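(* Let $0<s<1$ and suppose that either $n\ge 2$, or $n=1$ and $0<s<1/2$. For every $y>0$ let $$E_{s,y}(x)=\alpha(n,s)\,(y^2+|x|^2)^{-\frac{n-2s}{2}},\qquad x\in\mathbb R^n,\qquad \alpha(n,s)=\frac{\Gamma\left(\frac n2-s\right)}{2^{2s}\,\pi^{\frac n2}\,\Gamma(s)} .$$ Then (as tempered distributions) $$\widehat{E_{s,y}}(\xi)=\frac{y^s}{2^{2s-1}\,\pi^s\,\Gamma(s)}\,|\xi|^{-s}K_s(2\pi y|\xi|).$$ Consequently, with $E_s(x)=\alpha(n,s)|x|^{-(n-2s)}$, for every $\xi\ne 0$ $$\widehat{E_s}(\xi)=\lim_{y\to 0^+}\widehat{E_{s,y}}(\xi)=(2\pi|\xi|)^{-2s}.$$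
   Context: The Fourier transform is normalized as $\hat f(\xi)=\int_{\mathbb R^n}e^{-2\pi i\langle\xi,x\rangle}f(x)\,dx$ for $f\in\mathscr S(\mathbb R^n)$ (Schwartz space) and extended to tempered distributions by $\langle\hat T,f\rangle=\langle T,\hat f\rangle$. $K_\nu$ is the modified Bessel function of the third kind (Macdonald function): for non-integer $\nu$, $K_\nu(z)=\frac{\pi}{2}\,\frac{I_{-\nu}(z)-I_\nu(z)}{\sin\pi\nu}$, where $I_\nu(z)=\sum_{k=0}^\infty\frac{(z/2)^{\nu+2k}}{\Gamma(k+1)\Gamma(k+\nu+1)}$. *)

(* Defs.v *)
From HB Require Import structures.
From mathcomp Require Import all_boot all_order all_algebra.
From mathcomp Require Import all_classical all_reals all_analysis.
From mathcomp Require Import complex.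

Set Implicit Arguments.
Unset Strict Implicit.
Unset Printing Implicit Defensive.

Import Order.TTheory GRing.Theory Num.Theory.
Import numFieldNormedType.Exports.

Local Open Scope classical_set_scope.
Local Open Scope ring_scope.
Local Open Scope complex_scope.

(** Lebesgue measure on R^n, as the n-fold product of the Lebesgue measure
    of the line.  It lives on [n.-tuple R], which carries the product
    sigma-algebra, whereas ['rV[R]_n] carries the normed-space structure;
    [rV_of] identifies the two. *)
Section product_step.
Context {R : realType} (n : nat).
Variable mu : {sigma_finite_measure set (n.-tuple (measurableTypeR R)) -> \bar R}.

Definition tcons (p : measurableTypeR R * n.-tuple (measurableTypeR R)) :
  n.+1.-tuple (measurableTypeR R) := [the _.-tuple _ of p.1 :: p.2].

Let measurable_tcons : measurable_fun setT tcons.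
Proof.
by apply: measurable_cons; [exact: measurable_fst|exact: measurable_snd].
Qed.

Definition leb_cons : set (n.+1.-tuple (measurableTypeR R)) -> \bar R :=
  pushforward ((@lebesgue_measure R) \x mu)%E tcons.

Let leb_cons0 : leb_cons set0 = 0%E.
Proof. by rewrite /leb_cons /pushforward preimage_set0 measure0. Qed.

Let leb_cons_ge0 A : (0 <= leb_cons A)%E.
Proof. exact: measure_ge0. Qed.

Let leb_cons_sigma_additive : semi_sigma_additive leb_cons.
Proof.
move=> F mF tF mUF; rewrite /leb_cons /pushforward preimage_bigcup.
have mpre A : measurable A -> measurable (tcons @^-1` A).
  by move=> mA; rewrite -[X in measurable X]setTI; exact: measurable_tcons.
apply: measure_semi_sigma_additive.
- by move=> k; exact: mpre.
- apply/trivIsetP => i j _ _ ij; rewrite -preimage_setI.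
  by move/trivIsetP : tF => /(_ _ _ _ _ ij) ->//; rewrite preimage_set0.
- by rewrite -preimage_bigcup; exact: mpre.
Qed.

HB.instance Definition _ := isMeasure.Build _ _ _ leb_cons
  leb_cons0 leb_cons_ge0 leb_cons_sigma_additive.

Let leb_cons_sigma_finite : sigma_finite setT leb_cons.
Proof.
have [F TF mF] := @sigma_finiteT _ _ _ (@lebesgue_measure R).
have [G TG mG] := sigma_finiteT mu.
pose H (k : nat * nat) : set (n.+1.-tuple (measurableTypeR R)) :=
  [set t | F k.1 (thead t) /\ G k.2 (behead_tuple t)].
have mH k : measurable (H k).
  have -> : H k = ((@tnth _ _)^~ ord0 @^-1` F k.1) `&`
                  ((fun t : n.+1.-tuple (measurableTypeR R) =>
                     behead_tuple t : n.-tuple (measurableTypeR R)) @^-1` G k.2) by [].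
  apply: measurableI.
    rewrite -[X in measurable X]setTI.
    by apply: (measurable_tnth ord0) => //; have [] := mF k.1.
  rewrite -[X in measurable X]setTI.
  by apply: measurable_behead => //; have [] := mG k.2.
have preH k : tcons @^-1` H k = F k.1 `*` G k.2.
  apply/seteqP; split=> -[x t] /=; rewrite /H/= theadE.
    by move=> -[Fx Gt]; split => //=; move: Gt; congr (G _ _); exact: val_inj.
  by move=> -[Fx Gt]; split => //=; move: Gt; congr (G _ _); exact: val_inj.
exists (fun k => H (odflt (0, 0)%N (unpickle k))).
  apply/esym; rewrite -subTset => t _.
  have : setT (thead t) by [].
  rewrite TF => -[i _ Fi].
  have : setT (behead_tuple t) by [].
  rewrite TG => -[j _ Gj].
  by exists (pickle (i, j)) => //=; rewrite pickleK.
move=> k; set l := odflt _ _; split; first exact: mH.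
rewrite /leb_cons /pushforward preH.
have [mFk Fk] := mF l.1; have [mGk Gk] := mG l.2.
by rewrite product_measure1E// lte_mul_pinfty// ge0_fin_numE.
Qed.

HB.instance Definition _ := Measure_isSigmaFinite.Build _ _ _ leb_cons
  leb_cons_sigma_finite.

End product_step.

Fixpoint lebRn {R : realType} (n : nat) :
    {sigma_finite_measure set (n.-tuple (measurableTypeR R)) -> \bar R} :=
  match n with
  | 0 => [the {sigma_finite_measure set _ -> \bar R} of
           dirac ([tuple] : 0.-tuple (measurableTypeR R))]
  | n'.+1 => [the {sigma_finite_measure set _ -> \bar R} of
               leb_cons (lebRn n')]
  end.

Section euclidean.
Context {R : realType} {n : nat}.
Implicit Types (x xi : 'rV[R]_n) (f g : 'rV[R]_n -> R[i]).

Definition rV_of (t : n.-tuple (measurableTypeR R)) : 'rV[R]_n :=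
  \row_i (tnth t i : R).

Definition dotr xi x : R := \sum_(i < n) xi 0 i * x 0 i.

(* The library norm of ['rV[R]_n] is the sup norm. *)
Definition enorm x : R := Num.sqrt (dotr x x).

Definition Rn_integrable f : Prop :=
  (lebRn n).-integrable setT (fun t => (complex.Re (f (rV_of t)))%:E) /\
  (lebRn n).-integrable setT (fun t => (complex.Im (f (rV_of t)))%:E).

Definition Rn_integral f : R[i] :=
  (\int[lebRn n]_t complex.Re (f (rV_of t))) +i*
  (\int[lebRn n]_t complex.Im (f (rV_of t))).

Definition partial (i : 'I_n) (f : 'rV[R]_n -> R[i]) : 'rV[R]_n -> R[i] :=
  fun x => ('D_(delta_mx 0 i) (fun z => complex.Re (f z)) x : R) +i*
           ('D_(delta_mx 0 i) (fun z => complex.Im (f z)) x : R).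

Definition partials (s : seq 'I_n) f : 'rV[R]_n -> R[i] := foldr partial f s.

Definition smooth f : Prop := forall (s : seq 'I_n) x,
  differentiable (fun z => complex.Re (partials s f z)) x /\
  differentiable (fun z => complex.Im (partials s f z)) x.

(* [M] bounds the [N]-th Schwartz seminorm of [f]. *)
Definition seminorm_le (N : nat) f (M : R) : Prop :=
  forall (s : seq 'I_n) x, (size s <= N)%N ->
    (((1 + enorm x) ^+ N)%:C * `|partials s f x| <= M%:C)%R.

Definition schwartz f : Prop :=
  smooth f /\ forall N : nat, exists M : R, seminorm_le N f M.

Definition cis (t : R) : R[i] := cos t +i* sin t.

Definition fourier f : 'rV[R]_n -> R[i] := fun xi =>
  Rn_integral (fun x => cis (- (2 * pi * dotr xi x)) * f x).

(* Only the values of a functional at Schwartz functions are meaningful. *)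
Definition functional := ('rV[R]_n -> R[i]) -> R[i].
Implicit Types T : functional.

Definition tempered T : Prop :=
  (forall (a : R[i]) f g, schwartz f -> schwartz g ->
     T (fun x => a * f x + g x) = a * T f + T g) /\
  (exists (N : nat) (C : R), forall f (M : R), schwartz f ->
     seminorm_le N f M -> `|T f| <= (C * M)%:C).

Definition distr_eq T1 T2 : Prop := forall f, schwartz f -> T1 f = T2 f.

Definition distr_fourier T : functional := fun f => T (fourier f).

Definition distr_of (u : 'rV[R]_n -> R) : functional :=
  fun f => Rn_integral (fun x => (u x)%:C * f x).

Definition tempered_function (u : 'rV[R]_n -> R) : Prop :=
  (forall f, schwartz f -> Rn_integrable (fun x => (u x)%:C * f x)) /\
  tempered (distr_of u).

(* The function [u] is a tempered distribution and its Fourier transform is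
   (the tempered distribution given by) the function [g]. *)
Definition has_fourier (u g : 'rV[R]_n -> R) : Prop :=
  [/\ tempered_function u, tempered_function g &
      distr_eq (distr_fourier (distr_of u)) (distr_of g)].

End euclidean.

Section special_functions.
Context {R : realType}.
Implicit Types x z nu : R.

Definition Euler_integral x : R :=
  \int[@lebesgue_measure R]_(t in `]0, +oo[) (t `^ (x - 1) * expR (- t)).

(* Off the half-line [x > 0], Gamma is continued by
   Gamma(x) = Gamma(x + m) / (x (x + 1) ... (x + m - 1)), with x + m > 0.
   At the poles this gives 0, so that [(Gamma x)^-1] has its usual value 0. *)
Definition Gamma x : R :=
  let m := if 0 < x then 0%N else (Num.truncn (- x)).+1 in
  Euler_integral (x + m%:R) / \prod_(j < m) (x + j%:R).

(* Modified Bessel functions, for positive real argument. *)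
Definition besselI nu z : R :=
  limn (series (fun k : nat => (z / 2) `^ (nu + 2 * k%:R) /
    (Gamma (k%:R + 1) * Gamma (k%:R + nu + 1)))).

(* For non-integer [nu]. *)
Definition besselK nu z : R :=
  pi / 2 * ((besselI (- nu) z - besselI nu z) / sin (pi * nu)).

End special_functions.

Section kernels.
Context {R : realType} {n : nat}.
Implicit Types (s y : R) (x xi : 'rV[R]_n).

Definition riesz_const s : R :=
  Gamma (n%:R / 2 - s) / (2 `^ (2 * s) * pi `^ (n%:R / 2) * Gamma s).

Definition riesz_reg s y x : R :=
  riesz_const s * (y ^+ 2 + enorm x ^+ 2) `^ (- ((n%:R - 2 * s) / 2)).

(* At [x = 0] this has the junk value 0. *)
Definition riesz s x : R :=
  riesz_const s * enorm x `^ (- (n%:R - 2 * s)).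

Definition riesz_reg_hat s y xi : R :=
  y `^ s / (2 `^ (2 * s - 1) * pi `^ s * Gamma s) *
  enorm xi `^ (- s) * besselK s (2 * pi * y * enorm xi).

End kernels.
Arguments riesz_const {R} n s.

(* Main.v *)
Require Import Defs.
From mathcomp Require Import all_boot all_order all_algebra.
From mathcomp Require Import all_classical all_reals all_analysis.
From mathcomp Require Import measurable_realfun ring lra.
Set Implicit Arguments.
Unset Strict Implicit.
Unset Printing Implicit Defensive.
Import Order.TTheory GRing.Theory Num.Theory.
Import numFieldNormedType.Exports.
Local Open Scope classical_set_scope.
Local Open Scope ring_scope.

(** Both kernels are superpositions of Gaussians ("subordination"): by Euler's
    integral, with t = exp tau,
      (y^2 + |x|^2)^(-p) Gamma(p)
        = int exp(p tau - (y^2 + |x|^2) exp tau) dtau,     p = n/2 - s,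
    and the Fourier transform of exp(- t |x|^2) is
    (pi / t)^(n/2) exp(- pi^2 |xi|^2 / t).  Exchanging the two integrals against a
    Schwartz function and changing tau into - tau, the transform of the left-hand
    side is pi^(n/2) times
      int exp(s tau - pi^2 |xi|^2 exp tau - y^2 exp(- tau)) dtau,
    a Macdonald integral, which at y = 0 reduces to Gamma(s) (pi |xi|)^(- 2 s).  As
    K_s is defined by a series, its integral representation is obtained from the
    differential equation that both expressions satisfy, together with their
    behaviour at 0 and the reflection formula for Gamma.  The case y = 0 of the
    duality is not a limit: the argument applies to it verbatim. *)

(** Every auxiliary integral runs over the whole line, after t = exp tau: there are no endpoints to
    treat, and a bound by a multiple of [sech], that is, exponential decay at both ends, settles
    integrability. The delicate exchange is that of tau with x. At tau = -oo it is the factor exp(p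
    tau) that decays, the Schwartz function providing integrability in x; at tau = +oo the Gaussian
    contributes exp(- n tau / 2) and leaves exp(- s tau). On the Fourier side p and s trade places,
    so both positivity conditions are used twice; p > 0 is what the hypothesis on n provides. The
    transform of a test function enters through its measurability and the bound [rfourier_decay].
    Complex values are split into cosine transforms with a phase, so that all the analysis is real;
    likewise the reflection formula comes from differentiating in the angle of a rotated ray. The
    identities between functions hold at every point, the origin included: a divergent integral of a
    nonnegative function has real value 0, and so has a power of 0 with nonzero exponent, so that
    degenerate points agree by default values. *)

Section generic.
Context d {T : measurableType d} {R : realType}.
Variable mu : {measure set T -> \bar R}.
Implicit Types f g : T -> R.

Lemma le_integrable_EFin f g : measurable_fun setT f ->
  (forall x, `|f x| <= g x) -> mu.-integrable setT (EFin \o g) ->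
  mu.-integrable setT (EFin \o f).
Proof.
move=> mf fg; apply: le_integrable => //; first exact/measurable_EFinP.
by move=> x _; rewrite lee_fin (le_trans (fg x))// ler_norm.
Qed.

Lemma dominated_convergence_EFin (f_ : nat -> T -> R) f g :
  (forall n, measurable_fun setT (f_ n)) ->
  (forall x, f_ ^~ x @ \oo --> f x) ->
  mu.-integrable setT (EFin \o g) ->
  (forall n x, `|f_ n x| <= g x) ->
  mu.-integrable setT (EFin \o f) /\
  \int[mu]_x f_ n x @[n --> \oo] --> \int[mu]_x f x.
Proof.
move=> mf ff ig fg.
have mf' : measurable_fun setT f.
  exact: (measurable_fun_cvg mf (fun x _ => ff x)).
have [] := @dominated_convergence _ _ _ mu setT measurableT
  (fun n x => (f_ n x)%:E) (EFin \o f) (EFin \o g).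
- by move=> n; exact/measurable_EFinP.
- exact/measurable_EFinP.
- by apply: aeW => x _ /=; apply: cvg_EFin; [exact: nearW|exact: ff].
- exact: ig.
- by apply: aeW => x n _; rewrite /= lee_fin.
move=> intf _ cvgf; split => //.
apply: fine_cvg; rewrite /Rintegral fineK//.
exact: integrable_fin_num.
Qed.

Lemma is_derive_Rintegral (f df : R -> T -> R) (G : T -> R) u v a :
  u < a < v ->
  (forall x, u < x < v -> mu.-integrable setT (EFin \o f x)) ->
  (forall x y, u < x < v -> is_derive x (1 : R) (f ^~ y) (df x y)) ->
  mu.-integrable setT (EFin \o G) ->
  (forall x y, u < x < v -> `|df x y| <= G y) ->
  is_derive a (1 : R) (fun x => \int[mu]_y f x y) (\int[mu]_y df a y).
Proof.
move=> uav intf dfE intG dfG.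
have I x : `]u, v[%classic x -> u < x < v by rewrite /= in_itv.
have Ia : `]u, v[%classic a by rewrite /= in_itv.
have d1E x y : `]u, v[%classic x -> partial1of2 f x y = df x y.
  by move=> /I /dfE h; rewrite partial1of2E; have := h y => ?; exact: derive_val.
have intf' x : `]u, v[%classic x -> mu.-integrable setT (EFin \o f x) by move=> /I; exact: intf.
have der x y : `]u, v[%classic x -> setT y -> derivable (f ^~ y) x 1.
  by move=> /I /dfE h _; have [] := h y.
have G0 y : 0 <= G y by rewrite (le_trans (normr_ge0 _) (dfG _ y uav)).
have ub x y : `]u, v[%classic x -> setT y -> `|partial1of2 f x y| <= G y.
  by move=> Ix _; rewrite d1E//; exact/dfG/I.
apply: DeriveDef.
  exact: (derivable_under_integral measurableT Ia intf' der G0 intG ub).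
rewrite -derive1E (differentiation_under_integral measurableT Ia intf' der G0 intG ub).
by apply: eq_Rintegral => y _; rewrite d1E.
Qed.

End generic.

(** * Integration on the real line *)

Section line.
Context {R : realType}.
Implicit Types f g F G : R -> R.
Local Notation mu := (@lebesgue_measure R).

Lemma is_derive_continuous F f :
  (forall x, is_derive x (1 : R) F (f x)) -> continuous F.
Proof.
move=> dF x; apply/differentiable_continuous/derivable1_diffP.
by have [] := dF x.
Qed.

Lemma cvg_ge0_integral_itvNn (f : R -> R) : measurable_fun setT f ->
  (forall x, 0 <= f x) ->
  (\int[mu]_(x in `[(- n%:R)%R, n%:R%R]) (f x)%:E)%E @[n --> \oo] -->
  (\int[mu]_x (f x)%:E)%E.
Proof.
move=> mf f0.
have UT : \bigcup_n `[- n%:R, n%:R]%classic = [set: R].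
  apply/seteqP; split=> // x _.
  exists (Num.bound `|x|) => //=; rewrite in_itv/= -ler_norml ltW//.
  exact: archi_boundP.
rewrite -UT.
apply: ge0_nondecreasing_set_cvg_integral => //=.
- apply/nondecreasing_seqP => n; apply/subsetPset/subset_itv; rewrite bnd_simp.
    by rewrite lerN2 ler_nat.
  by rewrite ler_nat.
- by move=> n; exact/measurable_funTS/measurable_EFinP.
- by move=> n x _; rewrite lee_fin.
Qed.

Lemma FTC_itv F f a b : (forall x, is_derive x (1 : R) F (f x)) ->
  continuous f -> a < b ->
  (\int[mu]_(x in `[a, b]) (f x)%:E = (F b - F a)%:E)%E.
Proof.
move=> dF cf ab; rewrite EFinB.
apply: continuous_FTC2 => //.
- exact: continuous_subspaceT.
- split.
  + by move=> x _; have [] := dF x.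
  + exact/cvg_at_right_filter/(is_derive_continuous dF).
  + exact/cvg_at_left_filter/(is_derive_continuous dF).
- by move=> x _; rewrite derive1E; exact: derive_val.
Qed.

(** The integrals over [-n, n] are [F n - F (- n)], at most [C + C], and they increase to the full
    integral. With arctangents as [F] this yields the majorants [sech] and [cauchy]. *)
Lemma ge0_integrable_derive F f C : (forall x, is_derive x (1 : R) F (f x)) ->
  continuous f -> (forall x, 0 <= f x) -> (forall x, `|F x| <= C) ->
  mu.-integrable setT (EFin \o f).
Proof.
move=> dF cf f0 FC.
have mf : measurable_fun setT f by exact: continuous_measurable_fun.
apply/integrableP; split; first exact/measurable_EFinP.
under eq_integral do rewrite /= ger0_norm//.
apply: (@le_lt_trans _ _ (C + C)%:E); last exact: ltry.
have fcvg := cvg_ge0_integral_itvNn mf f0.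
rewrite -(cvg_lim _ fcvg)//; apply: lime_le; first exact: cvgP fcvg.
near=> n; rewrite (FTC_itv dF)//.
  rewrite lee_fin; move: (FC n%:R) (FC (- n%:R)); rewrite !ler_norml.
  by move=> /andP[? ?] /andP[? ?]; lra.
rewrite gtrN// ltr0n; near: n; exact: nbhs_infty_gt.
Unshelve. all: end_near. Qed.

Lemma cvg_Rintegral_itv f (u : nat -> R) : mu.-integrable setT (EFin \o f) ->
  u n @[n --> \oo] --> +oo ->
  \int[mu]_(x in `[- u n, u n]) f x @[n --> \oo] --> \int[mu]_x f x.
Proof.
move=> intf uoo.
have /integrableP[/measurable_EFinP mf _] := intf.
under eq_fun do rewrite Rintegral_mkcond.
apply: (proj2 (@dominated_convergence_EFin _ _ _ mu
  (fun n => f \_ `[- u n, u n]) f (fun x => `|f x|) _ _ _ _)) => //.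
- move=> n; apply: (measurable_restrictT f _).1. exact: measurable_itv. exact: measurable_funTS.
- move=> x; apply: cvg_near_cst; near=> n.
  rewrite patchE mem_set//= in_itv/= -ler_norml.
  by near: n; move/cvgryPge : uoo; apply.
- exact: integrable_norm.
- move=> n x; rewrite patchE; case: ifPn => // _.
  by rewrite normr0.
Unshelve. all: end_near. Qed.

Lemma ge0_integral_opp (f : R -> \bar R) : measurable_fun setT f ->
  (forall x, 0 <= f x)%E -> (\int[mu]_x f (- x)%R = \int[mu]_x f x)%E.
Proof.
move=> mf f0.
rewrite -[in LHS](preimage_setT (-%R : _ -> measurableTypeR R)).
rewrite -ge0_integral_pushforward//=.
by apply: eq_measure_integral => //= A mA _; exact: lebesgue_measureN.
Qed.

Lemma integrable_opp f : mu.-integrable setT (EFin \o f) ->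
  mu.-integrable setT (EFin \o (fun x => f (- x))).
Proof.
move=> intf; have /measurable_EFinP mf := measurable_int _ intf.
apply/integrableP; split.
  by apply/measurable_EFinP; apply: (measurableT_comp mf).
have /integrableP[_] := intf; rewrite -ge0_integral_opp//.
by apply/measurable_EFinP; exact: measurableT_comp.
Qed.

(** The integral [c] is the limit of [F x - F (- x)] at +oo. If [c] were nonzero, this difference
    would stay above [|c| / 2] in absolute value on a half-line, against the integrability of [F].
    Every integration by parts below goes through this lemma. *)
Lemma Rintegral_derive_eq0 F f : (forall x, is_derive x (1 : R) F (f x)) ->
  continuous f -> mu.-integrable setT (EFin \o f) ->
  mu.-integrable setT (EFin \o F) -> \int[mu]_x f x = 0.
Proof.
move=> dF cf intf intF.
set c := (X in X = 0); apply/eqP/negPn/negP => c0.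
have Dc : F x - F (- x) @[x --> +oo] --> c.
  apply/cvg_pinftyP => u uoo.
  have := cvg_Rintegral_itv intf uoo; apply: cvg_trans.
  apply: near_eq_cvg; near=> n; rewrite /Rintegral (FTC_itv dF)// gtrN//.
  by near: n; move/cvgryPgt : uoo; apply.
have /cvgrPdist_lt/(_ (`|c| / 2)) := Dc.
rewrite divr_gt0 ?normr_gt0// => /(_ isT) [N [Nreal NH]].
pose h x := F x - F (- x).
have intFN : mu.-integrable setT (EFin \o (F \o -%R)) by exact: integrable_opp.
have inth : mu.-integrable setT (EFin \o h).
  exact: (integrableB measurableT intF intFN).
have /integrableP[_] := inth.
apply/negP; rewrite -leNgt leye_eq; apply/eqP.
have : ((`|c| / 2)%:E * mu `]N, +oo[ <= \int[mu]_x `|(EFin \o h) x|)%E.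
  rewrite -integral_cst//.
  apply: (@le_trans _ _ (\int[mu]_(x in `]N, +oo[) `|(EFin \o h) x|)%E).
    apply: ge0_le_integral => //.
    - by move=> x _; rewrite lee_fin divr_ge0.
    - apply/measurable_funTS/measurableT_comp => //.
      by have /integrableP[] := inth.
    - move=> x; rewrite /= in_itv/= andbT => Nx.
      rewrite lee_fin /h; have := NH _ Nx => /= hc.
      rewrite -[leRHS]opprK lerNr.
      have := ler_normB (c - (F x - F (- x))) (- (F x - F (-x))).
      rewrite opprK subrK normrN; lra.
  apply: ge0_subset_integral => //.
  apply/measurableT_comp => //.
  by have /integrableP[] := inth.
rewrite lebesgue_measure_itv/= ltry.
by rewrite addye// gt0_muley ?leye_eq ?lte_fin ?divr_gt0 ?normr_gt0// => /eqP.
Unshelve. all: end_near. Qed.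

Lemma integral_shift f c : continuous f -> (forall x, 0 <= f x) ->
  (\int[mu]_x (f (x + c))%:E = \int[mu]_x (f x)%:E)%E.
Proof.
move=> cf f0.
have dF x : is_derive x (1 : R) (fun x => x + c) 1.
  by apply: is_derive_eq; rewrite addr0.
have dE : (fun x : R => x + c)^`()%classic = cst 1.
  by apply/funext => x; rewrite derive1E; exact: derive_val.
rewrite (@increasing_ge0_integration_by_substitutionT _ (fun x => x + c) f)//.
- by apply: eq_integral => x _; rewrite dE /= [in RHS]/GRing.mul/= mulr1.
- by move=> x y; rewrite ltrD2r.
- by rewrite dE; exact: cst_continuous.
- by rewrite dE; exact: is_cvg_cst.
- by rewrite dE; exact: is_cvg_cst.
- by apply: cvg_addrr_Ny; exact: cvg_id.
- by apply: cvg_addrr; exact: cvg_id.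
Qed.

Lemma integral_scale f c : 0 < c -> continuous f -> (forall x, 0 <= f x) ->
  (\int[mu]_x (f x)%:E = \int[mu]_x (c * f (c * x))%:E)%E.
Proof.
move=> c0 cf f0.
have dF x : is_derive x (1 : R) (fun x => c * x) c.
  by apply: is_derive_eq; rewrite [LHS]mulr1.
have dE : (fun x : R => c * x)^`()%classic = cst c.
  by apply/funext => x; rewrite derive1E; exact: derive_val.
rewrite (@increasing_ge0_integration_by_substitutionT _ (fun x => c * x) f)//.
- by apply: eq_integral => x _; rewrite dE /= [in LHS]/GRing.mul/= mulrC.
- by move=> x y; rewrite ltr_pM2l.
- by rewrite dE; exact: cst_continuous.
- by rewrite dE; exact: is_cvg_cst.
- by rewrite dE; exact: is_cvg_cst.
- by apply: gt0_cvgMrNy => //; exact: cvg_id.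
- by apply: gt0_cvgMry => //; exact: cvg_id.
Qed.

End line.

Section fubini.
Context d1 d2 {T1 : measurableType d1} {T2 : measurableType d2} {R : realType}.
Variables (m1 : {sigma_finite_measure set T1 -> \bar R})
  (m2 : {sigma_finite_measure set T2 -> \bar R}).

(** The inner real integrals are [fine] of the extended ones; both agree wherever the section is
    integrable, hence almost everywhere. *)
Lemma Rintegral_fubini (f : T1 * T2 -> R) :
  (m1 \x m2)%E.-integrable setT (EFin \o f) ->
  \int[m1]_x \int[m2]_y f (x, y) = \int[m2]_y \int[m1]_x f (x, y).
Proof.
move=> intf; rewrite /Rintegral.
have := Fubini intf.
have F1 := measurable_fubini_F intf.
have F2 := measurable_fubini_G intf.
have A1 := ae_integrable1 intf.
have A2 := ae_integrable2 intf.
move=> FG.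
rewrite [LHS](_ : _ = fine (\int[m1]_x \int[m2]_y (f (x, y))%:E)%E); last first.
  congr fine; apply: ae_eq_integral => //.
    by apply/measurable_EFinP; apply: measurableT_comp F1.
  case: A1 => N [mN N0 HN]; exists N; split => // x /= nx; apply: HN => /= ix.
  by apply: nx => _; rewrite fineK//; exact: integrable_fin_num ix.
rewrite [RHS](_ : _ = fine (\int[m2]_y \int[m1]_x (f (x, y))%:E)%E) ?FG//.
congr fine; apply: ae_eq_integral => //.
  by apply/measurable_EFinP; apply: measurableT_comp F2.
case: A2 => N [mN N0 HN]; exists N; split => // x /= nx; apply: HN => /= ix.
by apply: nx => _; rewrite fineK//; exact: integrable_fin_num ix.
Qed.

End fubini.

(** * Syntactic rules and tactics for derivatives and continuity *)

Section derivation_rules.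
Context {R : realType}.
Implicit Types (f g : R -> R) (x a b c : R).

Lemma der_cst x c : is_derive x (1 : R) (fun _ : R => c) 0.
Proof. exact: is_derive_cst. Qed.

Lemma der_id x : is_derive x (1 : R) (fun x : R => x) 1.
Proof. exact: is_derive_id. Qed.

Lemma der_add f g x a b : is_derive x (1 : R) f a -> is_derive x (1 : R) g b ->
  is_derive x (1 : R) (fun x => f x + g x) (a + b).
Proof. by move=> ? ?; exact: is_deriveD. Qed.

Lemma der_opp f x a : is_derive x (1 : R) f a ->
  is_derive x (1 : R) (fun x => - f x) (- a).
Proof. by move=> ?; exact: is_deriveN. Qed.

Lemma der_mul f g x a b : is_derive x (1 : R) f a -> is_derive x (1 : R) g b ->
  is_derive x (1 : R) (fun x => f x * g x) (a * g x + f x * b).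
Proof.
by move=> ? ?; apply: is_derive_eq; rewrite addrC [_ *: a]mulrC.
Qed.

Lemma der_inv f x a : f x != 0 -> is_derive x (1 : R) f a ->
  is_derive x (1 : R) (fun x => (f x)^-1) (- a / f x ^+ 2).
Proof.
move=> fx0 df; apply: (is_derive_eq (is_deriveV fx0 df)).
by rewrite [LHS]mulrC mulNr mulrN.
Qed.

Lemma der_exp f n x a : is_derive x (1 : R) f a ->
  is_derive x (1 : R) (fun x => f x ^+ n) (n%:R * f x ^+ n.-1 * a).
Proof.
move=> df; have := is_deriveX n df.
by rewrite (_ : (_ ^+ n)%R = fun x => f x ^+ n) ?exprfctE.
Qed.

Lemma der_expR f x a : is_derive x (1 : R) f a ->
  is_derive x (1 : R) (fun x => expR (f x)) (expR (f x) * a).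
Proof.
by move=> df; exact: (@is_derive1_comp _ expR f x _ _ (is_derive_expR _) df).
Qed.

Lemma der_sin f x a : is_derive x (1 : R) f a ->
  is_derive x (1 : R) (fun x => sin (f x)) (cos (f x) * a).
Proof.
by move=> df; exact: (@is_derive1_comp _ sin f x _ _ (is_derive_sin _) df).
Qed.

Lemma der_cos f x a : is_derive x (1 : R) f a ->
  is_derive x (1 : R) (fun x => cos (f x)) (- sin (f x) * a).
Proof.
by move=> df; exact: (@is_derive1_comp _ cos f x _ _ (is_derive_cos _) df).
Qed.

Lemma der_atan f x a : is_derive x (1 : R) f a ->
  is_derive x (1 : R) (fun x => atan (f x)) ((1 + f x ^+ 2)^-1 * a).
Proof.
by move=> df; exact: (@is_derive1_comp _ atan f x _ _ (is_derive1_atan _) df).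
Qed.

End derivation_rules.

Ltac derive_step :=
  lazymatch goal with
  | |- is_derive _ _ (fun _ => ?c) _ => apply: der_cst
  | |- is_derive _ _ (fun x => x) _ => apply: der_id
  | |- is_derive _ _ (fun x => @?f x + @?g x) _ =>
      eapply (@der_add _ f g); derive_step
  | |- is_derive _ _ (fun x => - @?f x) _ => eapply (@der_opp _ f); derive_step
  | |- is_derive _ _ (fun x => (@?f x)^-1) _ =>
      eapply (@der_inv _ f); [idtac | derive_step]
  | |- is_derive _ _ (fun x => @?f x ^+ _) _ =>
      eapply (@der_exp _ f); derive_step
  | |- is_derive _ _ (fun x => @?f x * @?g x) _ =>
      eapply (@der_mul _ f g); derive_step
  | |- is_derive _ _ (fun x => expR (@?f x)) _ =>
      eapply (@der_expR _ f); derive_step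
  | |- is_derive _ _ (fun x => sin (@?f x)) _ =>
      eapply (@der_sin _ f); derive_step
  | |- is_derive _ _ (fun x => cos (@?f x)) _ =>
      eapply (@der_cos _ f); derive_step
  | |- is_derive _ _ (fun x => atan (@?f x)) _ =>
      eapply (@der_atan _ f); derive_step
  | |- _ => eassumption
  end.

(** Functions without a rule are closed by a hypothesis of the context. What remains is the
    nonvanishing of each inverted function, followed by the identity between the computed derivative
    and the announced one. *)
Ltac compute_derive := eapply is_derive_eq; [derive_step | ].

Lemma is_derive0_itv (R : realType) (f : R -> R) (a b x y : R) :
  (forall z : R, a < z < b -> is_derive z (1 : R) f 0) ->
  a < x < b -> a < y < b -> f x = f y.
Proof.
move=> df; wlog xy : x y / x < y => [H|].
  by move=> ? ?; have [/H->//|/H->//|->//] := ltgtP x y.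
move=> /andP[ax xb] /andP[ay yb].
have [||c _] := @MVT _ f (cst 0) _ _ xy.
- move=> z; rewrite in_itv/= => /andP[xz zy].
  by apply: df; rewrite (lt_trans ax xz) (lt_trans zy yb).
- apply: derivable_within_continuous => z; rewrite in_itv/= => /andP[xz zy].
  have : a < z < b by rewrite (lt_le_trans ax xz) (le_lt_trans zy yb).
  by move=> /df [].
by rewrite mul0r => /subr0_eq ->.
Qed.

Section continuity_rules.
Context {R : realType}.
Implicit Types (f g : R -> R).

Lemma ctsD f g : continuous f -> continuous g -> continuous (fun x => f x + g x).
Proof. by move=> cf cg x; apply: cvgD; [exact: cf|exact: cg]. Qed.

Lemma ctsM f g : continuous f -> continuous g -> continuous (fun x => f x * g x).
Proof. by move=> cf cg x; apply: cvgM; [exact: cf|exact: cg]. Qed.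

Lemma ctsN f : continuous f -> continuous (fun x => - f x).
Proof. by move=> cf x; apply: cvgN; exact: cf. Qed.

Lemma ctsV f : (forall x, f x != 0) -> continuous f -> continuous (fun x => (f x)^-1).
Proof. by move=> f0 cf x; apply: cvgV; [exact: f0|exact: cf]. Qed.

Lemma ctsX f n : continuous f -> continuous (fun x => f x ^+ n).
Proof.
move=> cf x; apply: (@continuous_comp _ _ _ f (fun y => y ^+ n)); first exact: cf.
exact: exprn_continuous.
Qed.

Lemma cts_expR f : continuous f -> continuous (fun x => expR (f x)).
Proof.
move=> cf x; apply: (@continuous_comp _ _ _ f expR); first exact: cf.
exact: continuous_expR.
Qed.

Lemma cts_sin f : continuous f -> continuous (fun x => sin (f x)).
Proof.
move=> cf x; apply: (@continuous_comp _ _ _ f sin); first exact: cf.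
exact: continuous_sin.
Qed.

Lemma cts_cos f : continuous f -> continuous (fun x => cos (f x)).
Proof.
move=> cf x; apply: (@continuous_comp _ _ _ f cos); first exact: cf.
exact: continuous_cos.
Qed.

End continuity_rules.

Ltac continuity :=
  lazymatch goal with
  | |- continuous (fun _ => ?c) => exact: cst_continuous
  | |- continuous (fun x => x) => move=> ?; exact: cvg_id
  | |- continuous (fun x => @?f x + @?g x) => apply: (@ctsD _ f g); continuity
  | |- continuous (fun x => - @?f x) => apply: (@ctsN _ f); continuity
  | |- continuous (fun x => (@?f x)^-1) =>
      apply: (@ctsV _ f); [idtac | continuity]
  | |- continuous (fun x => @?f x ^+ _) => apply: (@ctsX _ f); continuity
  | |- continuous (fun x => @?f x * @?g x) => apply: (@ctsM _ f g); continuity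
  | |- continuous (fun x => expR (@?f x)) => apply: (@cts_expR _ f); continuity
  | |- continuous (fun x => sin (@?f x)) => apply: (@cts_sin _ f); continuity
  | |- continuous (fun x => cos (@?f x)) => apply: (@cts_cos _ f); continuity
  | |- _ => idtac
  end.

(** * Euler's integral in exponential form *)

Section gamma.
Context {R : realType}.
Implicit Types (x p r q s : R) (f : R -> R).
Local Notation mu := (@lebesgue_measure R).

(** The left-hand side is maximal at x = ln (c / r), with the right-hand side as value; centred
    there, the inequality is 1 + y <= exp y. *)
Lemma ler_lin_expR c r x : 0 < c -> 0 < r ->
  c * x - r * expR x <= c * ln (c / r) - c.
Proof.
move=> c0 r0; set y := x - ln (c / r).
have cr0 : 0 < c / r by rewrite divr_gt0.
have -> : x = ln (c / r) + y by rewrite /y addrC subrK.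
rewrite expRD lnK ?posrE// [r * _]mulrA [r * _]mulrC divfK ?gt_eqF//.
rewrite mulrDr -addrA lerD2l -mulrBr -[- c]mulrN1 ler_pM2l//.
by have := expR_ge1Dx y; lra.
Qed.

(** Half the hyperbolic secant of q x. It decays exponentially at both ends and has the elementary
    primitive atan (exp (q x)) / q; a bound by [C * sech q x] amounts to one exponential bound at
    each end, by [le_sech]. *)
Definition sech q x : R := (expR (q * x) + expR (- (q * x)))^-1.

Lemma sech_gt0 q x : 0 < sech q x.
Proof. by rewrite invr_gt0 addr_gt0 ?expR_gt0. Qed.

Lemma integrable_sech q : 0 < q -> mu.-integrable setT (EFin \o sech q).
Proof.
move=> q0; pose F x := atan (expR (q * x)) / q.
have E0 x : expR (q * x) + expR (- (q * x)) != 0.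
  by rewrite gt_eqF// addr_gt0 ?expR_gt0.
apply: (@ge0_integrable_derive _ F _ (pi / q)).
- move=> x; rewrite /F /sech; compute_derive.
  have e0 : expR (q * x) != 0 by rewrite gt_eqF ?expR_gt0.
  have := E0 x; rewrite expRN => E0x.
  have e1 : 0 < expR (q * x) by exact: expR_gt0.
  move: e1 e0 E0x; set e := expR _ => e1 e0 E0x. field.
  by rewrite e0 (gt_eqF q0) gt_eqF// ltr_pwDr// mulr_ge0// ltW.
- apply: (@is_derive_continuous _ (sech q) (fun x => - (q * expR (q * x) - q * expR (- (q * x)))
      / (expR (q * x) + expR (- (q * x))) ^+ 2)) => x.
  rewrite /sech; compute_derive; [exact: E0|].
  by congr (_ / _); ring.
- by move=> x; rewrite ltW// sech_gt0.
- move=> x; rewrite /F normrM normfV (gtr0_norm q0) ler_pM2r ?invr_gt0// ler_norml.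
  have := @atan_gtNpi2 _ (expR (q * x)); have := @atan_ltpi2 _ (expR (q * x)).
  by have := @pi_gt0 R; lra.
Qed.

Lemma integrable_le_sech q C f : 0 < q -> measurable_fun setT f ->
  (forall x, `|f x| <= C * sech q x) -> mu.-integrable setT (EFin \o f).
Proof.
move=> q0 mf fC; apply: (@le_integrable_EFin _ _ _ mu f (fun x => C * sech q x)) => //.
exact: (integrableZl measurableT C (integrable_sech q0)).
Qed.

Lemma le_sech q C y x : y * expR (q * x) + y * expR (- (q * x)) <= C ->
  y <= C * sech q x.
Proof. by rewrite -mulrDr -ler_pdivlMr ?invrK// addr_gt0 ?expR_gt0. Qed.

Lemma continuous_gammaf p r : continuous (fun x => expR (p * x - r * expR x)).
Proof.
apply: (@is_derive_continuous _ _
  (fun x => expR (p * x - r * expR x) * (p - r * expR x))) => x.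
by compute_derive; congr (_ * _); ring.
Qed.

Lemma integrable_gammaf p r : 0 < p -> 0 < r ->
  mu.-integrable setT (EFin \o (fun x => expR (p * x - r * expR x))).
Proof.
move=> p0 r0.
(* Multiplied by exp (p x), the integrand has exponent 2 p x - r exp x, bounded by [ler_lin_expR];
   multiplied by exp (- p x), it is exp (- r exp x) <= 1. *)
apply: (@integrable_le_sech p (expR ((p + p) * ln ((p + p) / r) - (p + p)) + 1)) => //.
  by apply: continuous_measurable_fun; exact: continuous_gammaf.
move=> x; rewrite ger0_norm ?expR_ge0//; apply: le_sech.
rewrite -!expRD; apply: lerD.
  rewrite ler_expR; have := @ler_lin_expR (p + p) r x; rewrite addr_gt0// => /(_ isT r0).
  by rewrite mulrDl; lra.
by rewrite -expR0 ler_expR addrAC subrr add0r oppr_le0 mulr_ge0 ?expR_ge0// ltW.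
Qed.

(* Euler's integral after the substitution [t = expR x]; see [GammaE]. *)
Definition gammaL p : R := \int[mu]_x expR (p * x - expR x).

(** Translating by [ln r] absorbs the factor [r]. The identity is kept in the extended reals to be
    usable under Tonelli in [gammaL_beta]. *)
Lemma integral_gammaf p r : 0 < p -> 0 < r ->
  (\int[mu]_x (expR (p * x - r * expR x))%:E =
   (expR (- (p * ln r)) * gammaL p)%:E)%E.
Proof.
move=> p0 r0.
have ig := integrable_gammaf p0 ltr01.
rewrite EFinM /gammaL /Rintegral fineK; last first.
  by apply: integrable_fin_num => //; move: ig; under eq_fun do rewrite mul1r.
rewrite -[in RHS](@integral_shift _ _ (ln r)); last 2 first.
- by have := @continuous_gammaf p 1; under eq_fun do rewrite mul1r.
- by move=> x; rewrite expR_ge0.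
rewrite -ge0_integralZl//.
- apply: eq_integral => x _; rewrite -EFinM -expRD; congr (expR _)%:E.
  by rewrite expRD lnK ?posrE//; ring.
- apply/measurable_EFinP; apply: continuous_measurable_fun => x.
  apply: (@continuous_comp _ _ _ (fun x => x + ln r) (fun x => expR (p * x - expR x))).
    by apply: cvgD; [exact: cvg_id|exact: cvg_cst].
  by have := @continuous_gammaf p 1; under eq_fun do rewrite mul1r; apply.
Qed.

Lemma Rintegral_gammaf p r : 0 < p -> 0 < r ->
  \int[mu]_x expR (p * x - r * expR x) = expR (- (p * ln r)) * gammaL p.
Proof. by move=> p0 r0; rewrite /Rintegral integral_gammaf. Qed.

(** The derivative of exp (p x - exp x) has integral 0. *)
Lemma gammaLS p : 0 < p -> gammaL (p + 1) = p * gammaL p.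
Proof.
move=> p0.
have i1 := integrable_gammaf p0 ltr01.
have i2 : mu.-integrable setT (EFin \o (fun x => expR ((p + 1) * x - 1 * expR x))).
  by apply: integrable_gammaf => //; rewrite addr_gt0.
have d : forall x, is_derive x (1 : R) (fun x => expR (p * x - 1 * expR x))
   (p * expR (p * x - 1 * expR x) - expR ((p + 1) * x - 1 * expR x)).
  move=> x; compute_derive.
  have -> : expR ((p + 1) * x - 1 * expR x) = expR x * expR (p * x - 1 * expR x).
    by rewrite -expRD; congr expR; ring.
  by ring.
have : \int[mu]_x (p * expR (p * x - 1 * expR x) - expR ((p + 1) * x - 1 * expR x)) = 0.
  apply: (Rintegral_derive_eq0 d) => //.
    move=> x; apply: cvgB; last exact: continuous_gammaf.
    by apply: cvgM; [exact: cvg_cst|exact: continuous_gammaf].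
  exact: (integrableB measurableT (integrableZl measurableT p i1) i2).
rewrite RintegralB//; last exact: (integrableZl measurableT p i1).
rewrite RintegralZl// !Rintegral_gammaf// ?addr_gt0//.
by rewrite ln1 !mulr0 oppr0 expR0 !mul1r => /subr0_eq.
Qed.

Lemma gammaL_gt0 p : 0 < p -> 0 < gammaL p.
Proof.
move=> p0; rewrite /gammaL.
have ig := integrable_gammaf p0 ltr01.
under eq_Rintegral do rewrite -[X in _ - X]mul1r.
(* On [0, 1] the integrand is at least exp (- exp 1), because p x >= 0 there. *)
apply: (@lt_le_trans _ _ (expR (- expR 1))); first exact: expR_gt0.
rewrite -lee_fin /Rintegral fineK; last exact: integrable_fin_num.
apply: (@le_trans _ _ (\int[mu]_(x in `[(0 : R)%R, (1 : R)%R]) (expR (p * x - 1 * expR x))%:E)%E).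
  apply: (@le_trans _ _ (\int[mu]_(x in `[(0 : R)%R, (1 : R)%R]) (expR (- expR 1))%:E)%E).
    have m01 : mu `[(0 : R), 1]%classic = 1%E.
      by rewrite lebesgue_measure_itv/= lte01 oppr0 adde0.
    by rewrite integral_cst//= [X in (_ * X)%E]m01 mule1.
  apply: ge0_le_integral => //=.
  - apply/measurable_funTS/measurable_EFinP; apply: continuous_measurable_fun.
    exact: continuous_gammaf.
  - move=> x /=; rewrite in_itv/= => /andP[x0 x1]; rewrite lee_fin ler_expR mul1r.
    by have : expR x <= expR 1 by [rewrite ler_expR]; have := mulr_ge0 (ltW p0) x0; lra.
apply: ge0_subset_integral => //.
- apply/measurable_EFinP; apply: continuous_measurable_fun.
  exact: continuous_gammaf.
Qed.

(** For p = 1 the integrand has the primitive - exp (- exp x), which goes from -1 to 0. *)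
Lemma gammaL1 : gammaL 1 = 1.
Proof.
have d (x : R) : is_derive x (1 : R) (fun x => - expR (- expR x)) (expR (1 * x - 1 * expR x)).
  by compute_derive; rewrite !mul1r expRD; ring.
have mf := continuous_measurable_fun (@continuous_gammaf 1 1).
have h := @cvg_ge0_integral_itvNn _ _ mf (fun x => expR_ge0 _).
rewrite integral_gammaf// ln1 mulr0 oppr0 expR0 mul1r in h.
have {}h : - expR (- expR n%:R) - - expR (- expR (- n%:R)) @[n --> \oo] --> gammaL 1.
  have h3 := fine_cvg h; apply: cvg_trans (h3 _).
  apply: near_eq_cvg; near=> n.
  rewrite /= (FTC_itv d (@continuous_gammaf 1 1))//.
  by rewrite gtrN// ltr0n; near: n; exact: nbhs_infty_gt.
have h2 : - expR (- expR (n%:R : R)) - - expR (- expR (- n%:R)) @[n --> \oo] --> (1 : R).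
  rewrite [X in _ --> X](_ : 1 = - 0 - - 1); last by rewrite oppr0 add0r opprK.
  apply: cvgB; apply: cvgN.
    apply: (@squeeze_cvgr _ _ _ _ (cst 0) (fun n => expR (- n%:R))).
    - near=> n; rewrite expR_ge0/= ler_expR lerN2.
      by have := expR_ge1Dx (n%:R : R); lra.
    - exact: cvg_cst.
    - exact: cvgn_expR.
  rewrite -[X in _ --> X]expR0.
  apply: (@cvg_comp _ _ _ (fun n => - expR (- n%:R)) expR _ (nbhs (0 : R))).
    by rewrite -oppr0; apply: cvgN; exact: cvgn_expR.
  exact: continuous_expR.
exact: (cvg_unique _ h h2).
Unshelve. all: end_near. Qed.

End gamma.

Ltac measurability :=
  lazymatch goal with
  | |- measurable_fun _ (fun x => @?f x + @?g x) =>
      apply: measurable_funD; measurability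
  | |- measurable_fun _ (fun x => @?f x * @?g x) =>
      apply: measurable_funM; measurability
  | |- measurable_fun _ (fun x => - @?f x) =>
      apply: measurable_funN; measurability
  | |- measurable_fun _ (fun x => @?f x ^+ _) =>
      apply: measurable_funX; measurability
  | |- measurable_fun _ (fun x => expR (@?f x)) =>
      apply: (@measurableT_comp _ _ _ _ _ _ expR _ f); [exact: measurable_expR | measurability]
  | |- measurable_fun _ (fun x => cos (@?f x)) =>
      apply: (@measurableT_comp _ _ _ _ _ _ cos _ f);
      [apply: continuous_measurable_fun; exact: continuous_cos | measurability]
  | |- measurable_fun _ (fun x => sin (@?f x)) =>
      apply: (@measurableT_comp _ _ _ _ _ _ sin _ f);
      [apply: continuous_measurable_fun; exact: continuous_sin | measurability]
  | |- measurable_fun _ (fun x => (@?f x)%:E) =>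
      apply/measurable_EFinP; measurability
  | |- measurable_fun _ (fun _ => ?c) => first [exact: measurable_cst | idtac]
  | |- _ => first [exact: measurable_id | exact: measurable_fst
                  | exact: measurable_snd | idtac]
  end.

(** * The beta integral B(s, 1 - s) *)

Section beta.
Context {R : realType}.
Implicit Types (x p r q s : R) (f : R -> R).
Local Notation mu := (@lebesgue_measure R).

(* The beta integral B(s, 1 - s), after the substitution [t / (1 - t) = expR x]. *)
Definition betaL s : R := \int[mu]_x (expR (s * x) / (1 + expR x)).

Lemma integrable_betaf s : 0 < s < 1 ->
  mu.-integrable setT (EFin \o (fun x => expR (s * x) / (1 + expR x))).
Proof.
(* The integrand behaves like exp (s x) at -oo and like exp (- (1 - s) x) at +oo; [q] is the slower
   of the two rates. *)
move=> /andP[s0 s1]; pose q := Num.min s (1 - s).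
have q0 : 0 < q by rewrite lt_min s0 subr_gt0.
have qs : q <= s by rewrite ge_min lexx.
have q1s : q <= 1 - s by rewrite ge_min lexx orbT.
have cf : continuous (fun x => expR (s * x) / (1 + expR x)).
  apply: (@is_derive_continuous _ _ (fun x =>
    (s * expR (s * x) * (1 + expR x) - expR (s * x) * expR x) / (1 + expR x) ^+ 2)) => x.
  have e0 : 1 + expR x != 0 by rewrite gt_eqF// addr_gt0 ?expR_gt0.
  by compute_derive => //; field.
apply: (@integrable_le_sech _ q 2) => //; first exact: continuous_measurable_fun.
move=> x.
have e0 : 0 < 1 + expR x by rewrite addr_gt0 ?expR_gt0.
rewrite ger0_norm; last by rewrite divr_ge0 ?expR_ge0 ?ltW.
apply: le_sech; rewrite -mulrDr mulrAC ler_pdivrMr// mulrDr -!expRD.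
have H u : 0 <= u <= 1 -> expR (u * x) <= 1 + expR x.
  move=> /andP[u0 u1]; have [x0|x0] := leP 0 x.
    apply: (@le_trans _ _ (expR x)); last by rewrite lerDr.
    by rewrite ler_expR; apply: ler_piMl.
  apply: (@le_trans _ _ 1); last by rewrite lerDl expR_ge0.
  by rewrite -expR0 ler_expR mulr_ge0_le0// ltW.
have := H (s + q); rewrite mulrDl => h1.
have := H (s - q); rewrite mulrBl => h2.
have {}h1 := h1 ltac:(lra); have {}h2 := h2 ltac:(lra); lra.
Qed.

(** Tonelli for exp (s x + y - exp y (1 + exp x)): integrating first in y gives [gammaL 1] times the
    beta integrand, and integrating first in x gives [gammaL s] times the integrand of
    [gammaL (1 - s)]. *)
Lemma gammaL_beta s : 0 < s < 1 -> gammaL s * gammaL (1 - s) = betaL s.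
Proof.
move=> s01; have /andP[s0 s1] := s01.
have s1' : 0 < 1 - s by rewrite subr_gt0.
apply: EFin_inj.
rewrite /betaL /Rintegral fineK; last exact: (integrable_fin_num measurableT (integrable_betaf
  s01)).
pose f (z : measurableTypeR R * measurableTypeR R) :=
  (expR (s * z.1 + (z.2 - expR z.2 * (1 + expR z.1))))%:E.
have f0 z : (0 <= f z)%E by rewrite lee_fin expR_ge0.
have E1 : (\int[mu]_x \int[mu]_y
   (expR (s * x + (y - expR y * (1 + expR x))))%:E =
   \int[mu]_x (expR (s * x) / (1 + expR x))%:E)%E.
  apply: eq_integral => x _.
  have e0 : 0 < 1 + expR x by rewrite addr_gt0 ?expR_gt0.
  transitivity (\int[mu]_y ((expR (s * x))%:E * (expR (1 * y - (1 + expR x) * expR y))%:E))%E.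
    by apply: eq_integral => y _; rewrite -EFinM -expRD mul1r [_ * expR y]mulrC.
  rewrite ge0_integralZl//.
  - rewrite integral_gammaf// gammaL1 mulr1 mul1r expRN lnK//.
  - by measurability.
have E2 : (\int[mu]_y \int[mu]_x
   (expR (s * x + (y - expR y * (1 + expR x))))%:E =
   (gammaL s * gammaL (1 - s))%:E)%E.
  transitivity (\int[mu]_y ((gammaL s)%:E * (expR ((1 - s) * y - 1 * expR y))%:E))%E.
    apply: eq_integral => y _.
    transitivity (\int[mu]_x ((expR (y - expR y))%:E * (expR (s * x - expR y * expR x))%:E))%E.
      apply: eq_integral => x _; rewrite -EFinM -[expR (y - _) * _]expRD; congr EFin; congr expR;
        ring.
    rewrite ge0_integralZl//.
    - rewrite integral_gammaf// ?expR_gt0// expRK -!EFinM; congr EFin.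
      by rewrite mulrA -[_ * expR (- _)]expRD [RHS]mulrC; congr (expR _ * _); ring.
    - by measurability.
  rewrite ge0_integralZl//.
  - by rewrite integral_gammaf// ln1 mulr0 oppr0 expR0 mul1r.
  - by measurability.
  - by rewrite lee_fin ltW// gammaL_gt0.
have mf : measurable_fun setT f.
  rewrite /f; measurability.
have T := @fubini_tonelli _ _ _ _ _ mu mu f mf f0.
exact: (etrans (esym E2) (etrans (esym T) E1)).
Qed.

(** Dominated convergence: the integrand for a parameter in [a, b] is at most the one for [b] where
    x >= 0 and the one for [a] where x < 0. *)
Lemma cvg_gammaL (p_ : nat -> R) p a b : 0 < a -> (forall n, a <= p_ n <= b) ->
  p_ @ \oo --> p -> gammaL (p_ n) @[n --> \oo] --> gammaL p.
Proof.
move=> a0 pab pp.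
have b0 : 0 < b by have /andP[h1 h2] := pab 0%N; lra.
apply: (proj2 (@dominated_convergence_EFin _ _ _ mu
  (fun n x => expR (p_ n * x - expR x)) _
  (fun x => expR (a * x - 1 * expR x) + expR (b * x - 1 * expR x)) _ _ _ _)).
- by move=> n; measurability.
- move=> x; apply: (@cvg_comp _ _ _ (fun n => p_ n * x - expR x) expR _ (nbhs (p * x - expR x))).
    by apply: cvgB; [apply: cvgM => //; exact: cvg_cst|exact: cvg_cst].
  exact: continuous_expR.
- exact: (integrableD measurableT (integrable_gammaf a0 ltr01) (integrable_gammaf b0 ltr01)).
- move=> n x; rewrite mul1r ger0_norm ?expR_ge0//; have /andP[h1 h2] := pab n.
  have [x0|x0] := leP 0 x.
    apply: (@le_trans _ _ (expR (b * x - expR x))); last by rewrite lerDr expR_ge0.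
    by rewrite ler_expR lerB// ler_wpM2r.
  apply: (@le_trans _ _ (expR (a * x - expR x))); last by rewrite lerDl expR_ge0.
  by rewrite ler_expR lerB// ler_wnM2r// ltW.
Qed.

End beta.

(** * The reflection formula for Gamma *)

Section reflection.
Context {R : realType}.
Implicit Types (x p r q s t u c : R) (f : R -> R).
Local Notation mu := (@lebesgue_measure R).

Section rotation.
Variables (s phi : R).
Hypothesis s01 : 0 < s < 1.

(* With [z = exp (x + i t)], [rot t x] and [- rotc t x] are the real and imaginary
   parts of [exp (i phi) z^s / (1 + z)].  By the Cauchy-Riemann equation the
   [t]-derivative of [rot] is the [x]-derivative of [rotc], whose integral
   vanishes: the integral of [rot t] does not depend on [t]. *)
Let den t x := 1 + 2 * expR x * cos t + expR x ^+ 2.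
Let psi t := s * t + phi.
Let rot t x := expR (s * x) * (cos (psi t) + expR x * cos (t - psi t)) / den t x.
Let rotc t x := expR (s * x) * (expR x * sin (t - psi t) - sin (psi t)) / den t x.
Let drot t x := expR (s * x) *
  ((- s * sin (psi t) - (1 - s) * expR x * sin (t - psi t)) / den t x +
   (cos (psi t) + expR x * cos (t - psi t)) * (2 * expR x * sin t) / den t x ^+ 2).

(** [den t x] is |1 + z|^2. With u = exp x, the worst case cos t = - 1/2 leaves the difference 3/4
    (u - 1)^2. Any lower bound for cos t strictly between -1 and 0 would let the angle go slightly
    past pi / 2, as [rotation_const] requires. *)
Let den_ge t x : - (1 / 2) <= cos t -> (1 + expR x) ^+ 2 / 4 <= den t x.
Proof.
move=> ct; rewrite /den; have u0 := expR_gt0 x; move: (expR x) u0 => u u0.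
have := mulr_ge0 (ltW u0) (_ : 0 <= cos t + 1 / 2); rewrite -lerBlDr sub0r => /(_ ct).
have := sqr_ge0 (u - 1); nra.
Qed.

Let den_gt0 t x : - (1 / 2) <= cos t -> 0 < den t x.
Proof.
move=> /den_ge -/(_ x); apply: lt_le_trans.
by rewrite divr_gt0// exprn_gt0// addr_gt0 ?expR_gt0.
Qed.

Let den_neq0 t x : - (1 / 2) <= cos t -> den t x != 0.
Proof. by move=> /den_gt0 h; rewrite gt_eqF. Qed.

Let num_le t x a b : `|a| <= 1 -> `|b| <= 1 -> `|a + expR x * b| <= 1 + expR x.
Proof.
move=> a1 b1; rewrite (le_trans (ler_normD _ _))// lerD//.
by rewrite normrM (ger0_norm (expR_ge0 _)) ler_piMr// expR_ge0.
Qed.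

Let frac_le t x y : - (1 / 2) <= cos t -> `|y| <= 1 + expR x ->
  `|y / den t x| <= 4 / (1 + expR x).
Proof.
move=> ct y1; rewrite normrM normfV (gtr0_norm (den_gt0 _ ct)).
have u0 : 0 < 1 + expR x by rewrite addr_gt0 ?expR_gt0.
rewrite ler_pdivrMr ?den_gt0// mulrAC ler_pdivlMr// -ler_pdivrMl//.
rewrite mulrC (le_trans _ (den_ge x ct))// ler_pM2r// expr2 ler_pM2r//.
Qed.

Let frac2_le t x y : - (1 / 2) <= cos t -> `|y| <= 1 + expR x ->
  `|y * (2 * expR x * sin t) / den t x ^+ 2| <= 32 / (1 + expR x).
Proof.
move=> ct y1.
have -> : y * (2 * expR x * sin t) / den t x ^+ 2 =
  (y / den t x) * (2 * expR x * sin t / den t x) by rewrite expr2 invfM; ring.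
rewrite normrM.
have u0 : 0 < 1 + expR x by rewrite addr_gt0 ?expR_gt0.
apply: (@le_trans _ _ (4 / (1 + expR x) * 8)); last by rewrite mulrAC -natrM.
apply: ler_pM => //; first exact: frac_le.
rewrite normrM normfV (gtr0_norm (den_gt0 _ ct)) ler_pdivrMr ?den_gt0//.
rewrite 2!normrM (ger0_norm (expR_ge0 _)) ger0_norm//.
have := den_ge x ct; have := sin_max t; have := expR_gt0 x.
move: (expR x) (den t x) (`|sin t|) (normr_ge0 (sin t)) => u d z z0 up z1 h.
have : 2 * u * z <= 2 * u by rewrite ler_piMr// mulr_ge0// ltW.
nra.
Qed.

Let drot_le t x : - (1 / 2) <= cos t ->
  `|drot t x| <= 36 * (expR (s * x) / (1 + expR x)).
Proof.
move=> ct; have /andP[s0 s1] := s01.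
rewrite /drot normrM (ger0_norm (expR_ge0 _)) [leRHS]mulrCA ler_wpM2l ?expR_ge0//.
have -> : 36 / (1 + expR x) = 4 / (1 + expR x) + 32 / (1 + expR x) :> R by rewrite -mulrDl -natrD.
rewrite (le_trans (ler_normD _ _))// lerD//.
  apply: frac_le => //.
  have -> : - s * sin (psi t) - (1 - s) * expR x * sin (t - psi t) =
    - s * sin (psi t) + expR x * (- (1 - s) * sin (t - psi t)) by ring.
  apply: num_le => //; rewrite normrM normrN.
    by rewrite (ger0_norm (ltW s0)) mulr_ile1 ?sin_max// ltW.
  have s1' : 0 <= 1 - s by rewrite subr_ge0 ltW.
  by rewrite (ger0_norm s1') mulr_ile1 ?sin_max// gerBl ltW.
by apply: frac2_le => //; apply: num_le => //; exact: cos_max.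
Qed.

Let rot_le t x : - (1 / 2) <= cos t -> `|rot t x| <= 4 * (expR (s * x) / (1 + expR x)).
Proof.
move=> ct; rewrite /rot -mulrA normrM (ger0_norm (expR_ge0 _)) [leRHS]mulrCA ler_wpM2l ?expR_ge0//.
by apply: frac_le => //; apply: num_le => //; exact: cos_max.
Qed.

Let rotc_le t x : - (1 / 2) <= cos t -> `|rotc t x| <= 4 * (expR (s * x) / (1 + expR x)).
Proof.
move=> ct; rewrite /rotc -mulrA normrM (ger0_norm (expR_ge0 _)) [leRHS]mulrCA ler_wpM2l ?expR_ge0//.
by apply: frac_le => //; rewrite addrC; apply: num_le => //; rewrite ?normrN; exact: sin_max.
Qed.

Let is_derive_rot t x : - (1 / 2) <= cos t -> is_derive t (1 : R) (rot ^~ x) (drot t x).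
Proof.
move=> ct; rewrite /rot /drot /den /psi; compute_derive; first exact: den_neq0.
have := den_neq0 x ct; rewrite /den => d0.
by field.
Qed.

Let is_derive_rotc t x : - (1 / 2) <= cos t -> is_derive x (1 : R) (rotc t) (drot t x).
Proof.
move=> ct; rewrite /rotc /drot /den /psi; compute_derive; first exact: den_neq0.
have := den_neq0 x ct; rewrite /den => d0.
set p := s * t + phi; set u := expR x.
have H1 : sin (t - p) = sin t * cos p - cos t * sin p by rewrite sinB.
have H2 : sin p = sin t * cos (t - p) - cos t * sin (t - p).
  by rewrite -sinB opprB addrCA subrr addr0.
(* The Cauchy-Riemann equation with its denominators cleared; it follows from the subtraction
   formulas for sin (t - p) and for sin p = sin (t - (t - p)). *)
have key : (u * sin (t - p) - sin p) * (cos t + u) + (cos p + u * cos (t - p)) * sin t =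
   sin (t - p) * (1 + 2 * u * cos t + u ^+ 2).
  transitivity ((sin t * cos p - cos t * sin p) +
    u * (sin t * cos (t - p) - cos t * sin (t - p) + 2 * sin (t - p) * cos t - sin p)
    + u ^+ 2 * sin (t - p)); first by ring.
  by rewrite -H1 -H2; ring.
apply/eqP; rewrite -subr_eq0; apply/eqP.
move: (cos t) (sin t) (sin p) (cos p) (sin (t - p)) (cos (t - p)) key d0 {H1 H2} => c S S2 C2 S1
  C1 key d0.
rewrite [LHS](_ : _ = expR (s * x) * 2 * u * (S1 * (1 + 2 * u * c + u ^+ 2) -
  ((u * S1 - S2) * (c + u) + (C2 + u * C1) * S)) / (1 + 2 * u * c + u ^+ 2) ^+ 2).
  by rewrite key subrr mulr0 mul0r.
by field.
Qed.

Lemma rotation_const :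
  mu.-integrable setT (EFin \o rot (pi / 2)) /\
  cos phi * betaL s = \int[mu]_x rot (pi / 2) x.
Proof.
(* The derivative in t has to vanish on an open interval containing both 0 and pi / 2; [e] is the
   room to the right of pi / 2. *)
have [e e0 He] : exists2 e, 0 < e & forall t, `|t - pi / 2| < e -> - (1 / 2) <= cos t.
  have /cvgrPdist_lt/(_ (1 / 2)) := @continuous_cos R (pi / 2).
  rewrite divr_gt0// => /(_ isT)/nbhs_ballP[e /= e0 He].
  exists e => // t te; have := He t; rewrite /ball/= distrC => /(_ te).
  by rewrite cos_pihalf sub0r normrN ltr_norml => /andP[/ltW].
have ct t : - (pi / 2) < t < pi / 2 + e -> - (1 / 2) <= cos t.
  move=> /andP[t1 t2]; have [t3|t3] := leP t (pi / 2).
    have : 0 <= cos t by apply: cos_ge0_pihalf; rewrite t3 ltW.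
    by apply: le_trans; rewrite oppr_le0 divr_ge0.
  by apply: He; rewrite ger0_norm; lra.
have ig := integrable_betaf s01.
have igC C : mu.-integrable setT (EFin \o (fun x => C * (expR (s * x) / (1 + expR x)))).
  exact: (integrableZl measurableT C ig).
have crot t : - (1 / 2) <= cos t -> continuous (rot t).
  by move=> h; rewrite /rot /den; continuity => x; have := den_neq0 x h.
have cdrot t : - (1 / 2) <= cos t -> continuous (drot t).
  move=> h; rewrite /drot /den; continuity => x; have := den_neq0 x h => //.
  by rewrite expf_eq0.
have irot t : - (1 / 2) <= cos t -> mu.-integrable setT (EFin \o rot t).
  move=> h; apply: (@le_integrable_EFin _ _ _ mu _ _ _ _ (igC 4)).
    by apply: continuous_measurable_fun; exact: crot.
  by move=> x; exact: rot_le.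
have idrot t : - (1 / 2) <= cos t -> mu.-integrable setT (EFin \o drot t).
  move=> h; apply: (@le_integrable_EFin _ _ _ mu _ _ _ _ (igC 36)).
    by apply: continuous_measurable_fun; exact: cdrot.
  by move=> x; exact: drot_le.
have drot0 t : - (1 / 2) <= cos t -> \int[mu]_x drot t x = 0.
  move=> h; apply: (Rintegral_derive_eq0 (fun x => is_derive_rotc x h)) => //.
  - exact: cdrot.
  - exact: idrot.
  - apply: (@le_integrable_EFin _ _ _ mu _ _ _ _ (igC 4)).
      apply: continuous_measurable_fun.
      apply: (@is_derive_continuous _ (rotc t) (drot t)) => x.
      exact: is_derive_rotc.
    by move=> x; exact: rotc_le.
have d0 t : - (pi / 2) < t < pi / 2 + e -> is_derive t (1 : R) (fun t => \int[mu]_x rot t x) 0.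
  move=> h; rewrite -(drot0 t); last exact: ct.
  apply: (@is_derive_Rintegral _ _ _ mu _ _ _ _ _ _ h _ _ (igC 36)).
  - by move=> z /ct; exact: irot.
  - by move=> z y /ct; exact: is_derive_rot.
  - by move=> z y /ct; exact: drot_le.
have pi0 := @pi_gt0 R.
split; first by apply: irot; apply: ct; lra.
transitivity (\int[mu]_x rot 0 x); last first.
  by apply: (is_derive0_itv d0); lra.
rewrite /betaL -RintegralZl//; apply: eq_Rintegral => x _.
have u0 : 1 + expR x != 0 by rewrite gt_eqF// addr_gt0 ?expR_gt0.
rewrite /rot /den /psi mulr0 add0r sub0r cosN cos0 mulr1.
have -> : 1 + 2 * expR x + expR x ^+ 2 = (1 + expR x) ^+ 2 by ring.
by field.
Qed.

End rotation.

(** The phase is chosen so that at the angle t = pi / 2 one has [psi t = pi / 2]: the term cos (psi)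
    disappears and the other cosine is 1. What is left is exp ((s + 1) x) / (1 + exp (2 x)), a beta
    integrand in the variable 2 x. *)
Lemma betaL_double s : 0 < s < 1 ->
  betaL ((s + 1) / 2) = 2 * sin (pi * s / 2) * betaL s.
Proof.
move=> s01; have := rotation_const (pi / 2 - pi * s / 2) s01.
have -> : cos (pi / 2 - pi * s / 2) = sin (pi * s / 2) by rewrite -cosN opprB cosBpihalf.
set rot := (X in EFin \o X) => -[irot E].
rewrite -mulrA E -RintegralZl// /betaL /Rintegral (@integral_scale _ _ 2 (ltr0Sn _ 1));
  last 2 first.
- by continuity => x; rewrite gt_eqF// addr_gt0 ?expR_gt0.
- by move=> x; rewrite divr_ge0 ?expR_ge0// addr_ge0 ?expR_ge0.
congr fine; apply: eq_integral => x _; rewrite /rot; congr (EFin (_ * _)).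
have -> : s * (pi / 2) + (pi / 2 - pi * s / 2) = pi / 2 by ring.
rewrite cos_pihalf subrr cos0 mulr0 addr0 add0r mulr1 -expRD mulrA divfK//.
rewrite mulrDl mul1r expr2 -expRD; congr (_ / (_ + expR _)); ring.
Qed.

Lemma cvg_sin_div (x_ : nat -> R) : (forall n, x_ n != 0) ->
  x_ @ \oo --> 0 -> sin (x_ n) / x_ n @[n --> \oo] --> (1 : R).
Proof.
move=> x0 xx.
have /@ex_derive/cvg_ex[/= l sl] := is_derive_sin (0 : R).
have l1 : l = 1.
  have := @derive_val _ _ _ _ _ _ _ (is_derive_sin (0 : R)); rewrite cos0 => <-.
  by apply/esym/cvg_lim.
move: sl; rewrite l1 => /cvgr_dnbhsP/(_ _ (conj x0 xx)).
by under eq_fun do rewrite scaler1 addr0 sin0 subr0 [_ *: _]mulrC.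
Qed.

(* B(1 - d, d) sin(pi d) is unchanged when [d] is halved, by [betaL_double], and it
   tends to pi as [d] tends to 0. *)
Lemma gammaL_reflection s : 0 < s < 1 ->
  gammaL s * gammaL (1 - s) * sin (pi * s) = pi.
Proof.
pose h (d : R) := betaL (1 - d) * sin (pi * d).
have h2 d : 0 < d < 1 -> h d = h (d / 2).
  move=> d01; have d1 : 0 < 1 - d < 1 by lra.
  rewrite /h; have -> : 1 - d / 2 = (1 - d + 1) / 2 by field.
  rewrite betaL_double//.
  have -> : pi * d = (pi * (d / 2)) *+ 2 :> R by rewrite -mulr_natr -mulrA divfK.
  rewrite sin_mulr2n.
  have -> : sin (pi * (1 - d) / 2) = cos (pi * (d / 2)).
    by rewrite -[RHS]cosN -sinDpihalf; congr sin; field.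
  by rewrite mulrA -mulr_natr; ring.
move=> s01; have /andP[s0 s1] := s01.
pose d n : R := s / 2 ^+ n.+1.
have d0 n : 0 < d n by rewrite divr_gt0// exprn_gt0.
have d12 n : d n <= 1 / 2.
  rewrite /d ler_pdivrMr ?exprn_gt0// exprS mul1r mulKf//.
  by rewrite (le_trans (ltW s1))// exprn_ege1// ler1n.
have hd n : h s = h (d n).
  elim: n => [|n ->]; first by rewrite h2// /d expr1.
  rewrite h2; last by rewrite d0 (le_lt_trans (d12 n))// ltr_pdivrMr// mul1r ltr1n.
  by rewrite /d [in RHS]exprSr invfM mulrA.
have dcvg : d @ \oo --> (0 : R).
  rewrite -(mulr0 s); apply: cvgM; first exact: cvg_cst.
  rewrite (_ : (fun n => _) = fun n => (1 / 2 : R) ^+ n.+1); last first.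
    by apply/funext => n; rewrite div1r exprVn.
  by rewrite (cvg_shiftS (fun n => (1 / 2 : R) ^+ n)); apply: cvg_expr; rewrite ger0_norm//; lra.
(* The pole of Gamma at 0 is moved into the quotient sin (pi d) / (pi d) by Gamma(d) = Gamma(d + 1)
   / d; every factor now has a limit. *)
have hE n : h (d n) = gammaL (1 - d n) * gammaL (d n + 1) * (pi * (sin (pi * d n) / (pi * d n))).
  have dn := d0 n; have dn2 := d12 n.
  rewrite /h -gammaL_beta; last by lra.
  rewrite opprB addrCA subrr addr0 gammaLS//.
  have dn0 : d n != 0 by rewrite gt_eqF.
  have pi0 : pi != 0 :> R by rewrite gt_eqF// pi_gt0.
  by move: (pi : R) pi0 => q q0; field; rewrite q0 dn0.
have cvgh : h (d n) @[n --> \oo] --> gammaL 1 * gammaL 1 * (pi * 1).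
  under eq_fun do rewrite hE.
  apply: cvgM; first apply: cvgM.
  - apply: (@cvg_gammaL _ _ _ (1 / 2) 1) => //.
      by move=> n; have := d0 n; have := d12 n; lra.
    by rewrite -[X in _ --> X]subr0; apply: cvgB => //; exact: cvg_cst.
  - apply: (@cvg_gammaL _ _ _ 1 2) => //.
      by move=> n; have := d0 n; have := d12 n; lra.
    by rewrite -[X in _ --> X]add0r; apply: cvgD => //; exact: cvg_cst.
  apply: cvgM; first exact: cvg_cst.
  apply: cvg_sin_div; first by move=> n; rewrite mulf_neq0// gt_eqF// pi_gt0.
  by rewrite -(mulr0 pi); apply: cvgM => //; exact: cvg_cst.
have : h (d n) @[n --> \oo] --> h s.
  by under eq_fun do rewrite -hd; exact: cvg_cst.
move=> /(cvg_unique _ cvgh); rewrite gammaL1 !mul1r mulr1 => pihs.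
rewrite [RHS](pihs (@norm_hausdorff _ _)) /h -gammaL_beta; last by lra.
have -> : 1 - (1 - s) = s by ring.
by rewrite [gammaL s * _]mulrC.
Qed.

End reflection.

Section Gamma.
Context {R : realType}.
Implicit Types (x p r q s t u c : R) (f : R -> R).
Local Notation mu := (@lebesgue_measure R).

(** The substitution t = exp x is made on the compact intervals [exp (- n), exp n], away from the
    singularity of t^(p - 1) at 0; both sides then pass to the limit by monotone convergence. *)
Lemma GammaE p : 0 < p -> Gamma p = gammaL p.
Proof.
move=> p0; rewrite /Gamma p0 big_ord0 divr1 addr0 /Euler_integral /gammaL /Rintegral.
congr fine; pose g t := t `^ (p - 1) * expR (- t).
have gE (t : R) : 0 < t -> g t = expR ((p - 1) * ln t - t).
  by move=> t0; rewrite /g /powR gt_eqF// -expRD.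
have mg : measurable_fun setT g.
  by apply: measurable_funM; [exact: measurable_powR|apply: measurableT_comp].
have U : \bigcup_n `[expR (- n%:R) : R, expR n%:R]%classic = `]0, +oo[%classic.
  apply/seteqP; split => t /=.
    move=> [n _]; rewrite /= !in_itv/= andbT => /andP[h _].
    by rewrite (lt_le_trans _ h)// expR_gt0.
  rewrite in_itv/= andbT => t0.
  exists (Num.bound `|ln t|) => //=; rewrite in_itv/= -[t]lnK ?posrE// !ler_expR.
  by rewrite lnK ?posrE// -ler_norml ltW//; exact: archi_boundP.
have C1 : (\int[mu]_(t in `[expR (- n%:R), expR n%:R]) (g t)%:E)%E @[n --> \oo] -->
    (\int[mu]_(t in `]0%R, +oo[) (g t)%:E)%E.
  rewrite -U; apply: ge0_nondecreasing_set_cvg_integral => //=.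
  - apply/nondecreasing_seqP => n; apply/subsetPset/subset_itv; rewrite bnd_simp ler_expR.
      by rewrite lerN2 ler_nat.
    by rewrite ler_nat.
  - by move=> n; apply/measurable_EFinP; exact: measurable_funTS.
  - by move=> n x _; rewrite lee_fin mulr_ge0 ?powR_ge0 ?expR_ge0.
have cg : continuous (fun x => expR (p * x - expR x)) by continuity.
have C2 := cvg_ge0_integral_itvNn (continuous_measurable_fun cg) (fun x => expR_ge0 _).
have E n : (\int[mu]_(t in `[expR (- n%:R)%R, expR n%:R]) (g t)%:E =
  \int[mu]_(x in `[(- n%:R)%R, n%:R%R]) (expR (p * x - expR x))%:E)%E.
  have dE : (@expR R)^`()%classic = expR.
    by apply/funext => x; rewrite derive1E; exact: derive_val.
  rewrite (@integration_by_substitution_increasing _ expR g).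
  - apply: eq_integral => x _; rewrite dE /= [in LHS]/GRing.mul/= gE ?expR_gt0// expRK -expRD.
    by congr (expR _)%:E; ring.
  - by rewrite ge0_cp// ler0n.
  - by move=> x y _ _; rewrite ltr_expR.
  - by rewrite dE => x _; exact: continuous_expR.
  - by rewrite dE; apply/cvg_ex; exists (expR (- n%:R)); apply: cvg_at_right_filter;
    exact: continuous_expR.
  - by rewrite dE; apply/cvg_ex; exists (expR n%:R); apply: cvg_at_left_filter;
    exact: continuous_expR.
  - split.
    + by move=> x _; exact: derivable_expR.
    + by apply: cvg_at_right_filter; exact: continuous_expR.
    + by apply: cvg_at_left_filter; exact: continuous_expR.
  - apply: continuous_in_subspaceT => t; rewrite inE/= in_itv/= => /andP[h _].
    have t0 : 0 < t by rewrite (lt_le_trans _ h)// expR_gt0.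
    rewrite (_ : g = fun t => t `^ (p - 1) * expR (- t))//.
    apply: cvgM; last by apply: (@cts_expR _ (fun t => - t)); continuity.
    have [h1 _] := is_derive1_powR (p - 1) t0.
    by move/derivable1_diffP/differentiable_continuous : h1.
move: C1; under eq_fun do rewrite E.
by move=> C1; have := cvg_unique _ C1 C2; apply; exact: ereal_hausdorff.
Qed.

End Gamma.

(** * The Macdonald integral *)

Section macdonald.
Context {R : realType}.
Implicit Types (x p r q s t u c a : R) (f : R -> R).
Local Notation mu := (@lebesgue_measure R).

(* [mac s a] is 2 a^(s/2) K_s(2 sqrt a); see [besselKE]. *)
Definition macf s a x : R := expR (s * x - expR x - a * expR (- x)).
Definition mac s a : R := \int[mu]_x macf s a x.

Lemma continuous_macf s a : continuous (macf s a).
Proof. by rewrite /macf; continuity. Qed.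

Lemma measurable_macf s a : measurable_fun setT (macf s a).
Proof. by apply: continuous_measurable_fun; exact: continuous_macf. Qed.

Lemma macf_ge0 s a x : 0 <= macf s a x.
Proof. exact: expR_ge0. Qed.

Lemma macf_le_gammaf s a x : 0 <= a -> macf s a x <= expR (s * x - 1 * expR x).
Proof.
by move=> a0; rewrite ler_expR mul1r lerBlDr lerDl mulr_ge0// expR_ge0.
Qed.

(** The linear term s x is beaten by exp x on the right and by a exp (- x) on the left, each time
    through [ler_lin_expR]; the 1 in [c] makes the slope positive. *)
Lemma macf_bounded s a : 0 < a -> exists C, forall x, macf s a x <= C.
Proof.
move=> a0; pose c := `|s| + 1.
have c0 : 0 < c by rewrite ltr_wpDl.
exists (expR (Num.max (c * ln (c / 1) - c) (c * ln (c / a) - c))) => x.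
rewrite ler_expR le_max; have [x0|x0] := leP 0 x; apply/orP; [left|right].
  have := @ler_lin_expR _ c 1 x c0 ltr01; apply: le_trans.
  have h1 : s * x <= c * x by rewrite ler_wpM2r// /c; have := ler_norm s; lra.
  have h2 : 0 <= a * expR (- x) by rewrite mulr_ge0 ?expR_ge0// ltW.
  by rewrite mul1r; lra.
have := @ler_lin_expR _ c a (- x) c0 a0; apply: le_trans.
have h1 : s * x <= c * - x.
  rewrite mulrN -mulNr ler_wnM2r ?ltW// /c.
  by have := ler_norm (- s); rewrite normrN; lra.
by have := expR_ge0 x; lra.
Qed.

Lemma integrable_macf s a : 0 < a -> mu.-integrable setT (EFin \o macf s a).
Proof.
move=> a0; have [C1 H1] := macf_bounded (s + 1) a0.
have [C2 H2] := macf_bounded (s - 1) a0.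
apply: (@integrable_le_sech _ 1 (C1 + C2)) => //; first exact: measurable_macf.
move=> x; rewrite ger0_norm ?macf_ge0//; apply: le_sech.
rewrite -!expRD; apply: lerD.
  by apply: le_trans (H1 x); rewrite ler_expR; lra.
by apply: le_trans (H2 x); rewrite ler_expR; lra.
Qed.

Lemma mac0 s : mac s 0 = gammaL s.
Proof. by apply: eq_Rintegral => x _; rewrite /macf mul0r subr0. Qed.

Lemma cvg_mac s (a_ : nat -> R) : 0 < s -> (forall n, 0 <= a_ n) ->
  a_ @ \oo --> 0 -> mac s (a_ n) @[n --> \oo] --> gammaL s.
Proof.
move=> s0 a0 aa; rewrite -mac0.
apply: (proj2 (@dominated_convergence_EFin _ _ _ mu (fun n => macf s (a_ n)) (macf s 0) _ _ _
  (integrable_gammaf s0 ltr01) _)).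
- by move=> n; exact: measurable_macf.
- move=> x; apply: (@cvg_comp _ _ _ (fun n => s * x - expR x - a_ n * expR (- x)) expR _
    (nbhs (s * x - expR x - 0 * expR (- x)))); last exact: continuous_expR.
  by apply: cvgB; [exact: cvg_cst|apply: cvgM => //; exact: cvg_cst].
- by move=> n x; rewrite ger0_norm ?macf_ge0//; exact: macf_le_gammaf.
Qed.

(** The derivative of [macf s a] integrates to 0. Together with [is_derive_mac] this gives the
    differential equation used in [mac_hyp01]. *)
Lemma mac_rec s a : 0 < a -> s * mac s a = mac (s + 1) a - a * mac (s - 1) a.
Proof.
move=> a0.
have i0 := integrable_macf s a0.
have i1 := integrable_macf (s + 1) a0.
have i2 := integrable_macf (s - 1) a0.
have d : forall x, is_derive x (1 : R) (macf s a)
    (s * macf s a x - (macf (s + 1) a x - a * macf (s - 1) a x)).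
  move=> x; rewrite /macf; compute_derive.
  have -> : expR ((s + 1) * x - expR x - a * expR (- x)) =
    expR x * expR (s * x - expR x - a * expR (- x)).
    by rewrite -expRD; congr expR; ring.
  have -> : expR ((s - 1) * x - expR x - a * expR (- x)) =
    expR (- x) * expR (s * x - expR x - a * expR (- x)).
    by rewrite -expRD; congr expR; ring.
  by ring.
have iZ2 := integrableZl measurableT a i2.
have iZ0 := integrableZl measurableT s i0.
have iB := integrableB measurableT i1 iZ2.
have : \int[mu]_x (s * macf s a x - (macf (s + 1) a x - a * macf (s - 1) a x)) = 0.
  apply: (Rintegral_derive_eq0 d) => //.
    apply: ctsD; first by apply: ctsM; [exact: cst_continuous|exact: continuous_macf].
    apply: ctsN; apply: ctsD; first exact: continuous_macf.
    by apply: ctsN; apply: ctsM; [exact: cst_continuous|exact: continuous_macf].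
  exact: (integrableB measurableT iZ0 iB).
rewrite RintegralB// RintegralB// !RintegralZl// => /subr0_eq; exact.
Qed.

Lemma is_derive_mac s a : 0 < a -> is_derive a (1 : R) (mac s) (- mac (s - 1) a).
Proof.
move=> a0; have a20 : 0 < a / 2 by rewrite divr_gt0.
have -> : - mac (s - 1) a = \int[mu]_x (- macf (s - 1) a x).
  rewrite -[LHS]mulN1r /mac -RintegralZl//; last exact: integrable_macf.
  by apply: eq_Rintegral => x _; rewrite mulN1r.
(* [macf] decreases in its parameter, so on the interval from a / 2 to 2 a the derivative is
   dominated by its value at a / 2. *)
apply: (@is_derive_Rintegral _ _ _ mu (macf s) (fun a x => - macf (s - 1) a x)
  (macf (s - 1) (a / 2)) (a / 2) (2 * a)).
- by apply/andP; split; lra.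
- by move=> x /andP[ax _]; apply: integrable_macf; exact: lt_trans ax.
- move=> b x _; rewrite /macf; compute_derive.
  have -> : expR ((s - 1) * x - expR x - b * expR (- x)) =
    expR (- x) * expR (s * x - expR x - b * expR (- x)).
    by rewrite -expRD; congr expR; ring.
  by ring.
- exact: integrable_macf.
- move=> b x /andP[ab _]; rewrite normrN ger0_norm ?macf_ge0//.
  by rewrite ler_expR lerD2l lerN2 ler_wpM2r ?expR_ge0// ltW.
Qed.

(** The reflection of x followed by a translation by ln a exchanges exp x and a exp (- x). This is
    the evenness of K_s in s. *)
Lemma mac_sym s a : 0 < a -> mac (- s) a = expR (- (s * ln a)) * mac s a.
Proof.
move=> a0; rewrite /mac -RintegralZl//; last exact: integrable_macf.
rewrite /Rintegral; congr fine.
have mE : measurable_fun setT (EFin \o macf (- s) a).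
  by apply/measurable_EFinP; exact: measurable_macf.
rewrite -(ge0_integral_opp mE); last by move=> x; rewrite lee_fin macf_ge0.
rewrite -(@integral_shift _ (fun x => macf (- s) a (- x)) (- ln a)); last 2 first.
- by rewrite /macf; continuity.
- by move=> x; exact: macf_ge0.
apply: eq_integral => x _; rewrite /macf -expRD; congr (expR _)%:E.
have -> : expR (- (x - ln a)) = a * expR (- x) by rewrite opprB expRD lnK.
have -> : expR (- - (x - ln a)) = expR x / a by rewrite opprK expRD expRN lnK.
by field; exact: lt0r_neq0.
Qed.

End macdonald.

(** * Entire power series and the series 0F1 *)

Section entire_series.
Context {R : realType}.
Implicit Types (c : nat -> R) (x : R).

Definition entire c := forall x, cvgn (pseries c x).

Lemma entire_norm c x : entire c -> cvgn (pseries (fun i => `|c i|) x).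
Proof.
move=> ec; apply: (is_cvg_pseries_inside_norm (ec (`|x| + 1))).
by rewrite [ltRHS]ger0_norm ?ltrDl// addr_ge0.
Qed.

Lemma entire_diffs c : entire c -> entire (pseries_diffs c).
Proof.
(* The factor n + 1 produced by differentiation is at most 2^(n + 1), so doubling the radius absorbs
   it. *)
move=> ec x; pose X := 2 * (`|x| + 1).
have X0 : 0 < X by rewrite mulr_gt0// ltr_wpDl.
apply: normed_cvg; apply: (@series_le_cvg _ _ (fun i => `|c i.+1| * X ^+ i.+1)).
- by move=> n; rewrite normr_ge0.
- by move=> n; rewrite mulr_ge0// exprn_ge0// ltW.
- move=> n; rewrite /= !normrM mulrAC [leLHS]mulrC ler_wpM2l//.
  rewrite normrX ger0_norm// /X exprMn ler_pM//.
    rewrite -natrX ler_nat; exact/ltnW/ltn_expl.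
  rewrite exprS (@le_trans _ _ ((`|x| + 1) ^+ n))//.
    by rewrite lerXn2r ?nnegrE ?addr_ge0// lerDl.
  by rewrite ler_peMl ?exprn_ge0 ?addr_ge0// lerDr.
- have /cvg_ex[l /=] := @entire_norm _ X ec; rewrite -cvg_shiftS => h.
  apply/cvg_ex; exists (l - `|c 0%N| * X ^+ 0).
  apply: cvg_trans (cvgB h (cvg_cst (`|c 0%N| * X ^+ 0))).
  apply: near_eq_cvg; apply: nearW => n.
  rewrite [LHS](_ : _ = pseries (fun i => `|c i|) X n.+1 - `|c 0%N| * X ^+ 0)//.
  by rewrite /pseries /series/= big_nat_recl//= addrAC subrr add0r.
Qed.

Definition psum c x := limn (pseries c x).

Lemma is_derive_psum c x : entire c ->
  is_derive x (1 : R) (psum c) (psum (pseries_diffs c) x).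
Proof.
move=> ec; apply: (@pseries_snd_diffs _ c (`|x| + 1)).
- exact: ec.
- exact/entire_diffs.
- exact/entire_diffs/entire_diffs.
- by rewrite [ltRHS]ger0_norm ?ltrDl// addr_ge0.
Qed.

Lemma continuous_psum c : entire c -> continuous (psum c).
Proof. by move=> ec; apply: (is_derive_continuous (fun x => is_derive_psum x ec)). Qed.

Lemma psum_at0 c : psum c 0 = c 0%N.
Proof.
apply: lim_near_cst => //; exists 1%N => // -[//|n] _.
rewrite /pseries /series/= big_nat_recl// expr0 mulr1 big1 ?addr0// => i _.
by rewrite exprS mul0r mulr0.
Qed.

Lemma psum_ge c x : entire c -> (forall k, 0 <= c k) -> 0 <= x -> c 0%N <= psum c x.
Proof.
move=> ec c0 x0; apply: limr_ge; first exact: ec.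
exists 1%N => // -[//|n] _.
rewrite /pseries /series/= big_nat_recl// expr0 mulr1 lerDl.
by apply: sumr_ge0 => i _; rewrite mulr_ge0// exprn_ge0.
Qed.

End entire_series.

Section hyp01.
Context {R : realType}.
Implicit Types (s x : R).

(* The coefficients of the hypergeometric series 0F1(; s + 1; x). *)
Definition coef01 s (k : nat) : R := (\prod_(j < k) (j.+1%:R * (j.+1%:R + s)))^-1.

Lemma coef01S s k : -1 < s ->
  k.+1%:R * (k.+1%:R + s) * coef01 s k.+1 = coef01 s k.
Proof.
move=> s1; rewrite /coef01 big_ord_recr/= invfM [X in _ * X]mulrC mulrA divff ?mul1r//.
rewrite mulf_neq0// gt_eqF//.
by have : 1 <= k.+1%:R :> R by [rewrite ler1n]; lra.
Qed.

Lemma coef01_ge0 s k : -1 < s -> 0 <= coef01 s k.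
Proof.
move=> s1; rewrite invr_ge0 prodr_ge0// => j _; rewrite mulr_ge0//.
by have : 1 <= j.+1%:R :> R by [rewrite ler1n]; lra.
Qed.

(** Each factor j + 1 + s is at least [m], so the k-th coefficient is at most m^(- k) / k!:
    comparison with the exponential series at |x| / m. *)
Lemma entire_coef01 s : -1 < s -> entire (coef01 s).
Proof.
move=> s1 x; pose m := Num.min 1 (1 + s).
have m0 : 0 < m by rewrite lt_min ltr01/=; lra.
apply: normed_cvg; apply: (@series_le_cvg _ _ (exp_coeff (`|x| / m))).
- by move=> n; rewrite normr_ge0.
- by move=> n; rewrite exp_coeff_ge0// divr_ge0// ltW.
- move=> n; rewrite /= normrM normrX /exp_coeff /= exprMn -mulrA [leLHS]mulrC ler_wpM2l
  ?exprn_ge0//.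
  rewrite ger0_norm ?coef01_ge0// /coef01 exprVn -invfM lef_pV2 ?posrE; last 2 first.
  - rewrite prodr_gt0// => j _; rewrite mulr_gt0//.
    by have : 1 <= j.+1%:R :> R by [rewrite ler1n]; lra.
  - by rewrite mulr_gt0// ?exprn_gt0// ltr0n fact_gt0.
  rewrite fact_prod big_add1 /= big_mkord natr_prod.
  rewrite -[X in _ ^+ X]card_ord -prodr_const -big_split/=.
  apply: ler_prod => j _; apply/andP; split; first by rewrite mulr_ge0// ltW.
  rewrite [leLHS]mulrC ler_wpM2l//.
  have : 1 <= j.+1%:R :> R by rewrite ler1n.
  by rewrite /m ge_min; have [|] := leP 0 s; lra.
- exact: is_cvg_series_exp_coeff.
Qed.

Definition hyp01 s x := psum (coef01 s) x.
Definition dhyp01 s x := psum (pseries_diffs (coef01 s)) x.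
Definition ddhyp01 s x := psum (pseries_diffs (pseries_diffs (coef01 s))) x.

Lemma hyp01_ode s x : -1 < s ->
  x * ddhyp01 s x + (s + 1) * dhyp01 s x = hyp01 s x.
Proof.
move=> s1; have e0 := entire_coef01 s1.
have e1 := entire_diffs e0; have e2 := entire_diffs e1.
(* The factor x raises degrees by one, hence the truncation at [n] for the second derivative and at
   [n.+1] for the other two; coefficientwise this is [coef01S]. *)
have E n : pseries (coef01 s) x n.+1 =
    x * pseries (pseries_diffs (pseries_diffs (coef01 s))) x n +
    (s + 1) * pseries (pseries_diffs (coef01 s)) x n.+1.
  rewrite /pseries /series/= big_nat_recl// [in RHS]big_nat_recl//= !expr0 !mulr1.
  rewrite mulrDr addrCA -(coef01S 0 s1) /pseries_diffs; congr (_ + _); first by ring.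
  rewrite !mulr_sumr -big_split/=; apply: eq_bigr => i _.
  by rewrite -(coef01S i.+1 s1) exprS -natr1; ring.
have C1 : pseries (coef01 s) x n.+1 @[n --> \oo] --> hyp01 s x.
  by rewrite (cvg_shiftS (pseries (coef01 s) x)); exact: e0.
have C2 : pseries (coef01 s) x n.+1 @[n --> \oo] -->
    x * ddhyp01 s x + (s + 1) * dhyp01 s x.
  under eq_fun do rewrite E.
  apply: cvgD; apply: cvgM; [exact: cvg_cst|exact: e2|exact: cvg_cst|].
  by rewrite (cvg_shiftS (pseries (pseries_diffs (coef01 s)) x)); exact: e1.
exact: (cvg_unique _ C2 C1).
Qed.

Lemma is_derive_hyp01 s x : -1 < s -> is_derive x (1 : R) (hyp01 s) (dhyp01 s x).
Proof. by move=> /entire_coef01; exact: is_derive_psum. Qed.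

Lemma is_derive_dhyp01 s x : -1 < s -> is_derive x (1 : R) (dhyp01 s) (ddhyp01 s x).
Proof. by move=> /entire_coef01/entire_diffs; exact: is_derive_psum. Qed.

Lemma hyp01_0 s : hyp01 s 0 = 1.
Proof. by rewrite /hyp01 psum_at0 /coef01 big_ord0 invr1. Qed.

Lemma hyp01_gt0 s x : -1 < s -> 0 <= x -> 0 < hyp01 s x.
Proof.
move=> s1 x0; apply: (@lt_le_trans _ _ (coef01 s 0)); first by rewrite /coef01 big_ord0 invr1.
by apply: psum_ge => // [|k]; [exact: entire_coef01|exact: coef01_ge0].
Qed.

End hyp01.

(** * From the Macdonald integral to the Bessel series *)

Section bessel.
Context {R : realType}.
Implicit Types (x p r q s t u c a z : R) (f : R -> R).

(* The Wronskian of two solutions of w'' - s w' = e^q w is a multiple of e^(s q). *)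
Lemma wronskian_const s (w w1 w2 p p1 p2 : R -> R) :
  (forall q, is_derive q (1 : R) w (w1 q)) ->
  (forall q, is_derive q (1 : R) w1 (w2 q)) ->
  (forall q, is_derive q (1 : R) p (p1 q)) ->
  (forall q, is_derive q (1 : R) p1 (p2 q)) ->
  (forall q, w2 q - s * w1 q = expR q * w q) ->
  (forall q, p2 q - s * p1 q = expR q * p q) ->
  forall q r, expR (- (s * q)) * (w1 q * p q - w q * p1 q) =
              expR (- (s * r)) * (w1 r * p r - w r * p1 r).
Proof.
move=> dw dw1 dp dp1 ow op q r.
apply: (@is_derive_0_is_cst _ (fun q => expR (- (s * q)) * (w1 q * p q - w q * p1 q))) => {}q.
move: (dw q) (dw1 q) (dp q) (dp1 q) => dwq dw1q dpq dp1q.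
compute_derive.
have -> : w2 q = s * w1 q + expR q * w q by rewrite -ow; ring.
have -> : p2 q = s * p1 q + expR q * p q by rewrite -op; ring.
by ring.
Qed.

(* In the variable [q = ln a] both sides solve [w'' - s w' = e^q w].  The Wronskian of
   their difference [w] and of the solution [p q = hyp01 (- s) (expR q)] vanishes at
   [q = -oo], hence everywhere, so that [w / p] is a constant, which is 0. *)
Lemma mac_hyp01 s a : 0 < s < 1 -> 0 < a ->
  mac s a = gammaL s * hyp01 (- s) a - gammaL (1 - s) / s * (expR (s * ln a) * hyp01 s a).
Proof.
move=> /andP[s0 s1] a0.
have s1' : -1 < s by lra.
have sN1 : -1 < - s by lra.
set g := gammaL s; set g1 := gammaL (1 - s) / s.
pose p q := hyp01 (- s) (expR q).
pose p1 q := expR q * dhyp01 (- s) (expR q).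
pose p2 q := expR q * dhyp01 (- s) (expR q) + expR q ^+ 2 * ddhyp01 (- s) (expR q).
pose w q := mac s (expR q) - (g * p q - g1 * (expR (s * q) * hyp01 s (expR q))).
pose w1 q := - (expR q * mac (s - 1) (expR q)) -
  (g * p1 q - g1 * (expR (s * q) * (s * hyp01 s (expR q) + expR q * dhyp01 s (expR q)))).
pose w2 q := - (expR q * mac (s - 1) (expR q) - expR q ^+ 2 * mac (s - 1 - 1) (expR q)) -
  (g * p2 q - g1 * (expR (s * q) * (s * s * hyp01 s (expR q) +
     (s * 2 + 1) * expR q * dhyp01 s (expR q) + expR q ^+ 2 * ddhyp01 s (expR q)))).
have cmp (f df : R -> R) q : is_derive (expR q) (1 : R) f (df (expR q)) ->
    is_derive q (1 : R) (fun q => f (expR q)) (df (expR q) * expR q).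
  by move=> h; exact: (is_derive1_comp h (is_derive_expR q)).
have dm t q := cmp (mac t) (fun a => - mac (t - 1) a) q (is_derive_mac t (expR_gt0 q)).
have dh t q (h : -1 < t) := cmp _ _ q (is_derive_hyp01 (expR q) h).
have ddh t q (h : -1 < t) := cmp _ _ q (is_derive_dhyp01 (expR q) h).
have dp q : is_derive q (1 : R) p (p1 q).
  by rewrite /p /p1 [X in is_derive _ _ _ X]mulrC; exact: dh.
have dp1 q : is_derive q (1 : R) p1 (p2 q).
  have := ddh _ q sN1 => h; rewrite /p1 /p2.
  apply: (is_derive_eq (der_mul (is_derive_expR q) h)); ring.
have dw q : is_derive q (1 : R) w (w1 q).
  have h1 := dm s q; have h2 := dp q; have h3 := dh _ q s1'.
  rewrite /w /w1.
  apply: (is_derive_eq (der_add h1 (der_opp (der_add (der_mul (der_cst q g) h2)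
    (der_opp (der_mul (der_cst q g1) (der_mul (der_expR (der_mul (der_cst q s) (der_id q)))
      h3))))))).
  by ring.
have dw1 q : is_derive q (1 : R) w1 (w2 q).
  have h1 := dm (s - 1) q; have h2 := dp1 q; have h3 := dh _ q s1'; have h4 := ddh _ q s1'.
  rewrite /w1 /w2.
  apply: (is_derive_eq (der_add (der_opp (der_mul (is_derive_expR q) h1))
    (der_opp (der_add (der_mul (der_cst q g) h2)
    (der_opp (der_mul (der_cst q g1) (der_mul (der_expR (der_mul (der_cst q s) (der_id q)))
      (der_add (der_mul (der_cst q s) h3) (der_mul (is_derive_expR q) h4))))))))).
  by ring.
have op q : p2 q - s * p1 q = expR q * p q.
  by rewrite /p2 /p1 /p -(hyp01_ode (expR q) sN1); ring.
(* The differential equation of [mac]: the recurrence at [s - 1] eliminates the term of index s - 2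
   produced by the second derivative. *)
have ow q : w2 q - s * w1 q = expR q * w q.
  have := mac_rec (s - 1) (expR_gt0 q); rewrite subrK => m.
  have e1 := hyp01_ode (expR q) s1'.
  have E : mac s (expR q) = (s - 1) * mac (s - 1) (expR q) + expR q * mac (s - 1 - 1) (expR q).
    by rewrite m; ring.
  have lin (x y z e : R) : e * (x - (g * y - z)) = e * x - g * (e * y) + e * z by ring.
  by rewrite /w E -e1 lin -op /w2 /w1; ring.
have W := wronskian_const dw dw1 dp dp1 ow op.
pose a_ (n : nat) : R := expR (- n%:R).
have a_cvg : a_ @ \oo --> 0 by exact: cvgn_expR.
have pow_cvg t : 0 < t -> expR (t * - n%:R) @[n --> \oo] --> (0 : R).
  move=> t0; rewrite (_ : (fun n => _) = (fun n => expR (- t) ^+ n)); last first.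
    by apply/funext => n; rewrite -expRM_natl; congr expR; ring.
  apply: cvg_expr; rewrite ger0_norm ?expR_ge0// -expR0 ltr_expR; lra.
have cvg_hyp t : -1 < t -> hyp01 t (a_ n) @[n --> \oo] --> (1 : R).
  move=> t1; rewrite -(hyp01_0 t); apply: (cvg_comp _ _ a_cvg).
  exact: (continuous_psum (entire_coef01 t1)).
have cvg_dhyp t : -1 < t -> dhyp01 t (a_ n) @[n --> \oo] --> dhyp01 t 0.
  move=> t1; apply: (cvg_comp _ _ a_cvg).
  exact: (continuous_psum (entire_diffs (entire_coef01 t1))).
have cvg_m t : 0 < t -> mac t (a_ n) @[n --> \oo] --> gammaL t.
  by move=> t0; apply: cvg_mac => // n; rewrite expR_ge0.
have cst c : (fun _ : nat => c) @ \oo --> (c : R) by exact: cvg_cst.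
have w_cvg : w (- n%:R) @[n --> \oo] --> (0 : R).
  have -> : 0 = g - (g * 1 - g1 * (0 * 1)) by ring.
  apply: cvgB; first exact: cvg_m.
  apply: cvgB; apply: cvgM => //; first exact: cvg_hyp.
  by apply: cvgM; [exact: pow_cvg|exact: cvg_hyp].
have p_cvg : p (- n%:R) @[n --> \oo] --> (1 : R) by exact: cvg_hyp.
have s10 : 0 < 1 - s by lra.
(* The term with [mac (s - 1)] tends to - gammaL (1 - s) after [mac_sym]; the coefficient [g1] of
   the second solution is the one that cancels it, just as [g] is the one that makes [w] tend to
   0. *)
have w1_cvg : expR (- (s * - n%:R)) * w1 (- n%:R) @[n --> \oo] --> (0 : R).
  have E n : expR (- (s * - n%:R)) * w1 (- n%:R) = - mac (1 - s) (a_ n) -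
    (g * (expR ((1 - s) * - n%:R) * dhyp01 (- s) (a_ n)) -
     g1 * (s * hyp01 s (a_ n) + a_ n * dhyp01 s (a_ n))).
    rewrite /w1 /p1 -/(a_ n).
    have -> : mac (s - 1) (a_ n) = expR ((1 - s) * n%:R) * mac (1 - s) (a_ n).
      rewrite -[s - 1]opprB mac_sym ?expR_gt0// expRK; congr (expR _ * _); ring.
    have e1 : expR (- (s * - n%:R)) * a_ n = expR ((1 - s) * - n%:R).
      by rewrite -expRD; congr expR; ring.
    have e2 : expR ((1 - s) * - n%:R) * expR ((1 - s) * n%:R) = 1.
      by rewrite -expRD -mulrDr addNr mulr0 expR0.
    have e3 : expR (- (s * - n%:R)) * expR (s * - n%:R) = 1.
      by rewrite -expRD addNr expR0.
    move: e1 e2 e3; set e := expR (- _); set e' := expR (_ * - _).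
    set X := expR ((1 - s) * _); set F := expR (s * _) => e1 e2 e3.
    transitivity (- (e * a_ n * X * mac (1 - s) (a_ n)) - (g * (e * a_ n * dhyp01 (- s) (a_ n)) -
      g1 * (e * F * (s * hyp01 s (a_ n) + a_ n * dhyp01 s (a_ n))))); first by ring.
    by rewrite e1 e2 e3 !mul1r.
  under eq_fun do rewrite E.
  have -> : 0 = - gammaL (1 - s) - (g * (0 * dhyp01 (- s) 0) - g1 * (s * 1 + 0 * dhyp01 s 0)).
    by rewrite /g1; field; rewrite gt_eqF.
  apply: cvgB; first by apply: cvgN; exact: cvg_m.
  apply: cvgB; apply: cvgM => //.
    by apply: cvgM; [exact: pow_cvg|exact: cvg_dhyp].
  by apply: cvgD; apply: cvgM => //; [exact: cvg_hyp|exact: cvg_dhyp].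
have D0 q : expR (- (s * q)) * (w1 q * p q - w q * p1 q) = 0.
  have C1 : expR (- (s * - n%:R)) * (w1 (- n%:R) * p (- n%:R) - w (- n%:R) * p1 (- n%:R))
     @[n --> \oo] --> (0 : R).
    rewrite (_ : (fun n => _) = (fun n : nat => expR (- (s * - n%:R)) * w1 (- n%:R) * p (- n%:R) -
      w (- n%:R) * (expR ((1 - s) * - n%:R) * dhyp01 (- s) (a_ n)))); last first.
      apply/funext => n; rewrite /p1 -/(a_ n).
      have e1 : expR (- (s * - n%:R)) * a_ n = expR ((1 - s) * - n%:R).
        by rewrite -expRD; congr expR; ring.
      by rewrite -e1; ring.
    have -> : 0 = 0 * 1 - 0 * (0 * dhyp01 (- s) 0) by ring.
    apply: cvgB; apply: cvgM => //.
    by apply: cvgM; [exact: pow_cvg|exact: cvg_dhyp].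
  have C2 : expR (- (s * - n%:R)) * (w1 (- n%:R) * p (- n%:R) - w (- n%:R) * p1 (- n%:R))
     @[n --> \oo] --> expR (- (s * q)) * (w1 q * p q - w q * p1 q).
    rewrite (_ : (fun n => _) = fun=> expR (- (s * q)) * (w1 q * p q - w q * p1 q)).
      exact: cst.
    by apply/funext => n; exact: W.
  exact: (cvg_unique _ C2 C1).
have p0 q : p q != 0 by rewrite gt_eqF// hyp01_gt0// expR_ge0.
have wp q : w q / p q = 0.
  have C1 : w (- n%:R) / p (- n%:R) @[n --> \oo] --> (0 : R).
    rewrite -[X in _ --> X](mul0r 1^-1); apply: cvgM => //.
    by apply: cvgV => //; exact: oner_neq0.
  have C2 : w (- n%:R) / p (- n%:R) @[n --> \oo] --> w q / p q.
    rewrite (_ : (fun n => _) = fun=> w q / p q); first exact: cst.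
    apply/funext => n; apply: (@is_derive_0_is_cst _ (fun q => w q / p q)) => r.
    apply: (is_derive_eq (der_mul (dw r) (der_inv (p0 r) (dp r)))).
    move/eqP: (D0 r); rewrite mulf_eq0 gt_eqF ?expR_gt0//= subr_eq0 => /eqP h.
    have -> : w1 r / p r + w r * (- p1 r / p r ^+ 2) = (w1 r * p r - w r * p1 r) / p r ^+ 2.
      by field; exact: p0.
    by rewrite h subrr mul0r.
  exact: (cvg_unique _ C2 C1).
move/eqP: (wp (ln a)); rewrite mulf_eq0 invr_eq0 (negbTE (p0 _)) orbF.
by rewrite /w /p lnK ?posrE// subr_eq0 => /eqP.
Qed.

End bessel.

Section bessel_series.
Context {R : realType}.
Implicit Types (x p r q s t u c a z nu : R) (f : R -> R).

(** As nu > -1 both arguments are positive, so that Gamma is Euler's integral; each step k then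
    contributes one factor of [coef01] by the functional equation. *)
Lemma GammaM_coef01 nu k : -1 < nu ->
  Gamma (k%:R + 1) * Gamma (k%:R + nu + 1) = gammaL (nu + 1) / coef01 nu k.
Proof.
move=> nu1; have k0 : 0 <= k%:R :> R by rewrite ler0n.
rewrite !GammaE; [|by lra|by lra].
elim: k k0 => [|k IH] _.
  by rewrite /coef01 big_ord0 invrK !add0r mulr1 gammaL1 mul1r.
have k0 : 0 <= k%:R :> R by rewrite ler0n.
have e : k.+1%:R + nu + 1 = (k%:R + nu + 1) + 1 by rewrite -natr1; ring.
have h1 : 0 < k%:R + 1 :> R by lra.
have h2 : 0 < k%:R + nu + 1 by lra.
have -> : k.+1%:R + 1 = (k%:R + 1) + 1 :> R by rewrite -natr1.
rewrite e (gammaLS h1) (gammaLS h2).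
transitivity (gammaL (k%:R + 1) * gammaL (k%:R + nu + 1) * ((k%:R + 1) * (k%:R + 1 + nu))).
  by ring.
rewrite IH// /coef01 !invrK big_ord_recr/= natr1.
by rewrite -mulrA.
Qed.

Lemma besselIE nu z : -1 < nu -> 0 < z ->
  besselI nu z = expR (nu * ln (z / 2)) / gammaL (nu + 1) * hyp01 nu ((z / 2) ^+ 2).
Proof.
move=> nu1 z0; have z2 : 0 < z / 2 by rewrite divr_gt0.
rewrite /besselI.
apply/cvg_lim => //; rewrite /hyp01.
rewrite (_ : series _ = (fun n => expR (nu * ln (z / 2)) / gammaL (nu + 1) *
   pseries (coef01 nu) ((z / 2) ^+ 2) n)); last first.
  apply/funext => n; rewrite /pseries /series/= mulr_sumr; apply: eq_bigr => k _.
  rewrite GammaM_coef01// invfM invrK /powR gt_eqF//.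
  have -> : expR ((nu + 2 * k%:R) * ln (z / 2)) =
      expR (nu * ln (z / 2)) * (z / 2) ^+ 2 ^+ k.
    rewrite -exprM -[in RHS](lnK (x := z / 2)) ?posrE// expRK -expRM_natl -expRD natrM.
    by congr expR; ring.
  by ring.
by apply: cvgM; [exact: cvg_cst|exact: entire_coef01].
Qed.

(** The reflection formula replaces pi / sin (pi s) by Gamma(s) Gamma(1 - s). Dividing by the
    Gamma(1 - s) of I_{-s} and by the Gamma(s + 1) = s Gamma(s) of I_s leaves the two coefficients
    of [mac_hyp01]. *)
Lemma besselKE s z : 0 < s < 1 -> 0 < z ->
  besselK s z = 1 / 2 * expR (- (s * ln (z / 2))) * mac s ((z / 2) ^+ 2).
Proof.
move=> s01 z0; have /andP[s0 s1] := s01.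
have z2 : 0 < z / 2 by rewrite divr_gt0.
rewrite mac_hyp01// ?exprn_gt0// /besselK !besselIE//; [|lra|lra].
have -> : - s + 1 = 1 - s by rewrite addrC.
have sp : 0 < sin (pi * s).
  by apply: sin_gt0_pi; rewrite mulr_gt0 ?pi_gt0//= gtr_pMr// pi_gt0.
have G := gammaL_reflection s01.
have g0 := gammaL_gt0 s0; have g1 : 0 < gammaL (1 - s) by apply: gammaL_gt0; lra.
have e2 : expR (s * ln ((z / 2) ^+ 2)) = expR (s * ln (z / 2)) ^+ 2.
  by rewrite lnXn// -expRM_natl; congr expR; rewrite -mulr_natl; ring.
rewrite e2 gammaLS// mulNr expRN.
move: (sin (pi * s)) sp G => S S0 <-.
move: (expR _) (expR_gt0 (s * ln (z / 2))) (gammaL s) g0 (gammaL (1 - s)) g1.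
move=> e e0 g g0 g' g'0.
by field; rewrite !gt_eqF.
Qed.

End bessel_series.

(** * Gaussian integrals in one variable *)

Section gaussian.
Context {R : realType}.
Implicit Types (x k t phi : R).
Local Notation mu := (@lebesgue_measure R).

(* The square root of [pi / t], for [t > 0]. *)
Definition gaussc t : R := expR ((ln pi - ln t) / 2).

Lemma gauss_le t c x : 0 < t -> expR (c * x - t * x ^+ 2) <= expR (c ^+ 2 / (4 * t)).
Proof.
move=> t0; rewrite ler_expR -subr_ge0.
have -> : c ^+ 2 / (4 * t) - (c * x - t * x ^+ 2) = t * (x - c / (2 * t)) ^+ 2.
  by field; rewrite gt_eqF.
by rewrite mulr_ge0 ?sqr_ge0// ltW.
Qed.

Lemma integrable_xgauss t : 0 < t ->
  mu.-integrable setT (EFin \o (fun x => (1 + `|x|) * expR (- (t * x ^+ 2)))).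
Proof.
move=> t0.
pose C c : R := expR (c ^+ 2 / (4 * t)).
(* With A = exp x and B = exp (- x), |x| <= A + B and (1 + A + B)(A + B) = A + B + A^2 + B^2 + 2 A
   B, where A B = 1: these are exponentials exp (c x) with c = 1, -1, 2, -2, 0, each tamed by
   [gauss_le]. *)
apply: (@integrable_le_sech _ 1 (C 1 + C (-1) + C 2 + C (-2) + 2 * C 0)) => //.
  apply: measurable_funM; first by apply: measurable_funD => //.
  by apply: continuous_measurable_fun; continuity.
move=> x; have e0 := expR_ge0 (- (t * x ^+ 2)).
rewrite ger0_norm; last by rewrite mulr_ge0// addr_ge0.
apply: le_sech; rewrite !mul1r -mulrDr.
set e := expR (- (t * x ^+ 2)) in e0 *.
have H c : expR (c * x) * e <= C c by rewrite -expRD; exact: gauss_le.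
have h1 := H 1; have h2 := H (-1); have h3 := H 2; have h4 := H (-2); have h5 := H 0.
rewrite ?mul0r ?mul1r ?mulN1r expR0 in h1 h2 h5.
have e2 : expR (2 * x) = expR x ^+ 2 by rewrite expRM_natl.
have e3 : expR (-2 * x) = expR (- x) ^+ 2 by rewrite -expRM_natl; congr expR; ring.
have e4 : expR x * expR (- x) = 1 by rewrite -expRD subrr expR0.
rewrite e2 in h3; rewrite e3 in h4.
have xe : `|x| <= expR x + expR (- x).
  rewrite ler_norml; have := expR_ge1Dx x; have := expR_ge1Dx (- x).
  by have := expR_ge0 x; have := expR_ge0 (- x); lra.
move: (expR x) (expR (- x)) (expR_ge0 x) (expR_ge0 (- x)) e4 xe h1 h2 h3 h4 h5.
move=> A B A0 B0 AB xe h1 h2 h3 h4 h5.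
apply: (@le_trans _ _ ((1 + (A + B)) * e * (A + B))).
  by rewrite ler_wpM2r ?addr_ge0// ler_wpM2r// lerD2l.
have -> : (1 + (A + B)) * e * (A + B) = A * e + B * e + A ^+ 2 * e + B ^+ 2 * e + 2 * ((A * B) *
  e) by ring.
by rewrite AB; lra.
Qed.

Lemma integrable_gauss_le t (f : R -> R) : 0 < t -> measurable_fun setT f ->
  (forall x, `|f x| <= (1 + `|x|) * expR (- (t * x ^+ 2))) ->
  mu.-integrable setT (EFin \o f).
Proof.
by move=> t0 mf fle; apply: (@le_integrable_EFin _ _ _ mu _ _ _ _ (integrable_xgauss t0)).
Qed.

Lemma integral_gauss t : 0 < t ->
  \int[mu]_x expR (- (t * x ^+ 2)) = gaussc t.
Proof.
move=> t0; have st : 0 < Num.sqrt t by rewrite sqrtr_gt0.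
have := @integralT_gauss R.
rewrite (@integral_scale _ _ (Num.sqrt t))//; last 2 first.
- exact: continuous_gauss_fun.
- exact: gauss_fun_ge0.
move=> h.
have ig : mu.-integrable setT (EFin \o (fun x => expR (- (t * x ^+ 2)))).
  apply: (@integrable_gauss_le t) => //.
    by apply: continuous_measurable_fun; continuity.
  by move=> x; rewrite ger0_norm ?expR_ge0// ler_peMl ?expR_ge0// lerDl.
have : Num.sqrt t * \int[mu]_x expR (- (t * x ^+ 2)) = Num.sqrt pi.
  rewrite -RintegralZl// /Rintegral.
  rewrite -[RHS]/(fine (Num.sqrt pi)%:E) -h; congr fine.
  apply: eq_integral => x _; rewrite /gauss_fun exprMn sqr_sqrtr// ltW//.
move=> E; apply: (@mulfI _ (Num.sqrt t)); first by rewrite gt_eqF.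
rewrite E /gaussc.
have sq x : 0 < x -> Num.sqrt x = expR (ln x / 2).
  move=> x0; rewrite -[LHS]lnK ?posrE ?sqrtr_gt0//; congr expR.
  have : ln x = ln (Num.sqrt x) *+ 2 by rewrite -lnXn ?sqrtr_gt0// sqr_sqrtr// ltW.
  by move=> ->; rewrite mulr2n; lra.
by rewrite !sq ?pi_gt0// -expRD; congr expR; ring.
Qed.

Lemma integrable_gauss_cos t k phi : 0 < t ->
  mu.-integrable setT (EFin \o (fun x => expR (- (t * x ^+ 2)) * cos (k * x + phi))).
Proof.
move=> t0; apply: (@integrable_gauss_le t) => //.
  by apply: continuous_measurable_fun; continuity.
move=> x; rewrite normrM ger0_norm ?expR_ge0// mulrC ler_wpM2r ?expR_ge0//.
by rewrite (le_trans (cos_max _))// lerDl.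
Qed.

(** Integration by parts gives I' = - k / (2 t) I for the integral I as a function of k, so I(k) exp
    (k^2 / (4 t)) is constant. The phase is carried along because in several variables it receives
    the contribution of the other coordinates. *)
Lemma gauss_fourier1 t k phi : 0 < t ->
  \int[mu]_x (expR (- (t * x ^+ 2)) * cos (k * x + phi)) =
  gaussc t * expR (- (k ^+ 2 / (4 * t))) * cos phi.
Proof.
move=> t0.
pose I k := \int[mu]_x (expR (- (t * x ^+ 2)) * cos (k * x + phi)).
have bs (z : R) x : `|x * expR (- (t * x ^+ 2)) * sin z| <= (1 + `|x|) * expR (- (t * x ^+ 2)).
  rewrite 2!normrM (ger0_norm (expR_ge0 _)) mulrAC ler_wpM2r ?expR_ge0//.
  by rewrite (@le_trans _ _ `|x|) ?lerDr// ler_piMr// sin_max.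
have isin k' : mu.-integrable setT (EFin \o (fun x => x * expR (- (t * x ^+ 2)) * sin (k' * x +
  phi))).
  apply: (@integrable_gauss_le t) => //.
  by apply: continuous_measurable_fun; continuity.
have IBP k' : \int[mu]_x (x * expR (- (t * x ^+ 2)) * sin (k' * x + phi)) = k' / (2 * t) * I k'.
  have d x : is_derive x (1 : R) (fun x => expR (- (t * x ^+ 2)) * sin (k' * x + phi))
     (k' * (expR (- (t * x ^+ 2)) * cos (k' * x + phi)) -
      2 * t * (x * expR (- (t * x ^+ 2)) * sin (k' * x + phi))).
    by compute_derive; rewrite expr1; ring.
  have ic := integrableZl measurableT k' (integrable_gauss_cos k' phi t0).
  have i2 := integrableZl measurableT (2 * t) (isin k').
  have := Rintegral_derive_eq0 d; rewrite RintegralB// RintegralZl// ?RintegralZl//; last first.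
    exact: integrable_gauss_cos.
  move=> H; have {}H := H _ (integrableB measurableT ic i2) _.
  have : k' * I k' - 2 * t * \int[mu]_x (x * expR (- (t * x ^+ 2)) * sin (k' * x + phi)) = 0.
    apply: H; first by continuity.
    apply: (@integrable_gauss_le t) => //.
      by apply: continuous_measurable_fun; continuity.
    move=> x; rewrite normrM ger0_norm ?expR_ge0// mulrC ler_wpM2r ?expR_ge0//.
    by rewrite (le_trans (sin_max _))// lerDl.
  move/subr0_eq => E; apply: (@mulfI _ (2 * t)); first by rewrite gt_eqF// mulr_gt0.
  by rewrite -E; field; rewrite gt_eqF.
have dI k' : is_derive k' (1 : R) I (- (k' / (2 * t) * I k')).
  rewrite -IBP -mulN1r -RintegralZl//.
  apply: (@is_derive_Rintegral _ _ _ mu _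
    (fun k x => -1 * (x * expR (- (t * x ^+ 2)) * sin (k * x + phi))) _ (k' - 1) (k' + 1) _ _ _ _
    (integrable_xgauss t0)).
  - by apply/andP; split; lra.
  - by move=> z _; exact: integrable_gauss_cos.
  - by move=> z x _; compute_derive; ring.
  - by move=> z x _; rewrite mulN1r normrN.
have -> : \int[mu]_x (expR (- (t * x ^+ 2)) * cos (k * x + phi)) = I k by [].
have c : I k * expR (k ^+ 2 / (4 * t)) = I 0 * expR (0 ^+ 2 / (4 * t)).
  apply: (@is_derive_0_is_cst _ (fun k => I k * expR (k ^+ 2 / (4 * t)))) => k'.
  have h := dI k'; compute_derive.
  by rewrite expr1; field; rewrite gt_eqF.
have I0 : I 0 = gaussc t * cos phi.
  rewrite /I -integral_gauss// -RintegralZr//; last first.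
    apply: (@integrable_gauss_le t) => //.
      by apply: continuous_measurable_fun; continuity.
    by move=> x; rewrite ger0_norm ?expR_ge0// ler_peMl ?expR_ge0// lerDl.
  by apply: eq_Rintegral => x _; rewrite mul0r add0r.
apply: (@mulIf _ (expR (k ^+ 2 / (4 * t)))); first by rewrite gt_eqF ?expR_gt0.
rewrite c I0 expr0n/= mul0r expR0 mulr1.
have e : expR (- (k ^+ 2 / (4 * t))) * expR (k ^+ 2 / (4 * t)) = 1.
  by rewrite -expRD addNr expR0.
transitivity (gaussc t * cos phi * (expR (- (k ^+ 2 / (4 * t))) * expR (k ^+ 2 / (4 * t)))).
  by rewrite e mulr1.
by ring.
Qed.

End gaussian.

(** * Integration over R^n *)

Section lebRn_integral.
Context {R : realType}.
Local Notation mu := (@lebesgue_measure R).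
Local Notation T n := (n.-tuple (measurableTypeR R)).

Lemma measurable_tcons n : measurable_fun setT (@tcons R n).
Proof.
by apply: measurable_cons; [exact: measurable_fst|exact: measurable_snd].
Qed.

Lemma ge0_integral_lebRnS n (f : T n.+1 -> \bar R) :
  measurable_fun setT f -> (forall t, 0 <= f t)%E ->
  (\int[lebRn n.+1]_t f t = \int[mu]_x \int[lebRn n]_t f (tcons (x, t)))%E.
Proof.
move=> mf f0.
have mfc : measurable_fun setT (f \o @tcons R n).
  by apply: measurableT_comp => //; exact: measurable_tcons.
transitivity (\int[(mu \x lebRn n)%E]_p (f \o @tcons R n) p)%E.
  rewrite -[in RHS](preimage_setT (@tcons R n)).
  by rewrite -ge0_integral_pushforward//; exact: measurable_tcons.
by apply: fubini_tonelli1 => // p; exact: f0.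
Qed.

Lemma integrable_lebRnS n (f : T n.+1 -> R) :
  (lebRn n.+1).-integrable setT (EFin \o f) ->
  (mu \x lebRn n)%E.-integrable setT (EFin \o (f \o @tcons R n)).
Proof.
move=> /integrableP[mf intf].
have mfc : measurable_fun setT (EFin \o (f \o @tcons R n)).
  by apply: (@measurableT_comp _ _ _ _ _ _ (EFin \o f)) => //; exact: measurable_tcons.
apply/integrable12ltyP => //; move: intf.
by rewrite ge0_integral_lebRnS//; exact: measurableT_comp.
Qed.

(** Both orders are recorded for [integral_partial_eq0]: the first coordinate is integrated
    innermost when the derivative is taken along it, and outermost otherwise. *)
Lemma Rintegral_lebRnS n (f : T n.+1 -> R) :
  (lebRn n.+1).-integrable setT (EFin \o f) ->
  \int[lebRn n.+1]_t f t = \int[lebRn n]_t \int[mu]_x f (tcons (x, t)) /\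
  \int[lebRn n.+1]_t f t = \int[mu]_x \int[lebRn n]_t f (tcons (x, t)).
Proof.
move=> intf; have mf := measurable_int _ intf.
have intc := integrable_lebRnS intf.
have E := Rintegral_fubini intc.
suff E2 : \int[lebRn n.+1]_t f t = \int[mu]_x \int[lebRn n]_t f (tcons (x, t)).
  by rewrite -E.
rewrite -[RHS]/(\int[mu]_x \int[lebRn n]_t (f \o @tcons R n) (x, t)).
rewrite {1}/Rintegral.
transitivity (fine (\int[(mu \x lebRn n)%E]_p (EFin \o f \o @tcons R n) p)%E).
  congr fine; rewrite -[in RHS](preimage_setT (@tcons R n)).
  by rewrite -integral_pushforward//; exact: measurable_tcons.
rewrite -integral12_prod_meas1// /fubini_F /Rintegral; congr fine.
apply: ae_eq_integral => //.
  exact: (measurable_fubini_F intc).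
  apply/measurable_EFinP; apply: measurableT_comp => //.
  exact: (measurable_fubini_F intc).
case: (ae_integrable1 intc) => N [mN N0 HN]; exists N; split => // x /= nx; apply: HN => /= ix.
by apply: nx => _; rewrite fineK//; exact: integrable_fin_num ix.
Qed.

Lemma integral_lebRn0 (f : T 0 -> R) :
  (\int[lebRn 0]_t (f t)%:E = (f [tuple])%:E)%E.
Proof.
have mf : measurable_fun setT f.
  move=> _ A mA; rewrite setTI.
  have [h|h] := pselect (A (f [tuple])).
    rewrite (_ : _ @^-1` _ = setT)//; apply/seteqP; split => // t _ /=.
    by rewrite tuple0.
  rewrite (_ : _ @^-1` _ = set0)//; apply/seteqP; split => // t /=.
  by rewrite tuple0.
rewrite /= integral_dirac//; last exact/measurable_EFinP.
by rewrite diracT mul1e.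
Qed.

Lemma measurable_prod_tnth n (h : R -> R) : measurable_fun setT h ->
  measurable_fun setT (fun t : T n => \prod_(i < n) h (tnth t i)).
Proof.
move=> mh; apply: measurable_prod => i _.
by apply: measurableT_comp => //; exact: measurable_tnth.
Qed.

Lemma tnth_tcons0 n (x : R) (t : T n) : tnth (tcons (x, t)) ord0 = x.
Proof. by rewrite (tnth_nth 0). Qed.

Lemma tnth_tconsS n (x : R) (t : T n) i : tnth (tcons (x, t)) (lift ord0 i) = tnth t i.
Proof. by rewrite !(tnth_nth 0). Qed.

Lemma integral_prod_tnth n (h : R -> R) : (forall x, 0 <= h x) ->
  mu.-integrable setT (EFin \o h) ->
  (\int[lebRn n]_t (\prod_(i < n) h (tnth t i))%:E = ((\int[mu]_x h x) ^+ n)%:E)%E.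
Proof.
move=> h0 ih; have /integrableP[/measurable_EFinP mh _] := ih.
elim: n => [|n IH]; first by rewrite integral_lebRn0 big_ord0.
rewrite ge0_integral_lebRnS; last 2 first.
- by apply/measurable_EFinP; exact: measurable_prod_tnth.
- by move=> t; rewrite lee_fin prodr_ge0.
under eq_integral => x _.
  under eq_integral => t _.
    rewrite big_ord_recl tnth_tcons0.
    under eq_bigr do rewrite tnth_tconsS.
    rewrite EFinM.
    over.
  rewrite ge0_integralZl//; last 3 first.
  - by apply/measurable_EFinP; exact: measurable_prod_tnth.
  - by move=> t _; rewrite lee_fin prodr_ge0.
  - by rewrite lee_fin.
  rewrite IH.
  over.
rewrite /= ge0_integralZr//; last 3 first.
- exact/measurable_EFinP.
- by move=> x _; rewrite lee_fin.
- by rewrite lee_fin exprn_ge0// Rintegral_ge0.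
by rewrite exprS EFinM /Rintegral fineK//; exact: integrable_fin_num.
Qed.

Lemma integrable_prod_tnth n (h : R -> R) : (forall x, 0 <= h x) ->
  mu.-integrable setT (EFin \o h) ->
  (lebRn n).-integrable setT (EFin \o (fun t : T n => \prod_(i < n) h (tnth t i))).
Proof.
move=> h0 ih; have /integrableP[/measurable_EFinP mh _] := ih.
apply/integrableP; split; first by apply/measurable_EFinP; exact: measurable_prod_tnth.
under eq_integral do rewrite /= ger0_norm ?prodr_ge0//.
by rewrite integral_prod_tnth// ltry.
Qed.

End lebRn_integral.

Section weight.
Context {R : realType}.
Local Notation mu := (@lebesgue_measure R).
Local Notation T n := (n.-tuple (measurableTypeR R)).

Definition cauchy (x : R) : R := (1 + x ^+ 2)^-1.

Lemma cauchy_gt0 x : 0 < cauchy x.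
Proof. by rewrite invr_gt0 ltr_wpDr ?sqr_ge0. Qed.

Lemma continuous_cauchy : continuous cauchy.
Proof. by rewrite /cauchy; continuity => x; rewrite gt_eqF// ltr_wpDr ?sqr_ge0. Qed.

Lemma integrable_cauchy : mu.-integrable setT (EFin \o cauchy).
Proof.
apply: (@ge0_integrable_derive _ (@atan R) cauchy (pi / 2)).
- exact: continuous_cauchy.
- by move=> x; rewrite ltW// cauchy_gt0.
- move=> x; rewrite ler_norml; apply/andP; split; apply: ltW.
    exact: atan_gtNpi2.
  exact: atan_ltpi2.
Qed.

(* An integrable majorant for Schwartz functions: [(1 + enorm x) ^- (2 * n) <= weight x]
   by [weight_ge]. *)
Definition weight n (x : 'rV[R]_n) : R := \prod_(i < n) cauchy (x 0 i).

Lemma weight_gt0 n (x : 'rV[R]_n) : 0 < weight x.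
Proof. by apply: prodr_gt0 => i _; exact: cauchy_gt0. Qed.

Lemma weightE n (t : T n) : weight (rV_of t) = \prod_(i < n) cauchy (tnth t i).
Proof. by apply: eq_bigr => i _; rewrite mxE. Qed.

Lemma measurable_weight n : measurable_fun setT (fun t : T n => weight (rV_of t)).
Proof.
under eq_fun do rewrite weightE; apply: measurable_prod_tnth.
exact: continuous_measurable_fun continuous_cauchy.
Qed.

Lemma integrable_weight n :
  (lebRn n).-integrable setT (EFin \o (fun t : T n => weight (rV_of t))).
Proof.
rewrite (_ : (fun t => _) = (fun t : T n => \prod_(i < n) cauchy (tnth t i))).
  by apply: integrable_prod_tnth; [move=> x; rewrite ltW// cauchy_gt0|exact: integrable_cauchy].
by apply/funext => t; rewrite weightE.
Qed.

Lemma dotrE n (t : T n) : dotr (rV_of t) (rV_of t) = \sum_(i < n) (tnth t i : R) ^+ 2.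
Proof. by apply: eq_bigr => i _; rewrite !mxE. Qed.

Lemma dotr_ge0 n (x : 'rV[R]_n) : 0 <= dotr x x.
Proof. by apply: sumr_ge0 => i _; exact: sqr_ge0. Qed.

Lemma dotr_eq0 n (x : 'rV[R]_n) : (dotr x x == 0) = (x == 0).
Proof.
rewrite psumr_eq0; last by move=> i _; exact: sqr_ge0.
apply/allP/eqP => [h|-> i _]; last by rewrite mxE mulr0 eqxx.
apply/rowP => i; rewrite mxE; apply/eqP; have := h i (mem_index_enum i).
by rewrite /= mulf_eq0 orbb.
Qed.

Lemma enorm_sqr n (x : 'rV[R]_n) : enorm x ^+ 2 = dotr x x.
Proof. by rewrite sqr_sqrtr// dotr_ge0. Qed.

Lemma measurable_dotr d (U : measurableType d) n (f g : U -> T n) :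
  measurable_fun setT f -> measurable_fun setT g ->
  measurable_fun setT (fun u => dotr (rV_of (f u)) (rV_of (g u))).
Proof.
move=> mf mg; apply: measurable_sum => i.
have E (h : U -> T n) u : rV_of (h u) 0 i = tnth (h u) i by rewrite mxE.
under eq_fun do rewrite !E.
by apply: measurable_funM; apply: (@measurableT_comp _ _ _ _ _ _ (fun t : T n => tnth t i));
  rewrite //; exact: measurable_tnth.
Qed.

Lemma gauss_prod n (t : T n) r :
  expR (- (r * dotr (rV_of t) (rV_of t))) = \prod_(i < n) expR (- (r * (tnth t i : R) ^+ 2)).
Proof. by rewrite dotrE mulr_sumr -sumrN expR_sum. Qed.

Section kernel.
Variables (n : nat) (al be : R).
Hypotheses (al0 : 0 < al) (be0 : 0 < be) (albe : al + be = n%:R / 2).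

Let ker (z : T n * measurableTypeR R) : R :=
  expR (al * z.2 - dotr (rV_of z.1) (rV_of z.1) * expR z.2) * weight (rV_of z.1).

Let measurable_ker : measurable_fun setT ker.
Proof.
apply: measurable_funM; last first.
  by apply: (@measurableT_comp _ _ _ _ _ _ (fun t : T n => weight (rV_of t)));
    [exact: measurable_weight|exact: measurable_fst].
apply: measurableT_comp => //; apply: measurable_funB.
  by apply: measurable_funM => //; exact: measurable_snd.
apply: measurable_funM; first by apply: measurable_dotr; exact: measurable_fst.
by apply: measurableT_comp => //; exact: measurable_snd.
Qed.

Let ker_ge0 z : 0 <= ker z.
Proof. by rewrite mulr_ge0 ?expR_ge0// ltW// weight_gt0. Qed.

(* For [tau <= 0] bound the Gaussian by 1 and integrate the weight; for [tau >= 0] bound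
   the weight by 1, the integral of the Gaussian being [(pi expR (- tau))^(n/2)]. *)
Lemma integrable_ker : (lebRn n \x mu)%E.-integrable setT (EFin \o ker).
Proof.
apply/integrable21ltyP; first exact/measurable_EFinP.
pose w1 := \int[mu]_x cauchy x.
pose C := w1 ^+ n + expR (ln pi / 2) ^+ n.
(* After integration over R^n the kernel decays like exp (al tau) at -oo and, as al - n/2 = - be,
   like exp (- be tau) at +oo. The two terms of [C] are the integral of the weight and pi^(n/2). *)
pose m := Num.min al be.
have m0 : 0 < m by rewrite lt_min al0.
have mal : m <= al by rewrite ge_min lexx.
have mbe : m <= be by rewrite ge_min lexx orbT.
have w10 : 0 <= w1 by apply: Rintegral_ge0 => x _; rewrite ltW// cauchy_gt0.
have wn0 : 0 <= w1 ^+ n by rewrite exprn_ge0.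
apply: (@le_lt_trans _ _ (\int[mu]_x ((C * 2) * sech m x)%:E)%E); last first.
  apply: integrable_lty => //.
  exact: (integrableZl measurableT (C * 2) (integrable_sech m0)).
apply: ge0_le_integral => //.
- by move=> y _; apply: integral_ge0 => x _; exact: abse_ge0.
- apply: (@measurable_fun_fubini_tonelli_G _ _ _ _ _ (lebRn n) (abse \o (EFin \o ker))) => //.
  - by apply: measurableT_comp => //; exact/measurable_EFinP.
  - by move=> z; exact: abse_ge0.
- apply/measurable_EFinP; apply: measurable_funM => //.
  have /integrableP[/measurable_EFinP] := integrable_sech m0; exact.
move=> tau _.
pose h x := expR (- (expR tau * x ^+ 2)) * cauchy x.
have h0 x : 0 <= h x by rewrite mulr_ge0 ?expR_ge0// ltW// cauchy_gt0.
have mh : measurable_fun setT h.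
  apply: continuous_measurable_fun; apply: ctsM; last exact: continuous_cauchy.
  by continuity.
have hc x : h x <= cauchy x.
  apply: ler_piMl; first exact: ltW (cauchy_gt0 x).
  rewrite -[leRHS]expR0 ler_expR oppr_le0.
  by rewrite mulr_ge0 ?sqr_ge0// expR_ge0.
have ih : mu.-integrable setT (EFin \o h).
  apply: (@le_integrable_EFin _ _ _ mu _ _ _ _ integrable_cauchy) => // x.
  by rewrite ger0_norm.
have -> : (\int[lebRn n]_x `|(EFin \o ker) (x, tau)| =
   (expR (al * tau) * (\int[mu]_x h x) ^+ n)%:E)%E.
  rewrite EFinM -integral_prod_tnth// -ge0_integralZl//; last 2 first.
  - by apply/measurable_EFinP; exact: measurable_prod_tnth.
  - by move=> t _; rewrite lee_fin prodr_ge0.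
  apply: eq_integral => t _; rewrite /= ger0_norm// /ker/= -EFinM; congr EFin.
  by rewrite expRD -mulrA mulrC -[RHS]mulrC /h big_split/= -gauss_prod weightE [_ * expR tau]mulrC.
rewrite lee_fin; set A := \int[mu]_x h x.
have A0 : 0 <= A by apply: Rintegral_ge0.
have A1 : A <= w1 by apply: le_Rintegral => //; exact: integrable_cauchy.
have A2 : A <= expR (ln pi / 2) * expR (- (tau / 2)).
  have -> : expR (ln pi / 2) * expR (- (tau / 2)) = gaussc (expR tau) :> R.
    by rewrite -expRD /gaussc expRK; congr expR; ring.
  rewrite -integral_gauss ?expR_gt0//; apply: le_Rintegral => //.
    apply: (@integrable_gauss_le _ (expR tau)) => //; first exact: expR_gt0.
      by apply: continuous_measurable_fun; continuity.
    by move=> x; rewrite ger0_norm ?expR_ge0// ler_peMl ?expR_ge0// lerDl.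
  move=> x _; rewrite /h ler_piMr ?expR_ge0// /cauchy invf_le1 ?lerDl ?sqr_ge0//.
  by rewrite ltr_wpDr ?sqr_ge0.
have {}A1 : A ^+ n <= C.
  by rewrite (le_trans (lerXn2r _ _ _ A1))// lerDl exprn_ge0// expR_ge0.
have {}A2 : A ^+ n <= C * expR (- (n%:R / 2 * tau)).
  rewrite (le_trans (lerXn2r _ _ _ A2)) ?nnegrE ?mulr_ge0 ?expR_ge0//.
  rewrite exprMn -[X in _ * X <= _]expRM_natl.
  have -> : n%:R * - (tau / 2) = - (n%:R / 2 * tau) :> R by ring.
  by rewrite ler_wpM2r ?expR_ge0// lerDr.
have C0 : 0 <= C by rewrite addr_ge0 ?exprn_ge0 ?expR_ge0.
apply: le_sech; rewrite -mulrDr.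
set E := expR (m * tau) + _.
have E0 : 0 <= E by rewrite addr_ge0 ?expR_ge0.
have [t0|t0] := leP 0 tau.
  apply: (@le_trans _ _ (C * expR (- (be * tau)) * E)).
    rewrite ler_wpM2r//; apply: (le_trans (ler_wpM2l (expR_ge0 _) A2)).
    by rewrite mulrCA -expRD ler_wpM2l// ler_expR -albe; lra.
  rewrite -mulrA ler_wpM2l// /E mulrDr -!expRD.
  have h1 : expR (- (be * tau) + m * tau) <= 1.
    by rewrite -expR0 ler_expR -mulNr -mulrDl mulr_le0_ge0//; lra.
  have h2 : expR (- (be * tau) + - (m * tau)) <= 1.
    by rewrite -expR0 ler_expR -!mulNr -mulrDl mulr_le0_ge0//; lra.
  lra.
apply: (@le_trans _ _ (C * expR (al * tau) * E)).
  by rewrite ler_wpM2r// mulrC ler_wpM2r ?expR_ge0.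
rewrite -mulrA ler_wpM2l// /E mulrDr -!expRD.
have h1 : expR (al * tau + m * tau) <= 1.
  by rewrite -expR0 ler_expR -mulrDl mulr_ge0_le0//; lra.
have h2 : expR (al * tau + - (m * tau)) <= 1.
  by rewrite -expR0 ler_expR -mulNr -mulrDl mulr_ge0_le0//; lra.
lra.
Qed.

End kernel.
End weight.

(** * Gaussians in R^n and their cosine transforms *)

Section gauss_nd.
Context {R : realType}.
Local Notation mu := (@lebesgue_measure R).
Local Notation T n := (n.-tuple (measurableTypeR R)).

Definition behead_rV n (k : 'rV[R]_n.+1) : 'rV[R]_n := \row_j k 0 (lift ord0 j).

Lemma dotr_tcons n (k : 'rV[R]_n.+1) (x : R) (t : T n) :
  dotr k (rV_of (tcons (x, t))) = k 0 ord0 * x + dotr (behead_rV k) (rV_of t).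
Proof.
rewrite /dotr big_ord_recl mxE tnth_tcons0; congr (_ + _).
by apply: eq_bigr => i _; rewrite !mxE tnth_tconsS.
Qed.

Lemma dotr_behead n (k : 'rV[R]_n.+1) :
  dotr k k = k 0 ord0 ^+ 2 + dotr (behead_rV k) (behead_rV k).
Proof.
by rewrite /dotr big_ord_recl -expr2; congr (_ + _); apply: eq_bigr => i _; rewrite !mxE.
Qed.

Lemma dotr_tcons2 n (x : R) (t : T n) :
  dotr (rV_of (tcons (x, t))) (rV_of (tcons (x, t))) = x ^+ 2 + dotr (rV_of t) (rV_of t).
Proof.
rewrite /dotr big_ord_recl !mxE tnth_tcons0 -expr2; congr (_ + _).
by apply: eq_bigr => i _; rewrite !mxE tnth_tconsS.
Qed.

Lemma measurable_dotrl n (k : 'rV[R]_n) : measurable_fun setT (fun t : T n => dotr k (rV_of t)).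
Proof.
apply: measurable_sum => i; under eq_fun do rewrite mxE.
by apply: measurable_funM => //; exact: measurable_tnth.
Qed.

Lemma measurable_dotrr n : measurable_fun setT (fun t : T n => dotr (rV_of t) (rV_of t)).
Proof. by apply: measurable_dotr; exact: measurable_id. Qed.

Lemma integrable_gauss_nd n r : 0 < r ->
  (lebRn n).-integrable setT (EFin \o (fun t : T n => expR (- (r * dotr (rV_of t) (rV_of t))))).
Proof.
move=> r0.
rewrite (_ : (fun t => _) = (fun t : T n => \prod_(i < n) expR (- (r * (tnth t i : R) ^+ 2)))).
  apply: (@integrable_prod_tnth _ _ (fun x => expR (- (r * x ^+ 2)))).
    by move=> x; exact: expR_ge0.
  apply: (@integrable_gauss_le _ r) => //.
    by apply: continuous_measurable_fun; continuity.
  by move=> x; rewrite ger0_norm ?expR_ge0// ler_peMl ?expR_ge0// lerDl.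
by apply/funext => t; rewrite gauss_prod.
Qed.

Lemma measurable_gauss_cos_nd n r (k : 'rV[R]_n) phi :
  measurable_fun setT (fun t : T n => expR (- (r * dotr (rV_of t) (rV_of t))) *
    cos (dotr k (rV_of t) + phi)).
Proof.
apply: measurable_funM.
  apply: measurableT_comp => //; apply: measurableT_comp => //.
  by apply: measurable_funM => //; exact: measurable_dotrr.
apply: (@measurableT_comp _ _ _ _ _ _ cos).
  by apply: continuous_measurable_fun; exact: continuous_cos.
by apply: measurable_funD => //; exact: measurable_dotrl.
Qed.

Lemma integrable_gauss_cos_nd n r (k : 'rV[R]_n) phi : 0 < r ->
  (lebRn n).-integrable setT (EFin \o (fun t : T n =>
    expR (- (r * dotr (rV_of t) (rV_of t))) * cos (dotr k (rV_of t) + phi))).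
Proof.
move=> r0; apply: (@le_integrable_EFin _ _ _ _ _ _ _ _ (integrable_gauss_nd n r0)).
  exact: measurable_gauss_cos_nd.
by move=> t; rewrite normrM ger0_norm ?expR_ge0// ler_piMr ?expR_ge0// cos_max.
Qed.

(** Induction on the dimension with [k] and [phi] generalized: for a fixed first coordinate x, the
    term k_0 x joins the phase of the integral over the others. *)
Lemma gauss_fourier n r (k : 'rV[R]_n) phi : 0 < r ->
  \int[lebRn n]_t (expR (- (r * dotr (rV_of t) (rV_of t))) * cos (dotr k (rV_of t) + phi)) =
  gaussc r ^+ n * expR (- (dotr k k / (4 * r))) * cos phi.
Proof.
move=> r0; elim: n => [|n IH] in k phi *.
  rewrite {1}/Rintegral integral_lebRn0/= /dotr !big_ord0.
  by rewrite mulr0 mul0r oppr0 expR0 add0r !mul1r.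
have [_ ->] := Rintegral_lebRnS (integrable_gauss_cos_nd k phi r0).
transitivity (\int[mu]_x (gaussc r ^+ n * expR (- (dotr (behead_rV k) (behead_rV k) / (4 * r))) *
   (expR (- (r * x ^+ 2)) * cos (k 0 ord0 * x + phi)))).
  apply: eq_Rintegral => x _.
  transitivity (\int[lebRn n]_t (expR (- (r * x ^+ 2)) *
      (expR (- (r * dotr (rV_of t) (rV_of t))) *
       cos (dotr (behead_rV k) (rV_of t) + (k 0 ord0 * x + phi))))).
    apply: eq_Rintegral => t _; rewrite dotr_tcons2 dotr_tcons mulrA -expRD.
    by congr (expR _ * cos _); ring.
  rewrite RintegralZl//; last exact: integrable_gauss_cos_nd.
  by rewrite IH; ring.
rewrite RintegralZl//; last exact: integrable_gauss_cos.
have -> : expR (- (dotr k k / (4 * r))) = expR (- (k 0 ord0 ^+ 2 / (4 * r))) *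
    expR (- (dotr (behead_rV k) (behead_rV k) / (4 * r))).
  by rewrite dotr_behead -expRD mulrDl opprD.
by rewrite gauss_fourier1// [gaussc r ^+ n.+1]exprSr; ring.
Qed.

End gauss_nd.

Section measurable_rV.
Context {R : realType}.
Local Notation T n := (n.-tuple (measurableTypeR R)).

(** Openness refers to the norm of the row vectors, measurability to the product sigma-algebra of
    the tuples. An open set is a countable union of the boxes with rational centre and radius 1 / (k
    + 1) that it contains. *)
Lemma measurable_continuous_rV n (f : 'rV[R]_n -> R) : continuous f ->
  measurable_fun setT (fun t : T n => f (rV_of t)).
Proof.
move=> cf; apply: (measurability _ (RGenOpens.measurableE R)).
move=> _ [_ [a [b ->] <-]]; rewrite setTI.
pose U := f @^-1` `]a, b[%classic.
have oU : open U by apply: open_comp => // x _; exact: cf.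
pose box (q : n.-tuple rat * nat) : set (T n) :=
  [set t | forall i, `|(tnth t i : R) - ratr (tnth q.1 i)| < q.2.+1%:R^-1].
have mbox q : measurable (box q).
  rewrite (_ : box q = \bigcap_(i in [set: 'I_n])
     (fun t : T n => tnth t i) @^-1` [set z : measurableTypeR R | `|(z : R) - ratr (tnth q.1 i)|
       < q.2.+1%:R^-1]).
    apply: fin_bigcap_measurable => // i _; rewrite -[X in measurable X]setTI.
    apply: (measurable_tnth i) => //; apply: open_measurable.
    rewrite (_ : [set _ | _] = ball (ratr (tnth q.1 i) : R) q.2.+1%:R^-1).
      exact: ball_open.
    by apply/seteqP; split => z /=; rewrite /ball/= distrC.
  by apply/seteqP; split => [t h i _|t h i]; [exact: h|exact: (h i Logic.I)].
pose good q := box q `<=` [set t | U (rV_of t)].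
rewrite (_ : _ @^-1` _ = \bigcup_k (if unpickle k is Some q then
   if `[< good q >] then box q else set0 else set0)).
  apply: bigcupT_measurable => k; case: (unpickle k) => // q.
  by case: asboolP.
apply/seteqP; split => [t Ut|t [k _]]; last first.
  by case: (unpickle k) => // q; case: asboolP => // gq; exact: gq.
have /nbhs_ballP[e /= e0 He] : nbhs (rV_of t) U by exact: open_nbhs_nbhs.
(* Two points of a box differ by less than 2 / (k + 1) in each coordinate, so a box with 1 / (k + 1)
   < e / 2 around the point lies in the ball of radius e. *)
have e20 : 0 < e / 2 by rewrite divr_gt0.
have [k ke] : exists k : nat, k.+1%:R^-1 < e / 2.
  by have [k _ /(_ k (leqnn k))] := near_infty_natSinv_lt (PosNum e20); exists k.
have k0 : 0 < k.+1%:R^-1 :> R by rewrite invr_gt0 ltr0n.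
have Hq i : exists q : rat, `|(tnth t i : R) - ratr q| < k.+1%:R^-1.
  have [q] := @rat_in_itvoo _ ((tnth t i : R) - k.+1%:R^-1) ((tnth t i : R) + k.+1%:R^-1)
    (ltac:(by rewrite ltrBlDr -addrA ltrDl addr_gt0)).
  rewrite in_itv/= => /andP[q1 q2]; exists q.
  by rewrite ltr_norml ltrNl opprB ltrBlDl q2 ltrBlDr -ltrBlDl.
pose q := [tuple projT1 (cid (Hq i)) | i < n].
exists (pickle (q, k)) => //; rewrite pickleK.
have bt : box (q, k) t by move=> i; rewrite /= tnth_mktuple; case: cid.
case: asboolP => // -[]; move=> t' bt' /=; apply: He.
split=> // a' i; rewrite !mxE /ball/=.
have := bt i; have := bt' i; rewrite /= => h1 h2.
rewrite (le_lt_trans (ler_distD (ratr (tnth q i)) _ _))//.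
by rewrite [`|ratr _ - _|]distrC (splitr e) ltrD// (lt_trans _ ke).
Qed.

End measurable_rV.

(** * Directional derivatives and integration by parts in R^n *)

Section directional.
Context {R : realType}.

(** A directional derivative depends only on the values along the line, which allows passing between
    R^(n+1), R^n and R. *)
Lemma is_derive_ext (V V' : normedModType R) (f : V -> R) (f' : V' -> R) x v x' v' (d : R) :
  (forall h : R, f' (h *: v' + x') = f (h *: v + x)) ->
  is_derive x v f d -> is_derive x' v' f' d.
Proof.
move=> ff' [df <-].
have f0 : f' x' = f x by have := ff' 0; rewrite !scale0r !add0r.
have E : (fun h : R => h^-1 *: (f' (h *: v' + x') - f' x')) =
         (fun h : R => h^-1 *: (f (h *: v + x) - f x)).
  by apply/funext => h; rewrite ff' f0.
by apply: DeriveDef; [move: df; rewrite /derivable|rewrite /derive]; rewrite E.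
Qed.

Lemma is_derive_line (V : normedModType R) (f : V -> R) x v (d : R) :
  is_derive x v f d <-> is_derive (0 : R) (1 : R) (fun h : R => f (h *: v + x)) d.
Proof.
split; apply: is_derive_ext => h; first by rewrite addr0 [h *: 1]mulr1.
by rewrite addr0 [h *: 1]mulr1.
Qed.

End directional.

Section ibp.
Context {R : realType}.
Local Notation mu := (@lebesgue_measure R).
Local Notation T n := (n.-tuple (measurableTypeR R)).

Definition cons_rV n (x : R) (v : 'rV[R]_n) : 'rV[R]_n.+1 :=
  \row_j oapp (v 0) x (unlift ord0 j).

Lemma rV_of_tcons n (x : R) (t : T n) : rV_of (tcons (x, t)) = cons_rV x (rV_of t).
Proof.
apply/rowP => j; rewrite !mxE; case: unliftP => [i ->|->] /=.
  by rewrite mxE tnth_tconsS.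
by rewrite tnth_tcons0.
Qed.

Lemma weight_cons n (x : R) (v : 'rV[R]_n) : weight (cons_rV x v) = cauchy x * weight v.
Proof.
rewrite /weight big_ord_recl mxE unlift_none /=; congr (_ * _).
by apply: eq_bigr => i _; rewrite mxE liftK.
Qed.

Lemma cons_rV_lift n (x h : R) (v : 'rV[R]_n) j :
  cons_rV x (h *: delta_mx 0 j + v) = h *: delta_mx 0 (lift ord0 j) + cons_rV x v.
Proof.
apply/rowP => k; rewrite !mxE; case: unliftP => [i ->|->] /=.
  by rewrite !mxE (inj_eq lift_inj).
by rewrite mulr0 add0r.
Qed.

Lemma cons_rV0 n (x h : R) (v : 'rV[R]_n) :
  cons_rV (h + x) v = h *: delta_mx 0 ord0 + cons_rV x v.
Proof.
apply/rowP => k; rewrite !mxE; case: unliftP => [i ->|->] /=.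
  by rewrite mulr0 add0r.
by rewrite mulr1.
Qed.

(** Along the first coordinate this is [Rintegral_derive_eq0] on each line. Along another one, the
    first coordinate is frozen at x and the induction applies to the slice: since the weight is a
    product, the slice satisfies the same bounds with constant [M * cauchy x]. *)
Lemma integral_partial_eq0 n (i : 'I_n) (H H' : 'rV[R]_n -> R) (M : R) :
  (forall x, is_derive x (delta_mx 0 i) H (H' x)) ->
  (forall x, continuous (fun z : R => H' (z *: delta_mx 0 i + x))) ->
  measurable_fun setT (fun t : T n => H' (rV_of t)) ->
  (forall x, `|H x| <= M * weight x) ->
  (forall x, `|H' x| <= M * weight x) ->
  \int[lebRn n]_t H' (rV_of t) = 0.
Proof.
elim: n => [|n IH] in i H H' M *; first by case: i.
move=> dH cH' mH' HM H'M.
have iH' : (lebRn n.+1).-integrable setT (EFin \o (fun t : T n.+1 => H' (rV_of t))).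
  apply: (@le_integrable_EFin _ _ _ _ _ (fun t => M * weight (rV_of t))) => //.
  exact: (integrableZl measurableT M (integrable_weight n.+1)).
case: (unliftP ord0 i) => [j|] ij; rewrite {}ij in dH cH'.
  have [_ ->] := Rintegral_lebRnS iH'.
  rewrite (@eq_Rintegral _ _ _ _ _ (fun=> 0)) ?Rintegral_cst ?mul0r// => x _.
  under eq_Rintegral do rewrite rV_of_tcons.
  apply: (IH j (fun v => H (cons_rV x v)) (fun v => H' (cons_rV x v)) (M * cauchy x)).
  - move=> v; apply: is_derive_ext (dH (cons_rV x v)) => h.
    by rewrite cons_rV_lift.
  - by move=> v; under eq_fun do rewrite cons_rV_lift; exact: cH'.
  - under eq_fun do rewrite -rV_of_tcons.
    apply: (@measurableT_comp _ _ _ _ _ _ (fun t => H' (rV_of t))) => //.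
    apply: (@measurableT_comp _ _ _ _ _ _ (@tcons R n)); first exact: measurable_tcons.
    exact: measurable_pair1.
  - by move=> v; rewrite -mulrA -weight_cons.
  - by move=> v; rewrite -mulrA -weight_cons.
have [-> _] := Rintegral_lebRnS iH'.
rewrite (@eq_Rintegral _ _ _ _ _ (fun=> 0)) ?Rintegral_cst ?mul0r// => t _.
under eq_Rintegral do rewrite rV_of_tcons.
set v := rV_of t.
have dF (z : R) : is_derive z (1 : R) (fun z => H (cons_rV z v)) (H' (cons_rV z v)).
  apply: is_derive_ext (dH (cons_rV z v)) => h.
  by rewrite [h *: _]mulr1 cons_rV0.
have cF : continuous (fun z => H' (cons_rV z v)).
  have := cH' (cons_rV 0 v); under eq_fun do rewrite -cons_rV0 addr0; exact.
have ic : mu.-integrable setT (EFin \o (fun z => (M * weight v) * cauchy z)).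
  exact: (integrableZl measurableT (M * weight v) integrable_cauchy).
apply: (Rintegral_derive_eq0 dF) => //.
- apply: (@le_integrable_EFin _ _ _ mu _ _ _ _ ic).
    exact: continuous_measurable_fun.
  by move=> z; rewrite -mulrA [weight v * _]mulrC -weight_cons.
- apply: (@le_integrable_EFin _ _ _ mu _ _ _ _ ic).
    by apply: continuous_measurable_fun; exact: (is_derive_continuous dF).
  by move=> z; rewrite -mulrA [weight v * _]mulrC -weight_cons.
Qed.

End ibp.

(** * Cosine transforms of real Schwartz functions *)

Section real_schwartz.
Context {R : realType}.
Local Notation mu := (@lebesgue_measure R).
Local Notation T n := (n.-tuple (measurableTypeR R)).

Section defs.
Variable n : nat.
Implicit Types (h : 'rV[R]_n -> R) (x xi : 'rV[R]_n).

Definition rpartial (i : 'I_n) h : 'rV[R]_n -> R := fun x => 'D_(delta_mx 0 i) h x.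

Definition rpartials (s : seq 'I_n) h : 'rV[R]_n -> R := foldr rpartial h s.

Definition rschwartz h : Prop :=
  (forall s x, differentiable (rpartials s h) x) /\
  forall N : nat, exists M : R, forall s x, (size s <= N)%N ->
    (1 + enorm x) ^+ N * `|rpartials s h x| <= M.

Lemma enorm_ge0 x : 0 <= enorm x.
Proof. exact: sqrtr_ge0. Qed.

(** Each of the n factors 1 + x_i^2 is at most (1 + |x|)^2. *)
Lemma weight_ge x : 1 <= (1 + enorm x) ^+ (2 * n) * weight x.
Proof.
rewrite /weight exprM -[X in _ ^+ X]card_ord -prodr_const -big_split/=.
have H (i : 'I_n) : 1 <= (1 + enorm x) ^+ 2 * cauchy (x 0 i).
  rewrite /cauchy ler_pdivlMr ?ltr_wpDr ?sqr_ge0// mul1r sqrrD expr1n mul1r.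
  have : x 0 i ^+ 2 <= enorm x ^+ 2.
    rewrite enorm_sqr /dotr (bigD1 i)//= -expr2 lerDl.
    by apply: sumr_ge0 => j _; exact: sqr_ge0.
  have := enorm_ge0 x; rewrite mulr2n; lra.
elim/big_ind : _ => // a b a1 b1.
by rewrite -[leLHS]mulr1 ler_pM.
Qed.

Lemma le_weight x (a M : R) : (1 + enorm x) ^+ (2 * n) * `|a| <= M -> `|a| <= M * weight x.
Proof.
move=> aM; have w0 := weight_gt0 x; have := weight_ge x.
apply: contraTT; rewrite -!ltNge => h.
have : (1 + enorm x) ^+ (2 * n) * `|a| * weight x < `|a|.
  by apply: le_lt_trans h; rewrite ler_wpM2r// ltW.
rewrite mulrAC => h2; have a0 : 0 < `|a|.
  rewrite lt_neqAle normr_ge0 andbT eq_sym; apply/eqP => a0; move: h2.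
  by rewrite a0 mulr0 ltxx.
by move: h2; rewrite -{2}[`|a|]mul1r ltr_pM2r.
Qed.

Lemma rschwartz_weight h : rschwartz h -> exists M, forall x, `|h x| <= M * weight x.
Proof.
move=> [_ /(_ (2 * n)%N)[M HM]]; exists M => x.
by apply: le_weight; have := HM [::] x (leq0n _).
Qed.

Lemma rpartials_rcons s i h : rpartials s (rpartial i h) = rpartials (rcons s i) h.
Proof. by rewrite /rpartials foldr_rcons. Qed.

Lemma rschwartz_partial i h : rschwartz h -> rschwartz (rpartial i h).
Proof.
move=> [dh Hh]; split=> [s x|N]; first by rewrite rpartials_rcons.
have [M HM] := Hh N.+1; exists M => s x sN.
rewrite rpartials_rcons; have := HM (rcons s i) x; rewrite size_rcons ltnS => /(_ sN).
apply: le_trans; rewrite ler_wpM2r// exprS ler_peMl ?exprn_ge0 ?addr_ge0 ?enorm_ge0//.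
by rewrite lerDl enorm_ge0.
Qed.

Lemma rschwartz_continuous h : rschwartz h -> continuous h.
Proof.
by move=> [dh _] x; apply: differentiable_continuous; exact: (dh [::] x).
Qed.

Lemma rschwartz_is_derive i h x : rschwartz h ->
  is_derive x (delta_mx 0 i) h (rpartial i h x).
Proof.
by move=> [/(_ [::] x) dh _]; apply: DeriveDef => //; exact: diff_derivable.
Qed.

(* Cosine transform with a phase: [phi = 0] and [phi = - (pi / 2)] give, up to
   sign, the real and imaginary parts of the Fourier transform of a real function. *)
Definition rfourier phi h xi : R :=
  \int[lebRn n]_t (cos (2 * pi * dotr xi (rV_of t) + phi) * h (rV_of t)).

Lemma measurable_rfourier_integrand phi h xi : measurable_fun setT (fun t : T n => h (rV_of t)) ->
  measurable_fun setT (fun t : T n => cos (2 * pi * dotr xi (rV_of t) + phi) * h (rV_of t)).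
Proof.
move=> mh; apply: measurable_funM => //.
apply: (@measurableT_comp _ _ _ _ _ _ cos).
  by apply: continuous_measurable_fun; exact: continuous_cos.
by apply: measurable_funD => //; apply: measurable_funM => //; exact: measurable_dotrl.
Qed.

Lemma integrable_le_weight (u : T n -> R) M : measurable_fun setT u ->
  (forall t, `|u t| <= M * weight (rV_of t)) ->
  (lebRn n).-integrable setT (EFin \o u).
Proof.
move=> mu uM; apply: (@le_integrable_EFin _ _ _ _ _ (fun t => M * weight (rV_of t))) => //.
exact: (integrableZl measurableT M (integrable_weight n)).
Qed.

Lemma norm_cosM (a b : R) : `|cos a * b| <= `|b|.
Proof. by rewrite normrM ler_piMl// cos_max. Qed.

Lemma rfourier_bounded h : rschwartz h ->
  exists C, forall phi xi, `|rfourier phi h xi| <= C.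
Proof.
move=> sh; have [M HM] := rschwartz_weight sh.
have mh := measurable_continuous_rV (rschwartz_continuous sh).
exists (\int[lebRn n]_t (M * weight (rV_of t))) => phi xi.
have ig : (lebRn n).-integrable setT (EFin \o (fun t : T n =>
   cos (2 * pi * dotr xi (rV_of t) + phi) * h (rV_of t))).
  apply: (@integrable_le_weight _ M); first exact: measurable_rfourier_integrand.
  by move=> t; rewrite (le_trans (norm_cosM _ _)).
apply: (le_trans (le_normr_Rintegral _ ig)) => //.
apply: le_Rintegral => //.
- exact: (integrable_norm ig).
- exact: (integrableZl measurableT M (integrable_weight n)).
- by move=> t _; rewrite (le_trans (norm_cosM _ _)).
Qed.

(** The i-th derivative of cos (theta) h has integral 0. Writing - sin theta as cos (theta + pi / 2)
    makes the result a transform of the same kind with shifted phase. *)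
Lemma rfourier_partial phi h i xi : rschwartz h ->
  2 * pi * xi 0 i * rfourier (phi + pi / 2) h xi = - rfourier phi (rpartial i h) xi.
Proof.
move=> sh; have sdh := rschwartz_partial i sh.
have [M HM] := rschwartz_weight sh; have [M' HM'] := rschwartz_weight sdh.
have mh := measurable_continuous_rV (rschwartz_continuous sh).
have mdh := measurable_continuous_rV (rschwartz_continuous sdh).
pose th x := 2 * pi * dotr xi x + phi.
pose H x := cos (th x) * h x.
pose H' x := cos (th x) * rpartial i h x + 2 * pi * xi 0 i * (cos (th x + pi / 2) * h x).
have thD x (z : R) : th (z *: delta_mx 0 i + x) = th x + 2 * pi * xi 0 i * z.
  rewrite /th; have -> : dotr xi (z *: delta_mx 0 i + x) = z * xi 0 i + dotr xi x.
    rewrite /dotr (bigD1 i)//= [in RHS](bigD1 i)//= !mxE !eqxx.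
    rewrite [X in _ + X = _](eq_bigr (fun j => xi 0 j * x 0 j)); first by rewrite /= mulr1; ring.
    by move=> j ji; rewrite !mxE eqxx (negbTE ji) mulr0 add0r.
  by ring.
have dH x : is_derive x (delta_mx 0 i) H (H' x).
  have dh := (is_derive_line _ _ _ _).1 (rschwartz_is_derive i x sh).
  apply/is_derive_line.
  rewrite /H; under eq_fun do rewrite thD.
  apply: (is_derive_eq (der_mul (der_cos (der_add (der_cst 0 (th x)) (der_mul (der_cst 0 (2 * pi
    * xi 0 i)) (der_id 0)))) dh)).
  by rewrite !(mulr0, mul0r, addr0, add0r, scale0r, mulr1) /H' cosDpihalf; ring.
have line x : continuous (fun z : R => z *: delta_mx 0 i + x : 'rV[R]_n).
  by move=> z; apply: cvgD; [apply: cvgZr_tmp; exact: cvg_id|exact: cvg_cst].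
have cl (g : 'rV[R]_n -> R) x : continuous g -> continuous (fun z : R => g (z *: delta_mx 0 i + x)).
  by move=> cg z; apply: (@continuous_comp _ _ _ (fun z : R => z *: delta_mx 0 i + x) g);
    [exact: line|exact: cg].
pose C := M' + `|2 * pi * xi 0 i| * M.
have m1 := measurable_rfourier_integrand phi xi mdh.
have m2 := measurable_rfourier_integrand (phi + pi / 2) xi mh.
have M'0 : 0 <= M' by have := HM' 0; rewrite -ler_pdivrMr ?weight_gt0//; apply: le_trans;
  rewrite divr_ge0// ltW// weight_gt0.
have M0 : 0 <= M by have := HM 0; rewrite -ler_pdivrMr ?weight_gt0//; apply: le_trans;
  rewrite divr_ge0// ltW// weight_gt0.
have : \int[lebRn n]_t H' (rV_of t) = 0.
  apply: (@integral_partial_eq0 _ n i H H' (M + C)) => //.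
  - move=> x; rewrite /H'; under eq_fun do rewrite thD.
    have c1 := cl _ x (rschwartz_continuous sdh); have c2 := cl _ x (rschwartz_continuous sh).
    apply: ctsD; first by apply: ctsM => //; continuity.
    by apply: ctsM; [continuity|apply: ctsM => //; continuity].
  - apply: measurable_funD => //; apply: measurable_funM => //.
    by under eq_fun do rewrite /th -addrA; exact: m2.
  - move=> x; rewrite (le_trans (norm_cosM _ _))// (le_trans (HM x))//.
    by rewrite ler_wpM2r ?(ltW (weight_gt0 _))// lerDl addr_ge0// mulr_ge0.
  - move=> x; rewrite (le_trans (ler_normD _ _))//.
    apply: (@le_trans _ _ (C * weight x)); last first.
      by rewrite ler_wpM2r ?(ltW (weight_gt0 _))// lerDr.
    rewrite [leRHS]mulrDl lerD//; first by rewrite (le_trans (norm_cosM _ _)).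
    by rewrite normrM -[leRHS]mulrA ler_wpM2l// (le_trans (norm_cosM _ _)).
rewrite RintegralD//; last 2 first.
- apply: (@integrable_le_weight _ M') => // t.
  by rewrite (le_trans (norm_cosM _ _)).
- apply: (@integrable_le_weight _ (`|2 * pi * xi 0 i| * M)).
    apply: measurable_funM => //.
    by under eq_fun do rewrite /th -addrA; exact: m2.
  by move=> t; rewrite normrM -[leRHS]mulrA ler_wpM2l// (le_trans (norm_cosM _ _)).
rewrite RintegralZl//; last first.
  apply: (@integrable_le_weight _ M).
    by under eq_fun do rewrite /th -addrA; exact: m2.
  by move=> t; rewrite (le_trans (norm_cosM _ _)).
under [in X in _ + _ * X = _ -> _]eq_Rintegral do rewrite /th -addrA.
by move=> E; apply/eqP; rewrite -addr_eq0 addrC; apply/eqP; exact: E.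
Qed.

(** Each factor 1 + xi_i^2 costs two derivatives along i, since (2 pi)^2 >= 1; the induction runs
    over the list of coordinates. The constant is uniform in [phi] because each integration by parts
    shifts the phase. The bound makes the transform admissible in [subord_fubini]. *)
Lemma rfourier_decay h : rschwartz h ->
  exists C, forall phi xi, `|rfourier phi h xi| <= C * weight xi.
Proof.
move=> sh.
suff [C HC] : exists C, forall phi xi, (\prod_(i <- index_enum 'I_n) (1 + xi 0 i ^+ 2)) *
  `|rfourier phi h xi| <= C.
  exists C => phi xi; have := HC phi xi.
  rewrite -[X in X * _]invrK -prodfV mulrC ler_pdivrMr// prodr_gt0// => i _.
  exact: (cauchy_gt0 (xi 0 i)).
elim: (index_enum _) => [|i l IH] in h sh *.
  by have [C HC] := rfourier_bounded sh; exists C => phi xi; rewrite big_nil mul1r.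
have [C1 H1] := IH _ sh; have [C2 H2] := IH _ (rschwartz_partial i (rschwartz_partial i sh)).
exists (C1 + C2) => phi xi; rewrite big_cons mulrAC mulrC.
have P0 : 0 <= \prod_(j <- l) (1 + xi 0 j ^+ 2) by apply: prodr_ge0 => j _;
  rewrite addr_ge0 ?sqr_ge0.
apply: (le_trans _ (lerD (H1 phi xi) (H2 (phi - pi / 2 - pi / 2) xi))).
rewrite -mulrDr ler_wpM2l// mulrDl mul1r lerD2l.
have E : (2 * pi * xi 0 i) ^+ 2 * rfourier phi h xi = rfourier (phi - pi / 2 - pi / 2) (rpartial
  i (rpartial i h)) xi.
  have := rfourier_partial (phi - pi / 2) i xi sh.
  have := rfourier_partial (phi - pi / 2 - pi / 2) i xi (rschwartz_partial i sh).
  rewrite !subrK => e1 e2; rewrite expr2 -mulrA e2 mulrN e1 opprK//.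
rewrite -E normrM ler_wpM2r// ger0_norm ?sqr_ge0// exprMn ler_peMl ?sqr_ge0//.
have : 2 <= pi :> R by exact: pi_ge2.
by move=> p2; rewrite exprn_ege1//; lra.
Qed.

End defs.
End real_schwartz.

Section Rintegral_extra.
Context {R : realType}.

(** When [k] has infinite integral, both sides are 0 through [fine]. Hence [subord] may be
    multiplied by a constant even at a point where its integral diverges. *)
Lemma ge0_RintegralZr d (U : measurableType d) (nu : {measure set U -> \bar R})
  (k : U -> R) (c : R) : measurable_fun setT k -> (forall x, 0 <= k x) ->
  \int[nu]_x (k x * c) = (\int[nu]_x k x) * c.
Proof.
move=> mk k0.
have pos (a : R) : 0 <= a -> \int[nu]_x (k x * a) = (\int[nu]_x k x) * a.
  move=> a0; rewrite /Rintegral.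
  under eq_integral do rewrite EFinM.
  rewrite ge0_integralZr//; last 2 first.
  - exact/measurable_EFinP.
  - by move=> x _; rewrite lee_fin.
  have : (0 <= \int[nu]_x (k x)%:E)%E by apply: integral_ge0 => x _; rewrite lee_fin.
  case: (\int[nu]_x (k x)%:E)%E => [r _|_|//]; first by rewrite -EFinM.
  rewrite mul0r; move: a0; rewrite le_eqVlt => /predU1P[<-|a0].
    by rewrite mule0.
  by rewrite gt0_mulye.
have [c0|c0] := leP 0 c; first exact: pos.
have := pos (- c); rewrite oppr_ge0 => /(_ (ltW c0)).
rewrite mulrN => E; apply: oppr_inj; rewrite -E /Rintegral -fineN; congr fine.
have -> : (\int[nu]_x (k x * c)%:E = - \int[nu]_x (k x * - c)%:E)%E.
  rewrite -integral_ge0N; last by move=> x _; rewrite lee_fin mulr_ge0// oppr_ge0 ltW.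
  by apply: eq_integral => x _; rewrite -EFinN mulrN opprK.
by rewrite oppeK.
Qed.

Lemma Rintegral_opp (f : R -> R) : measurable_fun setT f ->
  \int[@lebesgue_measure R]_x f (- x) = \int[@lebesgue_measure R]_x f x.
Proof.
move=> mf; rewrite /Rintegral; congr fine; rewrite integralE [RHS]integralE.
have me : measurable_fun setT (EFin \o f) by exact/measurable_EFinP.
congr (_ - _)%E.
  rewrite -(@ge0_integral_opp _ ((EFin \o f)^\+%E)).
  - by apply: eq_integral => x _; rewrite !funeposE.
  - exact: measurable_funepos.
  - by move=> x; exact: funepos_ge0.
rewrite -(@ge0_integral_opp _ ((EFin \o f)^\-%E)).
- by apply: eq_integral => x _; rewrite !funenegE.
- exact: measurable_funeneg.
- by move=> x; exact: funeneg_ge0.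
Qed.

Lemma integrable_fine d (U : measurableType d) (nu : {measure set U -> \bar R})
  (f : U -> \bar R) : nu.-integrable setT f -> nu.-integrable setT (EFin \o (fine \o f)).
Proof.
move=> fi; have mf := measurable_int _ fi.
apply: (le_integrable measurableT _ _ fi).
  by apply/measurable_EFinP; exact: measurableT_comp.
by move=> x _ /=; case: (f x) => [r||] //=; rewrite normr0 leey.
Qed.

End Rintegral_extra.

(** * Superpositions of Gaussians tested against bounded multiples of the weight *)

Section subordination.
Context {R : realType}.
Local Notation mu := (@lebesgue_measure R).
Local Notation T n := (n.-tuple (measurableTypeR R)).
Variables (n : nat) (al be : R).
Hypotheses (al0 : 0 < al) (be0 : 0 < be) (albe : al + be = n%:R / 2).
Variable kap : R -> R -> R.
Hypothesis kap0 : forall tau q, 0 <= kap tau q.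
Hypothesis kap_le : forall tau q, 0 <= q -> kap tau q <= expR (al * tau - q * expR tau).
Hypothesis mkap : measurable_fun setT (fun z : R * R => kap z.1 z.2).

(** The kernel [kap] is kept abstract because the exchange of integrals is made for the kernels on
    both sides of the transform, with [al] and [be] swapped. Where the integral diverges the value
    is 0. *)
Definition subord (x : 'rV[R]_n) : R := \int[mu]_tau kap tau (dotr x x).

Lemma measurable_kap1 q : measurable_fun setT (kap ^~ q).
Proof.
apply: (@measurableT_comp _ _ _ _ _ _ (fun z : R * R => kap z.1 z.2) _ (fun tau => (tau, q))) => //.
Qed.

Variables (h : T n -> R) (M : R).
Hypothesis mh : measurable_fun setT h.
Hypothesis hM : forall t, `|h t| <= M * weight (rV_of t).

Lemma integrable_subord2 : (lebRn n \x mu)%E.-integrable setT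
  (EFin \o (fun z : T n * measurableTypeR R => kap z.2 (dotr (rV_of z.1) (rV_of z.1)) * h z.1)).
Proof.
apply: (@le_integrable_EFin _ _ _ (lebRn n \x mu)%E _ (fun z : T n * measurableTypeR R =>
   M * (expR (al * z.2 - dotr (rV_of z.1) (rV_of z.1) * expR z.2) * weight (rV_of z.1)))).
- apply: measurable_funM; last by apply: measurableT_comp => //; exact: measurable_fst.
  apply: (@measurableT_comp _ _ _ _ _ _ (fun z : R * R => kap z.1 z.2) _
    (fun z : T n * measurableTypeR R => (z.2, dotr (rV_of z.1) (rV_of z.1)))) => //.
  apply: measurable_fun_pair; first exact: measurable_snd.
  by apply: measurable_dotr; exact: measurable_fst.
- move=> z; rewrite normrM ger0_norm// mulrCA.
  by apply: ler_pM => //; apply: kap_le; exact: dotr_ge0.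
- exact: (integrableZl measurableT M (integrable_ker al0 be0 albe)).
Qed.

Lemma subord_fubini : \int[lebRn n]_t (subord (rV_of t) * h t) =
  \int[mu]_tau \int[lebRn n]_t (kap tau (dotr (rV_of t) (rV_of t)) * h t).
Proof.
have := Rintegral_fubini integrable_subord2; rewrite /= => <-.
by apply: eq_Rintegral => t _; rewrite ge0_RintegralZr//; exact: measurable_kap1.
Qed.

Lemma integrable_subord :
  (lebRn n).-integrable setT (EFin \o (fun t => subord (rV_of t) * h t)).
Proof.
have := integrable_fine (integrable_fubini_F integrable_subord2).
rewrite (_ : (fun t => _) = fine \o fubini_F mu (EFin \o
  (fun z : T n * measurableTypeR R => kap z.2 (dotr (rV_of z.1) (rV_of z.1)) * h z.1)))//.
apply/funext => t; rewrite -[LHS]ge0_RintegralZr//; exact: measurable_kap1.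
Qed.

End subordination.

(** * Complex test functions and tempered distributions *)

Section complex_integral.
Context {R : realType}.
Variable n : nat.
Local Notation T n := (n.-tuple (measurableTypeR R)).
Implicit Types (f g : 'rV[R]_n -> complex.complex R) (u : 'rV[R]_n -> R).
Import complex.

Local Open Scope complex_scope.

Lemma Re_partials (s : seq 'I_n) f x :
  Re (partials s f x) = rpartials s (fun x => Re (f x)) x.
Proof.
elim: s x => [//|i s IH] x; rewrite /= /rpartial.
by congr ('D_ _ _ x); apply/funext => z; exact: IH.
Qed.

Lemma Im_partials (s : seq 'I_n) f x :
  Im (partials s f x) = rpartials s (fun x => Im (f x)) x.
Proof.
elim: s x => [//|i s IH] x; rewrite /= /rpartial.
by congr ('D_ _ _ x); apply/funext => z; exact: IH.
Qed.

Lemma Re_le_norm (z : R[i]) : `|Re z| <= Num.sqrt (Re z ^+ 2 + Im z ^+ 2).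
Proof. by rewrite -sqrtr_sqr ler_wsqrtr// lerDl sqr_ge0. Qed.

Lemma Im_le_norm (z : R[i]) : `|Im z| <= Num.sqrt (Re z ^+ 2 + Im z ^+ 2).
Proof. by rewrite -sqrtr_sqr ler_wsqrtr// lerDr sqr_ge0. Qed.

Lemma norm_le_ReIm (z : R[i]) (M : R) : `|Re z| + `|Im z| <= M -> `|z| <= M%:C.
Proof.
move=> zM; rewrite normc_def lecR (le_trans _ zM)// -[leRHS]ger0_norm ?addr_ge0//.
rewrite -sqrtr_sqr ler_wsqrtr// sqrrD !real_normK ?num_real// -addrA lerD2l.
by rewrite lerDr mulrn_wge0// mulr_ge0.
Qed.

Lemma seminorm_le_ReIm N f M : seminorm_le N f M -> forall s x, (size s <= N)%N ->
  (1 + enorm x) ^+ N * `|rpartials s (fun x => Re (f x)) x| <= M /\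
  (1 + enorm x) ^+ N * `|rpartials s (fun x => Im (f x)) x| <= M.
Proof.
move=> fM s x sN; have := fM s x sN.
rewrite normc_def -rmorphM lecR => h.
have e0 : 0 <= (1 + enorm x) ^+ N by rewrite exprn_ge0// addr_ge0// enorm_ge0.
rewrite -Re_partials -Im_partials.
split; apply: le_trans h; rewrite ler_wpM2l//; [exact: Re_le_norm|exact: Im_le_norm].
Qed.

Lemma schwartz_ReIm f : schwartz f ->
  rschwartz (fun x => Re (f x)) /\ rschwartz (fun x => Im (f x)).
Proof.
move=> [df Hf]; split; split.
- move=> s x; rewrite (_ : rpartials s _ = fun z => Re (partials s f z)).
    by have [] := df s x.
  by apply/funext => z; rewrite Re_partials.
- move=> N; have [M HM] := Hf N; exists M => s x sN.
  exact: (seminorm_le_ReIm HM x sN).1.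
- move=> s x; rewrite (_ : rpartials s _ = fun z => Im (partials s f z)).
    by have [] := df s x.
  by apply/funext => z; rewrite Im_partials.
- move=> N; have [M HM] := Hf N; exists M => s x sN.
  exact: (seminorm_le_ReIm HM x sN).2.
Qed.

Lemma seminorm_le_weight f M : seminorm_le (2 * n) f M ->
  forall x, `|Re (f x)| <= M * weight x /\ `|Im (f x)| <= M * weight x.
Proof.
move=> fM x; have [h1 h2] := seminorm_le_ReIm fM x (leq0n _ : (size [::] <= 2 * n)%N).
by split; apply: le_weight.
Qed.

Lemma Re_scale (a : R) (z : R[i]) : Re (a%:C * z) = a * Re z.
Proof. by case: z => b c /=; rewrite mul0r subr0. Qed.

Lemma Im_scale (a : R) (z : R[i]) : Im (a%:C * z) = a * Im z.
Proof. by case: z => b c /=; rewrite mul0r addr0. Qed.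

Lemma distr_ofE u f : distr_of u f =
  (\int[lebRn n]_t (u (rV_of t) * Re (f (rV_of t)))) +i*
  (\int[lebRn n]_t (u (rV_of t) * Im (f (rV_of t)))).
Proof.
rewrite /distr_of /Rn_integral; congr (_ +i* _); apply: eq_Rintegral => t _.
  exact: Re_scale.
exact: Im_scale.
Qed.

(** Taking the weight itself as [h] shows that |u| times the weight has a finite integral [A]. A
    bound [M] on the seminorm of order [2 * n] bounds real and imaginary parts by [M] times the
    weight, hence the constant [A + A]. *)
Lemma tempered_of_integrable u :
  (forall h : T n -> R, measurable_fun setT h -> forall M,
    (forall t, `|h t| <= M * weight (rV_of t)) ->
    (lebRn n).-integrable setT (EFin \o (fun t => u (rV_of t) * h t))) ->
  tempered_function u.
Proof.
move=> iu.
have mR h : rschwartz h -> measurable_fun setT (fun t : T n => h (rV_of t)).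
  by move=> /rschwartz_continuous; exact: measurable_continuous_rV.
have iS (h : 'rV[R]_n -> R) : rschwartz h ->
    (lebRn n).-integrable setT (EFin \o (fun t => u (rV_of t) * h (rV_of t))).
  move=> sh; have [M HM] := rschwartz_weight sh.
  exact: (iu _ (mR _ sh) M (fun t => HM _)).
split.
  move=> f /schwartz_ReIm[sr si]; split.
    by under eq_fun do rewrite Re_scale; exact: (iS _ sr).
  by under eq_fun do rewrite Im_scale; exact: (iS _ si).
split.
  move=> [a b] f g /schwartz_ReIm[fr fi] /schwartz_ReIm[gr gi].
  have Z c (h : 'rV[R]_n -> R) : rschwartz h ->
      c * \int[lebRn n]_t (u (rV_of t) * h (rV_of t)) =
      \int[lebRn n]_t (c * (u (rV_of t) * h (rV_of t))).
    by move=> sh; rewrite RintegralZl//; exact: iS.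
  rewrite !distr_ofE; apply/eqP; rewrite eq_complex/=; apply/andP; split; apply/eqP.
    have i1 := integrableZl measurableT a (iS _ fr).
    have i2 := integrableZl measurableT b (iS _ fi).
    have i12 := integrableB measurableT i1 i2.
    rewrite (Z _ _ fr) (Z _ _ fi).
    rewrite -RintegralB// -RintegralD//; last exact: (iS _ gr).
    apply: eq_Rintegral => t _; case: (f _) (g _) => [p q] [p' q'] /=; ring.
  have i1 := integrableZl measurableT a (iS _ fi).
  have i2 := integrableZl measurableT b (iS _ fr).
  have i12 := integrableD measurableT i1 i2.
  rewrite (Z _ _ fr) (Z _ _ fi).
  rewrite -RintegralD// -RintegralD//; last exact: (iS _ gi).
  by apply: eq_Rintegral => t _; case: (f _) (g _) => [p q] [p' q'] /=; ring.
have mw : measurable_fun setT (fun t : T n => weight (rV_of t)).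
  exact: measurable_weight.
have wle (t : T n) : `|weight (rV_of t)| <= 1 * weight (rV_of t).
  by rewrite mul1r ger0_norm// ltW// weight_gt0.
have iw := iu _ mw 1 wle.
pose A := \int[lebRn n]_t `|u (rV_of t) * weight (rV_of t)|.
exists (2 * n)%N, (A + A) => f M sf fM.
have [sr si] := schwartz_ReIm sf.
have B (h : 'rV[R]_n -> R) : rschwartz h -> (forall x, `|h x| <= M * weight x) ->
    `|\int[lebRn n]_t (u (rV_of t) * h (rV_of t))| <= A * M.
  move=> sh hM; apply: (le_trans (le_normr_Rintegral _ (iS _ sh))) => //.
  rewrite /A -RintegralZr//; last exact: (integrable_norm iw).
  apply: le_Rintegral => //.
  - exact: (integrable_norm (iS _ sh)).
  - exact: (integrableZr measurableT M (integrable_norm iw)).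
  - move=> t _; rewrite !normrM -mulrA ler_wpM2l//.
    by rewrite (ger0_norm (ltW (weight_gt0 _))) mulrC.
rewrite distr_ofE; apply: norm_le_ReIm => /=; rewrite mulrDl.
apply: lerD.
  by apply: (B _ sr) => x; have [] := seminorm_le_weight fM x.
by apply: (B _ si) => x; have [] := seminorm_le_weight fM x.
Qed.

End complex_integral.

Section product_measure.
Context d1 d2 (T1 : measurableType d1) (T2 : measurableType d2) (R : realType).
Variable m1 : {sigma_finite_measure set T1 -> \bar R}.
Variable m2 : {sigma_finite_measure set T2 -> \bar R}.

Lemma measurable_Rintegral (f : T1 * T2 -> R) : measurable_fun setT f ->
  measurable_fun setT (fun x => \int[m2]_y f (x, y)).
Proof.
move=> mf; have me : measurable_fun setT (EFin \o f) by exact/measurable_EFinP.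
rewrite (_ : (fun x => _) = fine \o (fun x => fubini_F m2 (EFin \o f)^\+%E x -
    fubini_F m2 (EFin \o f)^\-%E x)%E).
  apply: measurableT_comp => //; apply: emeasurable_funB.
    by apply: measurable_fun_fubini_tonelli_F => //; exact: measurable_funepos.
  by apply: measurable_fun_fubini_tonelli_F => //; exact: measurable_funeneg.
apply/funext => x; rewrite /Rintegral /comp /fubini_F; congr fine; rewrite integralE.
by congr (_ - _)%E; apply: eq_integral => y _; rewrite ?funeposE ?funenegE.
Qed.

Lemma integrable_Rintegral_l (f : T1 * T2 -> R) : (m1 \x m2)%E.-integrable setT (EFin \o f) ->
  m2.-integrable setT (EFin \o (fun y => \int[m1]_x f (x, y))).
Proof.
move=> intf; have mf := measurable_int _ intf.
have /integrable21ltyP -/(_ mf) lty := intf.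
apply: (integrable_fine (f := fubini_G m1 (EFin \o f))).
apply/integrableP; split; first exact: (measurable_fubini_G intf).
apply: le_lt_trans lty; apply: ge0_le_integral => //.
- by apply: measurableT_comp => //; exact: (measurable_fubini_G intf).
- apply: (measurable_fun_fubini_tonelli_G (abse \o (EFin \o f))) => //=.
  exact: measurableT_comp.
- move=> y _; apply: le_abse_integral => //.
  exact: (measurableT_comp mf (measurable_pair2 y)).
Qed.

Lemma integrable_Rintegral_r (f : T1 * T2 -> R) : (m1 \x m2)%E.-integrable setT (EFin \o f) ->
  m1.-integrable setT (EFin \o (fun x => \int[m2]_y f (x, y))).
Proof. by move=> intf; exact: integrable_fine (integrable_fubini_F intf). Qed.

Lemma integrable_prodM (u : T1 -> R) (v : T2 -> R) :
  m1.-integrable setT (EFin \o u) -> m2.-integrable setT (EFin \o v) ->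
  (m1 \x m2)%E.-integrable setT (EFin \o (fun z => u z.1 * v z.2)).
Proof.
move=> iu iv.
have /measurable_EFinP mu := measurable_int _ iu.
have /measurable_EFinP mv := measurable_int _ iv.
apply/integrable12ltyP.
  apply/measurable_EFinP; apply: measurable_funM; apply: measurableT_comp => //.
have /integrableP[_ ltu] := iu; have /integrableP[_ ltv] := iv.
set c := (\int[m2]_x `|(EFin \o v) x|)%E in ltv.
have c0 : (0 <= c)%E by exact: integral_ge0.
rewrite (eq_integral (fun x => `|(u x)%:E| * c)%E); last first.
  move=> x _; rewrite /c -ge0_integralZl//.
    by apply: eq_integral => y _; rewrite /= normrM EFinM.
  exact/measurableT_comp/measurable_EFinP.
rewrite ge0_integralZr//; last exact/measurableT_comp/measurable_EFinP.
rewrite lte_mul_pinfty//; first exact: integral_ge0.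
by rewrite ge0_fin_numE//; exact: integral_ge0.
Qed.

End product_measure.

(** * The duality between the two superpositions *)

Section duality.
Context {R : realType}.
Local Notation mu := (@lebesgue_measure R).
Local Notation T n := (n.-tuple (measurableTypeR R)).
Variables (n : nat) (s p y : R).
Hypotheses (s0 : 0 < s) (p0 : 0 < p) (ps : p + s = n%:R / 2).

(* At [tau], the Fourier transform turns the Gaussian of [kapU] into that of [kapG] at
   [- tau]. *)
Definition kapU tau q : R := expR (p * tau - (y ^+ 2 + q) * expR tau).
Definition kapG tau q : R :=
  expR (s * tau - pi ^+ 2 * q * expR tau - y ^+ 2 * expR (- tau)).

Lemma kapU_ge0 tau q : 0 <= kapU tau q. Proof. exact: expR_ge0. Qed.
Lemma kapG_ge0 tau q : 0 <= kapG tau q. Proof. exact: expR_ge0. Qed.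

Lemma kapU_le tau q : 0 <= q -> kapU tau q <= expR (p * tau - q * expR tau).
Proof.
move=> q0; rewrite ler_expR lerD2l lerN2 ler_wpM2r ?expR_ge0//.
by rewrite lerDr sqr_ge0.
Qed.

Lemma kapG_le tau q : 0 <= q -> kapG tau q <= expR (s * tau - q * expR tau).
Proof.
move=> q0; rewrite ler_expR -addrA lerD2l.
have h1 : 0 <= y ^+ 2 * expR (- tau) by rewrite mulr_ge0 ?sqr_ge0 ?expR_ge0.
have h2 : q * expR tau <= pi ^+ 2 * q * expR tau.
  rewrite ler_wpM2r ?expR_ge0// ler_peMl// exprn_ege1//.
  by rewrite (le_trans _ (pi_ge2 R))// ler1n.
lra.
Qed.

Lemma measurable_kapU : measurable_fun setT (fun z : R * R => kapU z.1 z.2).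
Proof. by rewrite /kapU; measurability. Qed.

Lemma measurable_kapG : measurable_fun setT (fun z : R * R => kapG z.1 z.2).
Proof. by rewrite /kapG; measurability. Qed.

Let sp : s + p = n%:R / 2. Proof. by rewrite addrC. Qed.

Lemma measurable_fourier_kernel phi h : measurable_fun setT (fun t : T n => h (rV_of t)) ->
  measurable_fun setT (fun z : T n * T n =>
    cos (2 * pi * dotr (rV_of z.1) (rV_of z.2) + phi) * h (rV_of z.2)).
Proof.
move=> mh.
apply: measurable_funM; last first.
  by apply: (@measurableT_comp _ _ _ _ _ _ (fun t : T n => h (rV_of t))) => //;
    exact: measurable_snd.
apply: (@measurableT_comp _ _ _ _ _ _ cos).
  by apply: continuous_measurable_fun; exact: continuous_cos.
apply: measurable_funD => //; apply: measurable_funM => //.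
by apply: measurable_dotr; [exact: measurable_fst|exact: measurable_snd].
Qed.

Lemma dotrZl a (x z : 'rV[R]_n) : dotr (a *: x) z = a * dotr x z.
Proof. by rewrite /dotr mulr_sumr; apply: eq_bigr => i _; rewrite mxE mulrA. Qed.

Lemma dotrC (x z : 'rV[R]_n) : dotr x z = dotr z x.
Proof. by apply: eq_bigr => i _; rewrite mulrC. Qed.

Lemma gauss_fourier_2pi a (x : 'rV[R]_n) phi c :
  \int[lebRn n]_t (expR (- (expR a * dotr (rV_of t) (rV_of t))) *
    (cos (2 * pi * dotr (rV_of t) x + phi) * c)) =
  expR (n%:R / 2 * ln pi - n%:R / 2 * a - pi ^+ 2 * dotr x x * expR (- a)) * cos phi * c.
Proof.
have E (t : T n) : expR (- (expR a * dotr (rV_of t) (rV_of t))) *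
    (cos (2 * pi * dotr (rV_of t) x + phi) * c) =
    expR (- (expR a * dotr (rV_of t) (rV_of t))) * cos (dotr ((2 * pi) *: x) (rV_of t) + phi) * c.
  by rewrite dotrZl [dotr x _]dotrC mulrA.
under eq_Rintegral do rewrite E.
have ig := integrable_gauss_cos_nd ((2 * pi) *: x) phi (expR_gt0 a).
rewrite (RintegralZr c measurableT ig) gauss_fourier ?expR_gt0//.
congr (_ * _ * _); rewrite /gaussc expRK -expRM_natl -expRD; congr expR.
rewrite dotrZl dotrC dotrZl expRN; have := expR_gt0 a.
have [L ->] : exists L, ln (pi : R) = L by exists (ln pi).
move: (expR a) (pi : R) => b P b0.
by field; rewrite gt_eqF.
Qed.

Lemma measurable_rfourier phi h : rschwartz h ->
  measurable_fun setT (fun t : T n => rfourier phi h (rV_of t)).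
Proof.
move=> sh; have mh := measurable_continuous_rV (rschwartz_continuous sh).
apply: (@measurable_Rintegral _ _ _ _ _ (lebRn n) (fun z : T n * T n =>
  cos (2 * pi * dotr (rV_of z.1) (rV_of z.2) + phi) * h (rV_of z.2))).
exact: measurable_fourier_kernel.
Qed.

(** After Fubini in tau on both sides, the integrals over R^n are exchanged at fixed tau and the
    inner one is the transform of a Gaussian. As the Gaussian is even, the phase survives only as
    the factor [cos phi]. *)
Lemma subord_rfourier phi h : rschwartz h ->
  \int[lebRn n]_t (subord kapU (rV_of t) * rfourier phi h (rV_of t)) =
  cos phi * expR (n%:R / 2 * ln pi) * \int[lebRn n]_t (subord kapG (rV_of t) * h (rV_of t)).
Proof.
move=> sh; have [M HM] := rschwartz_weight sh; have [C HC] := rfourier_decay sh.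
have mh := measurable_continuous_rV (rschwartz_continuous sh).
rewrite (subord_fubini p0 s0 ps kapU_ge0 kapU_le measurable_kapU (measurable_rfourier phi sh)
  (fun t => HC phi _)).
have iG := integrable_subord2 s0 p0 sp kapG_ge0 kapG_le measurable_kapG mh (fun t => HM _).
rewrite (subord_fubini s0 p0 sp kapG_ge0 kapG_le measurable_kapG mh (fun t => HM _)).
pose Psi tau := \int[lebRn n]_t (kapG tau (dotr (rV_of t) (rV_of t)) * h (rV_of t)).
have iPsi : mu.-integrable setT (EFin \o Psi).
  exact: (integrable_Rintegral_l iG).
have mPsi : measurable_fun setT Psi.
  by have /integrableP[/measurable_EFinP] := iPsi.
rewrite -[X in _ = _ * X](Rintegral_opp mPsi).
have iPsiN : mu.-integrable setT (EFin \o (fun tau => Psi (- tau))).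
  exact: integrable_opp.
rewrite -RintegralZl//.
apply: eq_Rintegral => tau _.
pose g (t : T n) := expR (- (expR tau * dotr (rV_of t) (rV_of t))).
pose k (z : T n * T n) : R := g z.1 * (cos (2 * pi * dotr (rV_of z.1) (rV_of z.2) + phi) * h
  (rV_of z.2)).
have ik : (lebRn n \x lebRn n)%E.-integrable setT (EFin \o k).
  apply: (@le_integrable_EFin _ _ _ (lebRn n \x lebRn n)%E _ (fun z => g z.1 * (M * weight (rV_of
    z.2)))).
  - apply: measurable_funM; last exact: measurable_fourier_kernel.
    apply: (@measurableT_comp _ _ _ _ _ _ g) => //.
    by have /measurable_int/measurable_EFinP := integrable_gauss_nd n (expR_gt0 tau).
  - move=> z; rewrite normrM ger0_norm ?expR_ge0// ler_wpM2l ?expR_ge0//.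
    exact: (le_trans (norm_cosM _ _) (HM _)).
  - apply: (@integrable_prodM _ _ _ _ _ _ _ g (fun t => M * weight (rV_of t))).
      exact: (integrable_gauss_nd n (expR_gt0 tau)).
    exact: (integrableZl measurableT M (integrable_weight n)).
transitivity (expR (p * tau - y ^+ 2 * expR tau) * \int[lebRn n]_x \int[lebRn n]_y k (x, y)).
  have iF := integrable_Rintegral_r ik.
  rewrite -(RintegralZl _ measurableT iF).
  apply: eq_Rintegral => t _; rewrite /k /= /rfourier RintegralZl//; last first.
    apply: (integrable_le_weight (M := M)).
      exact: measurable_rfourier_integrand.
    by move=> u; exact: (le_trans (norm_cosM _ _) (HM _)).
  rewrite mulrA /g -expRD /kapU; congr (expR _ * _); ring.
have iG' := integrable_Rintegral_l ik.
rewrite (Rintegral_fubini ik) -(RintegralZl _ measurableT iG').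
have iK : (lebRn n).-integrable setT (EFin \o (fun t : T n => kapG (- tau) (dotr (rV_of t) (rV_of
  t)) * h (rV_of t))).
  apply: (integrable_le_weight (M := expR (s * - tau) * M)).
    apply: measurable_funM => //.
    apply: (@measurableT_comp _ _ _ _ _ _ (fun z : R * R => kapG z.1 z.2) _
      (fun t : T n => (- tau, dotr (rV_of t) (rV_of t)))); first exact: measurable_kapG.
    by apply: measurable_fun_pair => //; exact: measurable_dotrr.
  move=> t; rewrite normrM ger0_norm ?kapG_ge0// -mulrA ler_pM ?kapG_ge0//.
  apply: (le_trans (kapG_le _ (dotr_ge0 _))).
  by rewrite ler_expR gerBl mulr_ge0 ?dotr_ge0 ?expR_ge0.
rewrite /Psi -(RintegralZl _ measurableT iK).
apply: eq_Rintegral => u _; rewrite /k /= gauss_fourier_2pi /kapG.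
(* With n/2 = p + s the exponent p tau - (n/2) tau becomes s (- tau), the one of [kapG] at - tau. *)
rewrite opprK -ps.
rewrite !mulrA; congr (_ * _); rewrite -[RHS]mulrA -expRD mulrAC -expRD mulrC; congr (_ * expR _).
move: (ln _) (expR _) (expR _) => L e1 e2; ring.
Qed.

End duality.

Section fourier_pair.
Context {R : realType}.
Local Notation mu := (@lebesgue_measure R).
Local Notation T n := (n.-tuple (measurableTypeR R)).
Variables (n : nat) (s p y : R).
Hypotheses (s0 : 0 < s) (p0 : 0 < p) (ps : p + s = n%:R / 2).

(** Real and imaginary parts of exp (- i theta) (a + i b); the phase - pi / 2 turns the cosine into
    the sine of theta. *)
Lemma fourierE (f : 'rV[R]_n -> complex.complex R) : schwartz f -> forall xi,
  complex.Re (fourier f xi) = rfourier 0 (fun x => complex.Re (f x)) xi +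
    rfourier (- (pi / 2)) (fun x => complex.Im (f x)) xi /\
  complex.Im (fourier f xi) = rfourier 0 (fun x => complex.Im (f x)) xi -
    rfourier (- (pi / 2)) (fun x => complex.Re (f x)) xi.
Proof.
move=> /schwartz_ReIm[sr si] xi.
have ir phi (h : 'rV[R]_n -> R) : rschwartz h -> (lebRn n).-integrable setT
    (EFin \o (fun t : T n => cos (2 * pi * dotr xi (rV_of t) + phi) * h (rV_of t))).
  move=> sh; have [M HM] := rschwartz_weight sh.
  apply: (integrable_le_weight (M := M)).
    exact: (measurable_rfourier_integrand _ _ (measurable_continuous_rV (rschwartz_continuous sh))).
  by move=> u; exact: (le_trans (norm_cosM _ _) (HM _)).
rewrite /fourier /Rn_integral /rfourier /=.
rewrite -(RintegralD measurableT (ir 0 _ sr) (ir (- (pi / 2)) _ si)).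
rewrite -(RintegralB measurableT (ir 0 _ si) (ir (- (pi / 2)) _ sr)).
have sE (w : R) : cos (w - pi / 2) = sin w by rewrite cosB cos_pihalf sin_pihalf mulr0 add0r mulr1.
split; apply: eq_Rintegral => t _; rewrite sE addr0 /cis cosN sinN;
  by case: (f _) => a b /=; rewrite mulNr ?opprK// addrC.
Qed.

Lemma has_fourier_subord a :
  has_fourier (fun x : 'rV[R]_n => a * subord (kapU p y) x)
    (fun xi => a * expR (n%:R / 2 * ln pi) * subord (kapG s y) xi).
Proof.
have sp : s + p = n%:R / 2 by rewrite addrC.
have iU (h : T n -> R) (mh : measurable_fun setT h) M
    (hM : forall t, `|h t| <= M * weight (rV_of t)) :=
  integrable_subord p0 s0 ps (@kapU_ge0 _ p y) (@kapU_le _ p y) (@measurable_kapU _ p y) mh hM.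
have iG (h : T n -> R) (mh : measurable_fun setT h) M
    (hM : forall t, `|h t| <= M * weight (rV_of t)) :=
  integrable_subord s0 p0 sp (@kapG_ge0 _ s y) (@kapG_le _ s y) (@measurable_kapG _ s y) mh hM.
split.
- apply: tempered_of_integrable => h mh M hM; under eq_fun do rewrite -mulrA.
  exact: (integrableZl measurableT a (iU h mh M hM)).
- apply: tempered_of_integrable => h mh M hM; under eq_fun do rewrite -mulrA.
  exact: (integrableZl measurableT _ (iG h mh M hM)).
move=> f sf; have [sr si] := schwartz_ReIm sf.
have iF phi (h : 'rV[R]_n -> R) : rschwartz h -> (lebRn n).-integrable setT
    (EFin \o (fun t : T n => subord (kapU p y) (rV_of t) * rfourier phi h (rV_of t))).
  move=> sh; have [C HC] := rfourier_decay sh.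
  exact: (iU _ (measurable_rfourier phi sh) C (fun t => HC phi _)).
have E phi (h : 'rV[R]_n -> R) (sh : rschwartz h) := subord_rfourier y s0 p0 ps phi sh.
have c0 : cos (- (pi / 2)) = 0 :> R by rewrite cosN cos_pihalf.
have Z c (g : T n -> R) : (lebRn n).-integrable setT (EFin \o g) ->
  \int[lebRn n]_t (c * g t) = c * \int[lebRn n]_t g t.
  by move=> ig; rewrite (RintegralZl _ measurableT ig).
have iH (h : 'rV[R]_n -> R) : rschwartz h -> (lebRn n).-integrable setT
    (EFin \o (fun t : T n => subord (kapG s y) (rV_of t) * h (rV_of t))).
  move=> sh; have [C HC] := rschwartz_weight sh.
  exact: (iG _ (measurable_continuous_rV (rschwartz_continuous sh)) C (fun t => HC _)).
apply: (etrans (distr_ofE _ (fourier f))); apply: (etrans _ (esym (distr_ofE _ f))).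
congr (complex.Complex _ _).
- rewrite [RHS](_ : _ = \int[lebRn n]_t (a * expR (n%:R / 2 * ln pi) *
     (subord (kapG s y) (rV_of t) * complex.Re (f (rV_of t))))); last first.
    by apply: eq_Rintegral => t _; rewrite mulrA.
  rewrite (Z _ _ (iH _ sr)) -mulrA.
  have := E 0 _ sr; rewrite cos0 mul1r => <-.
  (* The sine transform contributes 0 because [cos (- (pi / 2)) = 0]; this zero is added back to
     recombine the real part of [fourier f]. *)
  have := E (- (pi / 2)) _ si; rewrite c0 !mul0r => E0.
  rewrite -[X in a * X]addr0 -[X in a * (_ + X)]E0.
  rewrite -(RintegralD measurableT (iF 0 _ sr) (iF (- (pi / 2)) _ si)).
  rewrite -Z; last exact: (integrableD measurableT (iF 0 _ sr) (iF (- (pi / 2)) _ si)).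
  by apply: eq_Rintegral => t _; rewrite (fourierE sf _).1 mulrDr mulrDr !mulrA.
- rewrite [RHS](_ : _ = \int[lebRn n]_t (a * expR (n%:R / 2 * ln pi) *
     (subord (kapG s y) (rV_of t) * complex.Im (f (rV_of t))))); last first.
    by apply: eq_Rintegral => t _; rewrite mulrA.
  rewrite (Z _ _ (iH _ si)) -mulrA.
  have := E 0 _ si; rewrite cos0 mul1r => <-.
  have := E (- (pi / 2)) _ sr; rewrite c0 !mul0r => E0.
  rewrite -[X in a * X]subr0 -[X in a * (_ - X)]E0.
  rewrite -(RintegralB measurableT (iF 0 _ si) (iF (- (pi / 2)) _ sr)).
  rewrite -Z; last exact: (integrableB measurableT (iF 0 _ si) (iF (- (pi / 2)) _ sr)).
  by apply: eq_Rintegral => t _; rewrite (fourierE sf _).2 mulrBr mulrBr !mulrA.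
Qed.

End fourier_pair.

(** * Identification with the Riesz kernels and their transforms *)

Section special_values.
Context {R : realType}.
Local Notation mu := (@lebesgue_measure R).

(** The integral is infinite and [fine] sends it to 0. This gives the value of [subord] at the
    degenerate points. *)
Lemma Rintegral_ge_eq0 (f : R -> R) c : measurable_fun setT f -> (forall x, 0 <= f x) ->
  0 < c -> (forall x, 0 < x -> c <= f x) -> \int[mu]_x f x = 0.
Proof.
move=> mf f0 c0 cf; rewrite /Rintegral.
suff -> : (\int[mu]_x (f x)%:E = +oo)%E by [].
apply/eqP; rewrite -leye_eq.
have : (c%:E * mu `]0%R, +oo[ <= \int[mu]_x (f x)%:E)%E.
  rewrite -integral_cst//.
  apply: (@le_trans _ _ (\int[mu]_(x in `]0%R, +oo[) (f x)%:E)%E).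
    apply: ge0_le_integral => //.
    - by move=> x _; rewrite lee_fin ltW.
    - exact/measurable_EFinP/measurable_funTS.
    - by move=> x; rewrite /= in_itv/= andbT => x0; rewrite lee_fin cf.
  apply: ge0_subset_integral => //.
  - exact/measurable_EFinP.
  - by move=> x _; rewrite lee_fin.
by rewrite lebesgue_measure_itv/= ltry sube0 gt0_muley.
Qed.

Lemma subord_kapU n p y (x : 'rV[R]_n) : 0 < p ->
  subord (kapU p y) x = gammaL p * (y ^+ 2 + enorm x ^+ 2) `^ (- p).
Proof.
move=> p0; rewrite enorm_sqr /subord /kapU.
have := addr_ge0 (sqr_ge0 y) (dotr_ge0 x); set r := _ + _.
rewrite le_eqVlt => /predU1P[<-|r0].
  rewrite powR0 ?oppr_eq0 ?gt_eqF// mulr0.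
  apply: (@Rintegral_ge_eq0 _ 1) => //.
  - by apply: continuous_measurable_fun; continuity.
  - by move=> z z0; rewrite mul0r subr0 -[leLHS]expR0 ler_expR mulr_ge0// ltW.
rewrite Rintegral_gammaf// mulrC /powR gt_eqF// mulNr//.
Qed.

Lemma dotr0 n : dotr (0 : 'rV[R]_n) 0 = 0.
Proof. by apply/eqP; rewrite dotr_eq0. Qed.

Lemma enorm0 n : enorm (0 : 'rV[R]_n) = 0.
Proof. by rewrite /enorm dotr0 sqrtr0. Qed.

(** At frequency 0 the kernel is bounded below on tau > 0, so the integral diverges; its value 0
    matches the default value of the powers of [enorm 0] on the other side. *)
Lemma subord_kapG0 n s y : 0 < s -> subord (kapG s y) (0 : 'rV[R]_n) = 0.
Proof.
move=> s0; rewrite /subord /kapG dotr0.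
apply: (@Rintegral_ge_eq0 _ (expR (- y ^+ 2))); last 2 first.
- exact: expR_gt0.
- move=> z z0; rewrite ler_expR mulr0 mul0r subr0.
  have h1 : 0 <= s * z by rewrite mulr_ge0// ltW.
  have h2 : y ^+ 2 * expR (- z) <= y ^+ 2.
    by rewrite ler_piMr ?sqr_ge0// -[leRHS]expR0 ler_expR oppr_le0 ltW.
  lra.
- by apply: continuous_measurable_fun; continuity.
- by move=> z; exact: expR_ge0.
Qed.

Lemma enorm_gt0 n (x : 'rV[R]_n) : x != 0 -> 0 < enorm x.
Proof.
move=> x0; rewrite lt_neqAle enorm_ge0 andbT eq_sym; apply: contra x0 => /eqP e.
by rewrite -dotr_eq0 -enorm_sqr e expr0n.
Qed.

(** Translating tau by - 2 ln (pi |xi|) normalizes the coefficient pi^2 |xi|^2 of exp tau to 1 and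
    turns y^2 into (pi y |xi|)^2. *)
Lemma subord_kapG n s y (xi : 'rV[R]_n) : xi != 0 ->
  subord (kapG s y) xi = expR (- (2 * s * ln (pi * enorm xi))) * mac s ((pi * y * enorm xi) ^+ 2).
Proof.
move=> xi0; have q0 := enorm_gt0 xi0.
have P0 : 0 < (pi : R) * enorm xi by rewrite mulr_gt0// pi_gt0.
set L := ln _.
rewrite /subord /Rintegral -(@integral_shift _ _ (- (2 * L))); last 2 first.
- by rewrite /kapG; continuity.
- by move=> x; exact: kapG_ge0.
rewrite -[LHS]/(Rintegral _ _ _) /mac.
have ex : expR (2 * L) = (pi * enorm xi) ^+ 2 by rewrite expRM_natl lnK.
have F x : kapG s y (x - 2 * L) (dotr xi xi) =
    macf s ((pi * y * enorm xi) ^+ 2) x * expR (- (2 * s * L)).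
  rewrite /kapG /macf -expRD; congr expR.
  rewrite -enorm_sqr opprB [2 * L - x]addrC !expRD [expR (- (2 * L))]expRN ex.
  move: P0; rewrite pmulr_lgt0// => P0.
  move: (enorm xi) (pi : R) (expR x) (expR (- x)) q0 P0 => q P a b q0 P0.
  by field; rewrite !gt_eqF.
under eq_Rintegral do rewrite F.
rewrite [RHS]mulrC; apply: ge0_RintegralZr; first exact: measurable_macf.
by move=> x; exact: macf_ge0.
Qed.

Variables (n : nat) (s : R).
Hypotheses (s01 : 0 < s < 1) (sn : 0 < n%:R / 2 - s).
Let p : R := n%:R / 2 - s.
Let s0 : 0 < s. Proof. by case/andP: s01. Qed.

(** The constant (4^s Gamma(s))^-1: what remains of [riesz_const] once the Gamma(p) of Euler's
    integral and the pi^(n/2) of the Gaussian transforms are accounted for. *)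
Definition riesz_hat_const := (expR (2 * s * ln 2) * gammaL s)^-1.

Lemma riesz_constE : riesz_const n s / gammaL p * expR (n%:R / 2 * ln pi) = riesz_hat_const.
Proof.
rewrite /riesz_const /riesz_hat_const !GammaE//.
have -> : 2 `^ (2 * s) = expR (2 * s * ln 2) :> R by rewrite /powR gt_eqF.
have -> : pi `^ (n%:R / 2) = expR (n%:R / 2 * ln pi) :> R by rewrite /powR gt_eqF// pi_gt0.
have := gammaL_gt0 sn; have := gammaL_gt0 s0; rewrite -/p.
have := expR_gt0 (n%:R / 2 * ln (pi : R)); have := expR_gt0 (2 * s * ln 2 : R).
move: (gammaL s) (gammaL p) (expR _) (expR _) => a b c d a0 b0 c0 d0.
by field; rewrite !gt_eqF.
Qed.

Lemma riesz_regE y (x : 'rV[R]_n) :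
  riesz_reg s y x = riesz_const n s / gammaL p * subord (kapU p y) x.
Proof.
rewrite subord_kapU// mulrA divfK ?gt_eqF ?gammaL_gt0// /riesz_reg.
by congr (_ * _ `^ _); rewrite /p; field.
Qed.

Lemma rieszE (x : 'rV[R]_n) : riesz s x = riesz_reg s 0 x.
Proof.
rewrite /riesz_reg /riesz expr0n add0r -powR_mulrn ?enorm_ge0// -powRrM.
by congr (_ * _ `^ _); field.
Qed.

Definition riesz_hat y (xi : 'rV[R]_n) := riesz_hat_const * subord (kapG s y) xi.

Lemma riesz_reg_hatE y (xi : 'rV[R]_n) : 0 < y -> riesz_reg_hat s y xi = riesz_hat y xi.
Proof.
move=> y0; have [->|xi0] := eqVneq xi 0.
  rewrite /riesz_hat subord_kapG0// mulr0 /riesz_reg_hat.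
  rewrite enorm0.
  by rewrite powR0 ?oppr_eq0 ?gt_eqF// mulr0 mul0r.
have q0 := enorm_gt0 xi0.
have P0 : 0 < (pi : R) := pi_gt0 R.
rewrite /riesz_hat subord_kapG// /riesz_reg_hat /riesz_hat_const GammaE// besselKE//; last first.
  by rewrite !mulr_gt0.
have -> : 2 * pi * y * enorm xi / 2 = pi * y * enorm xi.
  by move: (pi : R) => P; field.
rewrite !mulrA; congr (_ * _).
rewrite !(lnM, posrE) ?mulr_gt0//.
rewrite /powR !gt_eqF//.
have -> : expR ((2 * s - 1) * ln 2) = expR (2 * s * ln 2) / 2 :> R.
  by rewrite mulrBl mul1r expRD expRN lnK// posrE.
have -> : - (2 * s * (ln pi + ln (enorm xi))) = s * ln y - s * ln pi - s * ln (enorm xi)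
   - s * (ln pi + ln y + ln (enorm xi)) by ring.
rewrite !expRD !expRN.
have := gammaL_gt0 s0.
have := expR_gt0 (s * ln y); have := expR_gt0 (s * ln (pi : R)).
have := expR_gt0 (s * ln (enorm xi)); have := expR_gt0 (2 * s * ln 2 : R).
have := expR_gt0 (s * (ln pi + ln y + ln (enorm xi))).
rewrite mulNr expRN.
move: (gammaL s) (expR _) (expR _) (expR _) (expR _) (expR _) => a b c d e f a0 b0 c0 d0 e0 f0.
by field; rewrite !gt_eqF.
Qed.

Lemma riesz_hatE (xi : 'rV[R]_n) : (2 * pi * enorm xi) `^ (- (2 * s)) = riesz_hat 0 xi.
Proof.
have [->|xi0] := eqVneq xi 0.
  rewrite /riesz_hat subord_kapG0// mulr0.
  rewrite enorm0.
  by rewrite mulr0 powR0// oppr_eq0 mulf_neq0 ?gt_eqF.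
have q0 := enorm_gt0 xi0; have P0 : 0 < (pi : R) := pi_gt0 R.
rewrite /riesz_hat subord_kapG// mulr0 mul0r expr0n mac0 /riesz_hat_const.
rewrite /powR gt_eqF ?mulr_gt0// invfM mulrACA mulVf ?gt_eqF ?gammaL_gt0// mulr1.
rewrite -expRN -expRD -mulrA lnM ?posrE ?mulr_gt0//; congr expR; ring.
Qed.

(** In the form [riesz_hat] the factor y^s is gone and y survives only in the argument of [mac],
    whose limit at 0 is [gammaL s]. *)
Lemma cvg_riesz_reg_hat (xi : 'rV[R]_n) : xi != 0 ->
  riesz_reg_hat s y xi @[y --> 0^'+] --> (2 * pi * enorm xi) `^ (- (2 * s)).
Proof.
move=> xi0; apply/cvg_at_rightP => u [u0 uc].
have E k : riesz_reg_hat s (u k) xi = riesz_hat_const * (expR (- (2 * s * ln (pi * enorm xi))) *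
    mac s ((pi * u k * enorm xi) ^+ 2)).
  by rewrite riesz_reg_hatE// /riesz_hat subord_kapG.
under eq_fun do rewrite E.
rewrite riesz_hatE /riesz_hat subord_kapG// mulr0 mul0r expr0n mac0.
apply: cvgMr; apply: cvgMr; apply: cvg_mac => //; first by move=> k; exact: sqr_ge0.
have h : pi * u k * enorm xi @[k --> \oo] --> pi * 0 * enorm xi.
  by apply: cvgMl; exact: cvgMr.
have := cvgM h h; rewrite mulr0 mul0r mul0r; exact.
Qed.

End special_values.

Theorem lemma8p5 (R : realType) (n : nat) (s : R)
  (hs0 : 0 < s) (hs1 : s < 1)
  (hn : (2 <= n)%N \/ n = 1%N /\ s < 1 / 2) :
  (forall y : R, 0 < y ->
     has_fourier (fun x : 'rV[R]_n => riesz_reg s y x)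
                 (fun xi : 'rV[R]_n => riesz_reg_hat s y xi)) /\
  has_fourier (fun x : 'rV[R]_n => riesz s x)
              (fun xi : 'rV[R]_n => (2 * pi * enorm xi) `^ (- (2 * s))) /\
  (forall xi : 'rV[R]_n, xi != 0 ->
     riesz_reg_hat s y xi @[y --> 0^'+] --> (2 * pi * enorm xi) `^ (- (2 * s))).
Proof.
have s01 : 0 < s < 1 by rewrite hs0.
(* The hypothesis on the dimension enters here, as p = n/2 - s > 0, which makes Euler's integral for
   the kernel converge. *)
have sn : 0 < n%:R / 2 - s.
  case: hn => [n2|[-> s2]]; last by rewrite subr_gt0.
  have : 2 <= n%:R :> R by rewrite ler_nat.
  lra.
have F y := has_fourier_subord y hs0 sn (subrK s (n%:R / 2)) (riesz_const n s / gammaL (n%:R / 2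
  - s)).
have G y : has_fourier (fun x : 'rV[R]_n => riesz_reg s y x) (riesz_hat s y).
  have -> : (fun x : 'rV[R]_n => riesz_reg s y x) =
      fun x => riesz_const n s / gammaL (n%:R / 2 - s) * subord (kapU (n%:R / 2 - s) y) x.
    by apply/funext => x; exact: riesz_regE.
  by have := F y; rewrite riesz_constE.
split=> [y y0|].
  have -> : (fun xi : 'rV[R]_n => riesz_reg_hat s y xi) = riesz_hat s y.
    by apply/funext => xi; exact: riesz_reg_hatE.
  exact: G.
split.
  have -> : (fun x : 'rV[R]_n => riesz s x) = (fun x : 'rV[R]_n => riesz_reg s 0 x).
    by apply/funext => x; exact: rieszE.
  have -> : (fun xi : 'rV[R]_n => (2 * pi * enorm xi) `^ (- (2 * s))) = riesz_hat s 0.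
    by apply/funext => xi; exact: riesz_hatE.
  exact: G.
by move=> xi xi0; exact: cvg_riesz_reg_hat.
Qed.
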